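(* Let $D\subseteq\mathbb{C}^n$ be a domain and let $\mathcal{F}$ be a family of holomorphic functions $f:D\to\mathbb{C}$. Assume that for each compact subset $K\subset D$ there exist a set $E=E(K)\subset\mathbb{C}$ consisting of two distinct points and a constant $M=M(K)>0$ such that, for every $f\in\mathcal{F}$, $$f^{\sharp}(z)\le M\quad\text{and}\quad (f_{z_k})^{\sharp}(z)\le M\quad\text{whenever } z\in K,\ f(z)\in E,\ k=1,2,\dots,n.$$ Then $\mathcal{F}$ is normal on $D$.
   Context: $f_{z_k}=\frac{\partial f}{\partial z_k}$. A family $\mathcal{F}$ of holomorphic functions $f:D\to\mathbb{C}$ on a domain $D\subseteq\mathbb{C}^n$ is normal on $D$ if every sequence in $\mathcal{F}$ contains a subsequence that converges locally uniformly on $D$ to a limit function which is either holomorphic on $D$ or identically equal to $\infty$. For a holomorphic function $f$ on $D$ and $z\in D$, the spherical derivative is $$f^{\sharp}(z)=\sup_{|v|=1}\sqrt{L_z(\log(1+|f|^2),v)}=\sup_{|v|=1}\frac{|Df(z)v|}{1+|f(z)|^2},$$ where the supremum is over $v=(v_1,\dots,v_n)\in\mathbb{C}^n$ with Euclidean norm $|v|=1$, $L_z(\psi,v)=\sum_{k,l=1}^n\frac{\partial^2\psi}{\partial z_k\partial\bar z_l}(z)v_k\bar v_l$ is the Levi form of $\psi\in\mathcal{C}^2(D)$ at $z$, and $Df(z)v=\sum_{k=1}^n\frac{\partial f}{\partial z_k}(z)v_k$. The quantity $(f_{z_k})^{\sharp}$ is the spherical derivative of the holomorphic function $f_{z_k}$.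 *)

(* Defs.v *)
From HB Require Import structures.
From mathcomp Require Import all_boot all_order all_algebra.
From mathcomp Require Import all_classical all_reals all_analysis.
From mathcomp Require Import complex.
Set Implicit Arguments.
Unset Strict Implicit.
Unset Printing Implicit Defensive.
Import Order.TTheory GRing.Theory Num.Theory numFieldNormedType.Exports.
Import ComplexField.Normc.
Local Open Scope classical_set_scope.
Local Open Scope ring_scope.
Local Open Scope complex_scope.

(* R[i] carries the topology and norm that numFieldNormedType gives to every
   abstract numFieldType; canonical inference does not find them on the
   concrete type [complex R]. *)
HB.instance Definition _ (R : realType) :=
  PseudoPointedMetric.copy R[i] (R[i] : numClosedFieldType)^o.
HB.instance Definition _ (R : realType) :=
  GRing.ComAlgebra.copy R[i] (R[i] : numClosedFieldType)^o.
HB.instance Definition _ (R : realType) :=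
  Vector.copy R[i] (R[i] : numClosedFieldType)^o.
HB.instance Definition _ (R : realType) :=
  NormedModule.copy R[i] (R[i] : numClosedFieldType)^o.

(* Points of C^n are row vectors over R[i]. Functions D -> C are encoded as
   total functions on C^n; only their values on D matter below. The library
   norm on row vectors is the max norm: it gives the usual topology, but the
   Euclidean norm has to be written explicitly. *)

Section SeveralComplexVariables.
Context {R : realType} {n : nat}.
Implicit Types (D : set 'rV[R[i]]_n) (f g : 'rV[R[i]]_n -> R[i])
  (u : nat -> 'rV[R[i]]_n -> R[i]) (z v : 'rV[R[i]]_n).

Definition domain D : Prop := [/\ open D, connected D & D !=set0].

(* [differentiable] over the field R[i] is complex Frechet
   differentiability. *)
Definition holomorphic_on D f : Prop :=
  forall z, D z -> differentiable f z.

Definition partial (k : 'I_n) f : 'rV[R[i]]_n -> R[i] :=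
  fun z => 'D_(delta_mx 0 k) f z.

Definition Dfv f z v : R[i] := \sum_(k < n) partial k f z * v 0 k.

Definition eucl_norm v : R := Num.sqrt (\sum_(k < n) normc (v 0 k) ^+ 2).

Definition spherical_deriv f z : R :=
  sup [set normc (Dfv f z v) / (1 + normc (f z) ^+ 2)
      | v in [set v | eucl_norm v = 1]].

Definition loc_unif_cvg D u g : Prop :=
  forall z, D z -> exists2 U, nbhs z U & {uniform U `&` D, u @ \oo --> g}.

(* Locally uniform convergence to the constant infinity. *)
Definition loc_unif_cvg_infty D u : Prop :=
  forall z, D z -> exists2 U, nbhs z U &
    forall B : R, \forall m \near \oo,
      forall w, (U `&` D) w -> B < normc (u m w).

Definition normal_family D (F : set ('rV[R[i]]_n -> R[i])) : Prop :=
  forall u, (forall m, F (u m)) ->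
    exists2 s : nat -> nat, {homo s : i j / (i < j)%N} &
      (exists2 g, holomorphic_on D g & loc_unif_cvg D (u \o s) g)
      \/ loc_unif_cvg_infty D (u \o s).

End SeveralComplexVariables.

(* Main.v *)
(** By Marty's criterion it suffices to bound the spherical derivatives locally
    uniformly, and this can be done on discs in the coordinate directions. If
    they were unbounded there, Zalcman rescaling would produce an entire function
    g with g'(0) <> 0. The rescaling factors tend to 0, so by Hurwitz the bounds
    on f^# and on the spherical derivative of f_{z_k} at the points of E = {a, b}
    pass to the limit as g' = g'' = 0 wherever g is a or b: all a-points and
    b-points of g have multiplicity at least 3. Since 1/3 + 1/3 < 1, the plane
    carries an explicit negatively curved metric with cone points at a and b
    whose pullback by g vanishes at these points, and Ahlfors' lemma on larger
    and larger discs gives g'(0) = 0, a contradiction. *)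
Require Import Defs.
From HB Require Import structures.
From mathcomp Require Import all_boot all_order all_algebra.
From mathcomp Require Import all_classical all_reals all_analysis.
From mathcomp Require Import complex.
From mathcomp Require Import ring lra zify.
Set Implicit Arguments.
Unset Strict Implicit.
Unset Printing Implicit Defensive.
Import Order.TTheory GRing.Theory Num.Theory numFieldNormedType.Exports.
Import ComplexField.Normc.
Local Open Scope classical_set_scope.
Local Open Scope ring_scope.
Local Open Scope complex_scope.

(** Everything rests on explicit estimates drawn from complex differentiability alone. In place of
    Cauchy's integral formula stands a maximum principle with a lossy factor 2, obtained from
    trapezoidal sums over squares; sharp constants never matter, since the limit arguments only need
    bounds uniform in the family.

    Compactness is used along an ultrafilter containing the tails of the natural numbers. Bounded
    sequences then have pointwise limits, uniform Lipschitz and Taylor bounds make these limits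
    locally uniform and holomorphic, and a genuine subsequence is chosen only at the very end. One
    version of Marty's criterion, on a normed space with compact balls, thus serves both the
    rescaled functions on the plane and the family on C^n.

    Pure second derivatives suffice: along a line in direction e_k the second derivative of f is the
    k-th partial derivative of f_{z_k}. Where f takes a value in E, the bound on the spherical
    derivative of f controls f_{z_k}, and then the bound on that of f_{z_k} controls this second
    derivative. *)

Section Norm.
Context {R : realType}.
Implicit Types (x y z : R[i]).

Lemma normcE2 z : normc z ^+ 2 = complex.Re z ^+ 2 + complex.Im z ^+ 2.
Proof. by case: z => a b /=; rewrite sqr_sqrtr // addr_ge0 // sqr_ge0. Qed.

Lemma normc_ge0 z : 0 <= normc z.
Proof. by case: z => a b /=; exact: sqrtr_ge0. Qed.

Lemma normc_eq0 z : (normc z == 0) = (z == 0).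
Proof. by apply/eqP/eqP => [/eq0_normc //|->]; rewrite normc0. Qed.

Lemma normc_gt0 z : (0 < normc z) = (z != 0).
Proof. by rewrite lt_def normc_ge0 andbT normc_eq0. Qed.

Lemma normcB x y : normc (x - y) = normc (y - x).
Proof. by rewrite -[LHS]normcN opprB. Qed.

Lemma normc_real (r : R) : normc r%:C = `|r|.
Proof. by rewrite /= expr0n addr0 sqrtr_sqr. Qed.

Lemma normc_nat k : normc (k%:R : R[i]) = k%:R.
Proof. by rewrite -(rmorph_nat (real_complex R)) normc_real ger0_norm. Qed.

Lemma normc_Im (r : R) : normc (r *i) = `|r|.
Proof. by rewrite /= expr0n add0r sqrtr_sqr. Qed.

Lemma normc_i : normc ('i%C : R[i]) = 1.
Proof. by rewrite normc_Im normr1. Qed.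

Lemma le_Re_normc z : `|complex.Re z| <= normc z.
Proof.
rewrite -(@ler_pXn2r _ 2) ?nnegrE ?normc_ge0 ?normr_ge0//.
by rewrite normcE2 -normrX ger0_norm ?sqr_ge0// lerDl sqr_ge0.
Qed.

Lemma le_Im_normc z : `|complex.Im z| <= normc z.
Proof.
rewrite -(@ler_pXn2r _ 2) ?nnegrE ?normc_ge0 ?normr_ge0//.
by rewrite normcE2 -normrX ger0_norm ?sqr_ge0// lerDr sqr_ge0.
Qed.

Lemma normc_le_ReIm z : normc z <= `|complex.Re z| + `|complex.Im z|.
Proof.
rewrite -normc_real -[`|complex.Im z|]normc_Im.
by apply: le_trans (le_normcD _ _); case: z => a b; simpc.
Qed.

Lemma normcX z n : normc (z ^+ n) = normc z ^+ n.
Proof. by elim: n => [|n IH]; rewrite ?expr0 ?normc1// !exprS normcM IH. Qed.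

Lemma normc_div x y : normc (x / y) = normc x / normc y.
Proof. by rewrite normcM normcV. Qed.

Lemma le_normc_sum (I : Type) (r : seq I) (P : pred I) (F : I -> R[i]) :
  normc (\sum_(i <- r | P i) F i) <= \sum_(i <- r | P i) normc (F i).
Proof.
elim/big_rec2: _ => [|i a b _ h]; first by rewrite normc0.
by rewrite (le_trans (le_normcD _ _))// lerD2l.
Qed.

Lemma normrc_normc z : `|z| = (normc z)%:C.
Proof. by []. Qed.

Lemma le_normc_sub x y : normc x - normc y <= normc (x - y).
Proof. by rewrite lerBlDr -{1}(subrK y x) le_normcD. Qed.

End Norm.

(** * Bisection arguments *)

Section Cousin.
Context {R : realType}.

Lemma nested_intervals (x l : nat -> R) :
  (forall n, 0 <= l n) -> (forall n, x n <= x n.+1) ->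
  (forall n, x n.+1 + l n.+1 <= x n + l n) ->
  exists c, forall n, x n <= c <= x n + l n.
Proof.
move=> l0 xi xl.
have xm m n : (m <= n)%N -> x m <= x n.
  elim: n => [|n IH]; first by rewrite leqn0 => /eqP ->.
  rewrite leq_eqVlt => /predU1P[->//|]; rewrite ltnS => /IH h.
  exact: le_trans h (xi n).
have xd m n : (m <= n)%N -> x n + l n <= x m + l m.
  elim: n => [|n IH]; first by rewrite leqn0 => /eqP ->.
  rewrite leq_eqVlt => /predU1P[->//|]; rewrite ltnS => /IH h.
  exact: le_trans (xl n) h.
have ub n m : x m <= x n + l n.
  case: (leqP m n) => h.
    by rewrite (le_trans (xm _ _ h))// lerDl.
  by rewrite (le_trans _ (xd _ _ (ltnW h)))// lerDl.
have hs : has_sup (range x).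
  split; first by exists (x 0%N); exists 0%N.
  by exists (x 0%N + l 0%N) => _ [m _ <-].
exists (sup (range x)) => n; apply/andP; split.
  by apply: ub_le_sup; [case: hs|exists n].
by apply: ge_sup; [case: hs|move=> _ [m _ <-]].
Qed.

Lemma exists_half_lt (l d : R) : 0 < d -> exists n, l / 2 ^+ n < d.
Proof.
move=> d0; exists (Num.truncn (`|l| / d)).+1.
rewrite ltr_pdivrMr ?exprn_gt0//.
apply: (le_lt_trans (ler_norm l)).
rewrite mulrC -ltr_pdivrMr//.
apply: (lt_le_trans (truncnS_gt _)).
by rewrite -natrX ler_nat; exact/ltnW/ltn_expl.
Qed.

(** Repeated quartering: were [P] to fail, it would fail on a quarter, on a quarter of that, and so
    on, and the nested bad squares would shrink to a point near which the local hypothesis forces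
    [P]. Goursat's lemma and the compactness of closed discs both come from this principle. *)
Lemma cousin_square (P : R -> R -> R -> Prop) (x0 y0 l0 : R) : 0 < l0 ->
  (forall x y l, 0 < l -> P x y (l / 2) -> P (x + l / 2) y (l / 2) ->
    P x (y + l / 2) (l / 2) -> P (x + l / 2) (y + l / 2) (l / 2) -> P x y l) ->
  (forall a b, x0 <= a <= x0 + l0 -> y0 <= b <= y0 + l0 ->
    exists2 d, 0 < d & forall x y l, 0 < l < d ->
      x0 <= x <= a -> a <= x + l <= x0 + l0 ->
      y0 <= y <= b -> b <= y + l <= y0 + l0 -> P x y l) ->
  P x0 y0 l0.
Proof.
move=> l00 split_P loc_P; apply: contrapT => nP.
(* [p] carries the corner of a square and the number of quarterings so far; [q] is the corner of a
   quarter on which [P] still fails. *)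
pose good (p : R * R * nat) (q : R * R) :=
  ~ P p.1.1 p.1.2 (l0 / 2 ^+ p.2) ->
  [/\ ~ P q.1 q.2 (l0 / 2 ^+ p.2.+1),
      (q.1 = p.1.1) \/ (q.1 = p.1.1 + l0 / 2 ^+ p.2.+1) &
      (q.2 = p.1.2) \/ (q.2 = p.1.2 + l0 / 2 ^+ p.2.+1)].
have [f fP] : {f & forall p, good p (f p)}.
  apply: choice => -[[x y] n]; rewrite /good /=.
  have [h|h] := pselect (P x y (l0 / 2 ^+ n)); first by exists (x, y).
  have e : l0 / 2 ^+ n.+1 = l0 / 2 ^+ n / 2 by rewrite exprSr invfM mulrA.
  rewrite e; move: h; set l := l0 / 2 ^+ n => h.
  have l_gt0 : 0 < l by rewrite divr_gt0// exprn_gt0.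
  have [p1|p1] := pselect (P x y (l / 2)); last first.
    by exists (x, y) => _; split=> //=; left.
  have [p2|p2] := pselect (P (x + l / 2) y (l / 2)); last first.
    by exists (x + l / 2, y) => _; split=> //=; [right|left].
  have [p3|p3] := pselect (P x (y + l / 2) (l / 2)); last first.
    by exists (x, y + l / 2) => _; split=> //=; [left|right].
  have [p4|p4] := pselect (P (x + l / 2) (y + l / 2) (l / 2)); last first.
    by exists (x + l / 2, y + l / 2) => _; split=> //=; right.
  by exfalso; apply: h; apply: split_P.
pose s := fix s n : R * R := if n is m.+1 then f (s m, m) else (x0, y0).
pose l n := l0 / 2 ^+ n.
have l_gt0 n : 0 < l n by rewrite divr_gt0// exprn_gt0.
have lS n : l n.+1 = l n / 2 by rewrite /l exprSr invfM mulrA.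
have bad n : ~ P (s n).1 (s n).2 (l n).
  elim: n => [|n IH]; first by rewrite /l /= expr0 divr1.
  by have [] := fP (s n, n) IH.
have step n := fP (s n, n) (bad n).
have [a aP] : exists c, forall n, (s n).1 <= c <= (s n).1 + l n.
  apply: nested_intervals => n; first exact/ltW.
  - have [_ + _] := step n; rewrite /= -/(l n.+1); have := l_gt0 n.+1.
    by move=> ? [] ->; lra.
  - have [_ + _] := step n; rewrite /= -/(l n.+1) lS; have := l_gt0 n.
    by move=> ? [] ->; lra.
have [b bP] : exists c, forall n, (s n).2 <= c <= (s n).2 + l n.
  apply: nested_intervals => n; first exact/ltW.
  - have [_ _] := step n; rewrite /= -/(l n.+1); have := l_gt0 n.+1.
    by move=> ? [] ->; lra.
  - have [_ _] := step n; rewrite /= -/(l n.+1) lS; have := l_gt0 n.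
    by move=> ? [] ->; lra.
have ins n : [/\ x0 <= (s n).1, (s n).1 + l n <= x0 + l0,
    y0 <= (s n).2 & (s n).2 + l n <= y0 + l0].
  elim: n => [|n [h1 h2 h3 h4]].
    by rewrite /l /= expr0 divr1; split.
  have [_] := step n; rewrite /= -/(l n.+1) lS; have := l_gt0 n.
  by move=> lp [] -> [] ->; split; clear -h1 h2 h3 h4 lp; lra.
have la0 : l 0%N = l0 by rewrite /l expr0 divr1.
have [||d d0 dP] := loc_P a b.
- by have := aP 0%N; rewrite la0.
- by have := bP 0%N; rewrite la0.
have [n nd] := @exists_half_lt l0 d d0.
apply: (bad n); have [h1 h2 h3 h4] := ins n.
have := aP n; have := bP n => /andP[? ?] /andP[? ?].
by apply: dP; apply/andP; split=> //; exact: l_gt0.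
Qed.

(** An interval is treated as the first side of a square whose second coordinate is ignored. It
    takes the place of the mean value theorem below. *)
Lemma cousin_segment (P : R -> R -> Prop) :
  (forall a m b, a <= m <= b -> P a m -> P m b -> P a b) ->
  (forall t, 0 <= t <= 1 -> exists2 d, 0 < d & forall a b,
     0 <= a <= t -> t <= b <= 1 -> b - a < d -> P a b) ->
  P 0 1.
Proof.
move=> tr loc.
suff : P 0 (0 + 1) by rewrite add0r.
apply: (@cousin_square (fun x _ l => P x (x + l)) 0 0 1) => //.
  move=> x y l l0 p1 p2 _ _ {y}; apply: (tr _ (x + l / 2)) => //; first by lra.
  by have -> : x + l = x + l / 2 + l / 2 by lra.
move=> a ? ha _; have [|d d0 dP] := loc a; first by lra.
exists d => // x y l l0 *; apply: dP; lra.
Qed.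

End Cousin.

(** * Cauchy estimates on the disc *)

Section Goursat.
Context {R : realType}.
Implicit Types (q f : R[i] -> R[i]) (z w d l : R[i]).

(** Written without a quotient, so that [h = 0] needs no exception and the same shape serves for
    Fréchet derivatives in [Dat]. *)
Definition cderiv f z l : Prop := forall e : R, 0 < e ->
  exists2 r : R, 0 < r & forall h, normc h < r ->
    normc (f (z + h) - f z - l * h) <= e * normc h.

(* Contour integrals are replaced by trapezoidal sums: like integrals they
   vanish on affine functions around a square and are additive under
   subdivision, so the bisection proof of Goursat's lemma applies to them. *)
Definition edge q z d (n : nat) : R[i] :=
  \sum_(k < n) (q (z + k%:R * d) + q (z + k.+1%:R * d)) / 2 * d.

Definition square q z d (n : nat) : R[i] :=
  edge q z d n + edge q (z + n%:R * d) ('i%C * d) n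
  - edge q (z + n%:R * ('i%C * d)) d n - edge q z ('i%C * d) n.

Lemma edge_cat q z d m n :
  edge q z d (m + n) = edge q z d m + edge q (z + m%:R * d) d n.
Proof.
rewrite /edge big_split_ord /=; congr (_ + _).
apply: eq_bigr => k _; congr (_ / 2 * d); congr (q _ + q _); rewrite -?addnS natrD; ring.
Qed.

Lemma edgeB q p z d n :
  edge (fun w => q w - p w) z d n = edge q z d n - edge p z d n.
Proof. by rewrite /edge -sumrB; apply: eq_bigr => k _; field. Qed.

Lemma edgeZ a q z d n : edge (fun w => a * q w) z d n = a * edge q z d n.
Proof. by rewrite /edge big_distrr; apply: eq_bigr => k _ /=; field. Qed.

Lemma edge_affine a b z d n : edge (fun w => a + b * w) z d n =
  n%:R * d * a + b * ((z + n%:R * d) ^+ 2 - z ^+ 2) / 2.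
Proof.
elim: n => [|n IH]; first by rewrite /edge big_ord0; field.
by rewrite /edge in IH *; rewrite big_ord_recr /= IH -natr1; field.
Qed.

Lemma edge_le q z d n (M : R) :
  (forall k, (k <= n)%N -> normc (q (z + k%:R * d)) <= M) ->
  normc (edge q z d n) <= n%:R * normc d * M.
Proof.
move=> h; rewrite /edge (le_trans (le_normc_sum _ _ _))//.
rewrite (@le_trans _ _ (\sum_(k < n) normc d * M))//; last first.
  by rewrite sumr_const card_ord -mulrA mulr_natl.
apply: ler_sum => k _; rewrite normcM mulrC ler_wpM2l ?normc_ge0//.
rewrite normc_div.
rewrite normc_nat.
rewrite ler_pdivrMr// (le_trans (le_normcD _ _))// mulr_natr mulr2n.
by apply: lerD; apply: h; [exact: ltnW|].
Qed.

Lemma squareB q p z d n :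
  square (fun w => q w - p w) z d n = square q z d n - square p z d n.
Proof. rewrite /square !edgeB; ring. Qed.

Lemma squareZ a q z d n : square (fun w => a * q w) z d n = a * square q z d n.
Proof. by rewrite /square !edgeZ; ring. Qed.

Lemma square_affine a b z d n : square (fun w => a + b * w) z d n = 0.
Proof. by rewrite /square !edge_affine; field. Qed.

(** Inner edges are met twice with opposite signs and cancel. *)
Lemma square_split q z d n : square q z d (n + n) =
  square q z d n + square q (z + n%:R * d) d n +
  square q (z + n%:R * ('i%C * d)) d n +
  square q (z + n%:R * d + n%:R * ('i%C * d)) d n.
Proof.
rewrite /square !edge_cat natrD !mulrDl.
move: (n%:R * d) (n%:R * ('i * d)) => a b.
have -> : z + (a + a) = z + a + a by ring.
have -> : z + (b + b) = z + b + b by ring.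
have -> : z + b + a = z + a + b by ring.
have -> : z + b + b + a = z + a + b + b by ring.
have -> : z + a + b + a = z + a + a + b by ring.
ring.
Qed.

Lemma square_le q (x y : R) (d : R) n (M : R) : 0 <= d ->
  (forall w, x <= complex.Re w <= x + n%:R * d ->
     y <= complex.Im w <= y + n%:R * d -> normc (q w) <= M) ->
  normc (square q (x +i* y) d%:C n) <= 4 * (n%:R * d) * M.
Proof.
move=> d0 h.
have nd : normc d%:C = d by rewrite normc_real ger0_norm.
have nid : normc ('i%C * d%:C) = d by rewrite normcM normc_i mul1r.
have nRC (k : nat) : (k%:R : R[i]) = (k%:R : R)%:C by rewrite rmorph_nat.
have kn k : (k <= n)%N -> 0 <= k%:R * d <= n%:R * d.
  by move=> kn; rewrite mulr_ge0//= ler_wpM2r// ler_nat.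
have n0 : 0 <= n%:R * d by rewrite mulr_ge0.
have -> : 4 * (n%:R * d) * M = n%:R * d * M + n%:R * d * M + n%:R * d * M + n%:R * d * M.
  by ring.
rewrite /square (le_trans (le_normcD _ _))// lerD//; last first.
  rewrite normcN (le_trans (edge_le (M := M) _)) ?nid// => k /kn /andP[k1 k2].
  by apply: h; rewrite nRC /=; simpc => /=; apply/andP; split; lra.
rewrite (le_trans (le_normcD _ _))// lerD//; last first.
  rewrite normcN (le_trans (edge_le (M := M) _)) ?nd// => k /kn /andP[k1 k2].
  by apply: h; rewrite !nRC /=; simpc => /=; apply/andP; split; lra.
rewrite (le_trans (le_normcD _ _))// lerD//.
  rewrite (le_trans (edge_le (M := M) _)) ?nd// => k /kn /andP[k1 k2].
  by apply: h; rewrite nRC /=; simpc => /=; apply/andP; split; lra.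
rewrite (le_trans (edge_le (M := M) _)) ?nid// => k /kn /andP[k1 k2].
by apply: h; rewrite !nRC /=; simpc => /=; apply/andP; split; lra.
Qed.

(** A bound proportional to the area adds up over four quarters. On a small square about a point the
    affine approximation contributes nothing, and the remainder is at most [e / 8] times a distance
    of at most [2 l], over a perimeter [4 l]. The threshold [N0] is there because a sum with [2 ^ N]
    steps per side can be quartered only [N] times. *)
Lemma goursat q (x0 y0 l0 : R) : 0 < l0 ->
  (forall w, x0 <= complex.Re w <= x0 + l0 -> y0 <= complex.Im w <= y0 + l0 ->
     exists l, cderiv q w l) ->
  forall e : R, 0 < e -> exists N0, forall N, (N0 <= N)%N ->
    normc (square q (x0 +i* y0) (l0 / 2 ^+ N)%:C (2 ^ N)) <= e * l0 ^+ 2.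
Proof.
move=> l00 hq e e0.
pose P (x y l : R) := exists N0, forall N, (N0 <= N)%N ->
  normc (square q (x +i* y) (l / 2 ^+ N)%:C (2 ^ N)) <= e * l ^+ 2.
have pow2 (l : R) N : ((2 ^ N)%:R : R[i]) * (l / 2 ^+ N)%:C = l%:C.
  have -> : ((2 ^ N)%:R : R[i]) = (2 ^+ N : R)%:C by rewrite rmorphXn rmorph_nat natrX.
  by rewrite -rmorphM mulrC divfK// expf_neq0.
apply: (@cousin_square _ P) => //.
  move=> x y l l_gt0 [N1 h1] [N2 h2] [N3 h3] [N4 h4].
  exists (N1 + N2 + N3 + N4).+1 => -[//|N]; rewrite ltnS => hN.
  rewrite expnS mul2n -addnn square_split.
  have -> : l / 2 ^+ N.+1 = l / 2 / 2 ^+ N by rewrite exprS invfM mulrA.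
  rewrite mulrCA pow2.
  have -> : x +i* y + (l / 2)%:C = (x + l / 2) +i* y by simpc.
  have -> : x +i* y + 'i%C * (l / 2)%:C = x +i* (y + l / 2) by simpc.
  have -> : (x + l / 2) +i* y + 'i%C * (l / 2)%:C = (x + l / 2) +i* (y + l / 2) by simpc.
  have -> : e * l ^+ 2 = e * (l / 2) ^+ 2 + e * (l / 2) ^+ 2 + e * (l / 2) ^+ 2 + e * (l / 2) ^+ 2.
    by field.
  do 3 ?[rewrite (le_trans (le_normcD _ _))// lerD//].
  - by apply: h1; lia.
  - by apply: h2; lia.
  - by apply: h3; lia.
  - by apply: h4; lia.
move=> a b ha hb; have [//|//|D hD] := hq (a +i* b).
have [|r r0 hr] := hD (e / 8); first by rewrite divr_gt0.
exists (r / 2); first by rewrite divr_gt0.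
move=> x y l /andP[l_gt0 lr] /andP[x0x xa] /andP[ax xl] /andP[y0y yb] /andP[by_ yl].
exists 0%N => N _; set p := a +i* b in hD hr *.
have -> : square q (x +i* y) (l / 2 ^+ N)%:C (2 ^ N) =
  square (fun w => q w - (q p - D * p + D * w)) (x +i* y) (l / 2 ^+ N)%:C (2 ^ N).
  by rewrite squareB square_affine subr0.
have -> : e * l ^+ 2 = 4 * l * (e / 8 * (2 * l)) by field.
have lN : (2 ^ N)%:R * (l / 2 ^+ N) = l.
  by rewrite natrX mulrC divfK// expf_neq0.
rewrite -{2}lN; apply: square_le; first by rewrite divr_ge0// ?exprn_ge0// ltW.
rewrite lN => -[u v] /= /andP[u1 u2] /andP[v1 v2].
have hw : normc (u +i* v - p) <= 2 * l.
  apply: (le_trans (normc_le_ReIm _)) => /=.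
  have : `|u - a| <= l by rewrite ler_norml; lra.
  have : `|v - b| <= l by rewrite ler_norml; lra.
  lra.
have := hr (u +i* v - p); rewrite [p + _]addrC subrK => /(_ _).
have -> : q (u +i* v) - (q p - D * p + D * (u +i* v)) =
  q (u +i* v) - q p - D * (u +i* v - p) by ring.
move=> h; apply: (le_trans (h _)); first by lra.
by rewrite ler_wpM2l// divr_ge0// ltW.
Qed.

End Goursat.

(** * Rules for the complex derivative *)

Section Derivative.
Context {R : realType}.
Implicit Types (f g : R[i] -> R[i]) (z w l m : R[i]).

Definition ccont f z : Prop := forall e : R, 0 < e ->
  exists2 r : R, 0 < r & forall h, normc h < r -> normc (f (z + h) - f z) <= e.

Lemma cderiv_ext f g z l (r : R) : 0 < r ->
  (forall h, normc h < r -> f (z + h) = g (z + h)) ->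
  cderiv f z l -> cderiv g z l.
Proof.
move=> r0 fg hf e e0; have [s s0 hs] := hf e e0.
exists (Num.min r s) => [|h]; first by rewrite lt_min r0.
rewrite lt_min => /andP[hr /hs]; rewrite -fg// -[g z](_ : f z = _)//.
by rewrite -[z in RHS]addr0 -fg ?addr0// normc0.
Qed.

Lemma cderiv_lip f z l : cderiv f z l -> exists2 r : R, 0 < r &
  forall h, normc h < r -> normc (f (z + h) - f z) <= (normc l + 1) * normc h.
Proof.
move=> /(_ 1 ltr01)[r r0 hr]; exists r => // h /hr H.
have -> : f (z + h) - f z = (f (z + h) - f z - l * h) + l * h by ring.
rewrite (le_trans (le_normcD _ _))// normcM; lra.
Qed.

Lemma cderiv_cont f z l : cderiv f z l -> ccont f z.
Proof.
move=> /cderiv_lip[r r0 hr] e e0.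
have K : 0 < normc l + 1 by rewrite ltr_wpDl// normc_ge0.
exists (Num.min r (e / (normc l + 1))) => [|h].
  by rewrite lt_min r0 divr_gt0.
rewrite lt_min ltr_pdivlMr// => /andP[/hr H1 H2].
by apply: (le_trans H1); rewrite mulrC ltW.
Qed.

Lemma ccont_bound f z : ccont f z -> exists2 r : R, 0 < r &
  forall h, normc h < r -> normc (f (z + h)) <= normc (f z) + 1.
Proof.
move=> /(_ 1 ltr01)[r r0 hr]; exists r => // h /hr.
move=> H; rewrite -[f (z + h)](subrK (f z)) (le_trans (le_normcD _ _))//; lra.
Qed.

Lemma cderiv_unique f z l m : cderiv f z l -> cderiv f z m -> l = m.
Proof.
move=> hl hm; apply/eqP; rewrite -subr_eq0 -normc_eq0; apply/eqP/le_anti.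
rewrite normc_ge0 andbT; apply/ler_addgt0Pr => e e0; rewrite add0r.
have e2 : 0 < e / 2 by rewrite divr_gt0.
have [r r0 hr] := hl _ e2; have [s s0 hs] := hm _ e2.
pose t := Num.min r s / 2.
have t0 : 0 < t by rewrite divr_gt0// lt_min r0.
have tn : normc t%:C = t by rewrite normc_real gtr0_norm.
have tr : t < r.
  by rewrite /t ltr_pdivrMr// mulr_natr mulr2n gt_min; apply/orP; left; lra.
have ts : t < s.
  by rewrite /t ltr_pdivrMr// mulr_natr mulr2n gt_min; apply/orP; right; lra.
rewrite -(ler_pM2r t0) -{1}tn -normcM.
have -> : (l - m) * t%:C =
  (f (z + t%:C) - f z - m * t%:C) - (f (z + t%:C) - f z - l * t%:C) by ring.
rewrite (le_trans (le_normcD _ _))// normcN.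
have := hs t%:C; have := hr t%:C; rewrite tn => /(_ tr) H1 /(_ ts) H2; lra.
Qed.

Lemma cderiv_cst (c : R[i]) z : cderiv (fun=> c) z 0.
Proof.
move=> e e0; exists 1 => // h _.
by rewrite subrr mul0r subrr normc0 mulr_ge0 ?normc_ge0// ltW.
Qed.

Lemma cderiv_affine (a c : R[i]) z : cderiv (fun w => a + c * w) z c.
Proof.
move=> e e0; exists 1 => // h _.
have -> : a + c * (z + h) - (a + c * z) - c * h = 0 by ring.
by rewrite normc0 mulr_ge0 ?normc_ge0// ltW.
Qed.

Lemma cderiv_id z : cderiv id z 1.
Proof.
apply: (@cderiv_ext (fun w => 0 + 1 * w) _ _ _ 1) => // [h _|].
  by rewrite add0r mul1r.
exact: cderiv_affine.
Qed.

Lemma cderivD f g z l m : cderiv f z l -> cderiv g z m ->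
  cderiv (fun w => f w + g w) z (l + m).
Proof.
move=> hl hm e e0; have e2 : 0 < e / 2 by rewrite divr_gt0.
have [r r0 hr] := hl _ e2; have [s s0 hs] := hm _ e2.
exists (Num.min r s) => [|h]; first by rewrite lt_min r0.
rewrite lt_min => /andP[/hr H1 /hs H2].
have -> : f (z + h) + g (z + h) - (f z + g z) - (l + m) * h =
  (f (z + h) - f z - l * h) + (g (z + h) - g z - m * h) by ring.
rewrite (le_trans (le_normcD _ _))//; lra.
Qed.

Lemma cderivM f g z l m : cderiv f z l -> cderiv g z m ->
  cderiv (fun w => f w * g w) z (l * g z + f z * m).
Proof.
move=> hl hm e e0.
have [r1 r10 h1] := cderiv_lip hl; have [r2 r20 h2] := cderiv_lip hm.
pose G := normc (g z) + 1; pose F := normc (f z) + 1.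
have G0 : 0 < G by rewrite ltr_wpDl// normc_ge0.
have F0 : 0 < F by rewrite ltr_wpDl// normc_ge0.
pose L := (normc l + 1) * (normc m + 1).
have L0 : 0 < L by rewrite mulr_gt0// ltr_wpDl// normc_ge0.
have [|r3 r30 h3] := hl (e / 3 / G); first by rewrite !divr_gt0.
have [|r4 r40 h4] := hm (e / 3 / F); first by rewrite !divr_gt0.
exists (Num.min (Num.min r1 r2) (Num.min (Num.min r3 r4) (e / 3 / L))) => [|h].
  by rewrite !lt_min r10 r20 r30 r40 !divr_gt0.
rewrite !lt_min => /andP[/andP[/h1 {}h1 /h2 {}h2]].
move=> /andP[/andP[/h3 {}h3 /h4 {}h4]]; rewrite ltr_pdivlMr// => hL.
have -> : f (z + h) * g (z + h) - f z * g z - (l * g z + f z * m) * h =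
  (f (z + h) - f z) * (g (z + h) - g z) + f z * (g (z + h) - g z - m * h)
  + g z * (f (z + h) - f z - l * h) by ring.
have -> : e * normc h = e / 3 * normc h + e / 3 * normc h + e / 3 * normc h by field.
have nh := normc_ge0 h.
do ![apply: (le_trans (le_normcD _ _)); apply: lerD]; rewrite normcM.
- apply: (@le_trans _ _ ((normc l + 1) * normc h * ((normc m + 1) * normc h))).
    by rewrite ler_pM ?normc_ge0.
  have -> : (normc l + 1) * normc h * ((normc m + 1) * normc h) = normc h * L * normc h.
    by rewrite /L; ring.
  by rewrite ler_wpM2r// ltW.
- apply: (@le_trans _ _ (F * (e / 3 / F * normc h))).
    by rewrite ler_pM ?normc_ge0// lerDl.
  by rewrite mulrA [F * _]mulrC divfK ?gt_eqF.
- apply: (@le_trans _ _ (G * (e / 3 / G * normc h))).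
    by rewrite ler_pM ?normc_ge0// lerDl.
  by rewrite mulrA [G * _]mulrC divfK ?gt_eqF.
Qed.

Lemma cderivZ (c : R[i]) f z l : cderiv f z l -> cderiv (fun w => c * f w) z (c * l).
Proof. by move=> h; have := cderivM (cderiv_cst c z) h; rewrite mul0r add0r. Qed.

Lemma cderivB f g z l m : cderiv f z l -> cderiv g z m ->
  cderiv (fun w => f w - g w) z (l - m).
Proof.
move=> hl /(cderivZ (-1)) hm.
have := cderivD hl hm; rewrite mulN1r; apply: (@cderiv_ext _ _ _ _ 1) => // h _.
by rewrite mulN1r.
Qed.

Lemma cderiv_affine_comp (a c : R[i]) f z l : cderiv f (a + c * z) l ->
  cderiv (fun w => f (a + c * w)) z (c * l).
Proof.
move=> hl e e0; pose K := normc c + 1.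
have K0 : 0 < K by rewrite ltr_wpDl// normc_ge0.
have [|r r0 hr] := hl (e / K); first by rewrite divr_gt0.
exists (r / K) => [|h]; first by rewrite divr_gt0.
rewrite ltr_pdivlMr// => hK; have nh := normc_ge0 h; have nc := normc_ge0 c.
have chK : normc (c * h) <= normc h * K by rewrite normcM /K; nra.
have := hr (c * h) (le_lt_trans chK hK).
have -> : a + c * (z + h) = a + c * z + c * h by ring.
have -> : c * l * h = l * (c * h) by ring.
move=> H; apply: (le_trans H); apply: (@le_trans _ _ (e / K * (normc h * K))).
  by rewrite ler_wpM2l// divr_ge0// ltW.
by rewrite mulrCA divfK ?gt_eqF// mulrC.
Qed.

Lemma cderivV f z l : f z != 0 -> cderiv f z l ->
  cderiv (fun w => (f w)^-1) z (- l / (f z) ^+ 2).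
Proof.
move=> fz0 hl e e0; pose F := normc (f z).
have F0 : 0 < F by rewrite normc_gt0.
have [|r1 r10 h1] := cderiv_cont hl (e := F / 2); first by rewrite divr_gt0.
have [|r2 r20 h2] := cderiv_cont hl (e := e * F ^+ 3 / 4 / (normc l + 1)).
  by rewrite !divr_gt0 ?mulr_gt0 ?exprn_gt0// ltr_wpDl// normc_ge0.
have [|r3 r30 h3] := hl (e * F ^+ 2 / 4).
  by rewrite !divr_gt0 ?mulr_gt0 ?exprn_gt0.
exists (Num.min (Num.min r1 r2) r3) => [|h].
  by rewrite !lt_min r10 r20 r30.
rewrite !lt_min => /andP[/andP[/h1 {}h1 /h2 {}h2] /h3 {}h3].
have nh := normc_ge0 h; have nl := normc_ge0 l.
have F2 : F / 2 <= normc (f (z + h)).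
  have := le_normc_sub (f z) (f z - f (z + h)); rewrite subKr [normc (f z - _)]normcB.
  by rewrite -/F; lra.
have fh0 : f (z + h) != 0.
  by rewrite -normc_gt0 (lt_le_trans _ F2)// divr_gt0.
have -> : (f (z + h))^-1 - (f z)^-1 - - l / f z ^+ 2 * h =
   (l * h * (f (z + h) - f z) - f z * (f (z + h) - f z - l * h)) /
   (f z ^+ 2 * f (z + h)) by field; rewrite ?fz0 ?fh0.
rewrite normc_div normcM normcX -/F ler_pdivrMr; last first.
  by rewrite mulr_gt0 ?exprn_gt0// normc_gt0.
apply: (@le_trans _ _ (e * F ^+ 3 / 4 * normc h + F * (e * F ^+ 2 / 4 * normc h))).
  apply: (le_trans (le_normcD _ _)); rewrite normcN; apply: lerD.
    rewrite !normcM; move: h2; rewrite ler_pdivlMr; last by lra.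
    by have := normc_ge0 (f (z + h) - f z); nra.
  by rewrite normcM ler_wpM2l// ltW.
have -> : e * F ^+ 3 / 4 * normc h + F * (e * F ^+ 2 / 4 * normc h)
  = e * normc h * (F ^+ 2 * (F / 2)) by field.
by rewrite ler_wpM2l ?mulr_ge0 ?(ltW e0)// ler_wpM2l// sqr_ge0.
Qed.

Lemma cderiv_div f g z l m : g z != 0 -> cderiv f z l -> cderiv g z m ->
  exists D, cderiv (fun w => f w / g w) z D.
Proof. by move=> gz hf hg; eexists; exact: cderivM hf (cderivV gz hg). Qed.

End Derivative.

(** * Trapezoidal sums around a singular centre *)

Section MeanValue.
Context {R : realType}.
Implicit Types (q f : R[i] -> R[i]) (z w d : R[i]) (l : R).

Definition dsquare q (x y l : R) N := square q (x +i* y) (l / 2 ^+ N)%:C (2 ^ N).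

Lemma natrC (n : nat) : (n%:R : R[i]) = (n%:R : R)%:C. Proof. by rewrite rmorph_nat. Qed.

Lemma dyadicK (l : R) N : ((2 ^ N)%:R : R[i]) * (l / 2 ^+ N)%:C = l%:C.
Proof.
by rewrite natrC natrX -rmorphM mulrC divfK// expf_neq0.
Qed.

Lemma dsquare_split q x y l N : dsquare q x y l N.+1 = dsquare q x y (l / 2) N +
  dsquare q (x + l / 2) y (l / 2) N + dsquare q x (y + l / 2) (l / 2) N +
  dsquare q (x + l / 2) (y + l / 2) (l / 2) N.
Proof.
rewrite /dsquare expnS mul2n -addnn square_split.
have -> : l / 2 ^+ N.+1 = l / 2 / 2 ^+ N by rewrite exprS invfM mulrA.
rewrite mulrCA dyadicK.
have -> : x +i* y + (l / 2)%:C = (x + l / 2) +i* y by simpc.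
have -> : x +i* y + 'i%C * (l / 2)%:C = x +i* (y + l / 2) by simpc.
by have -> : (x + l / 2) +i* y + 'i%C * (l / 2)%:C = (x + l / 2) +i* (y + l / 2) by simpc.
Qed.

(** The four squares of side [l] that meet at 0; after cancellation this is a sum along the boundary
    of the square of half-side [l] about 0. *)
Definition around0 q l N := dsquare q 0 0 l N + dsquare q (- l) 0 l N + dsquare q 0 (- l) l N + dsquare q (- l) (- l) l N.

(** Of the sixteen squares of side [l / 2] that tile the large square, the four meeting at 0 form
    the smaller sum. The other twelve avoid the singularity, so Goursat's lemma makes each of them
    at most [e / 12]. *)
Lemma around0_step q l : 0 < l ->
  (forall w, w != 0 -> `|complex.Re w| <= l -> `|complex.Im w| <= l ->
     exists D, cderiv q w D) ->
  forall e, 0 < e -> \forall N \near \oo, normc (around0 q l N.+1 - around0 q (l / 2) N) <= e.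
Proof.
move=> l0 hq e e0.
have good x y : - l <= x -> x + l / 2 <= l -> - l <= y -> y + l / 2 <= l ->
    [|| 0 < x, x + l / 2 < 0, 0 < y | y + l / 2 < 0] ->
    \forall N \near \oo, normc (dsquare q x y (l / 2) N) <= e / 12.
  move=> x1 x2 y1 y2 ne0.
  have [||| N0 hN] := @goursat _ q x y (l / 2) _ _ (e / 12 / (l / 2) ^+ 2).
  - by rewrite divr_gt0.
  - move=> [u v] /= /andP[u1 u2] /andP[v1 v2]; apply: hq; last 2 first.
    + by rewrite /= ler_norml; lra.
    + by rewrite /= ler_norml; lra.
    rewrite eq_complex /=; apply/negP => /andP[/eqP u0 /eqP v0].
    by move: ne0; rewrite u0 v0 in u1 u2 v1 v2; case/or4P; lra.
  - by rewrite !divr_gt0// exprn_gt0// divr_gt0.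
  exists N0 => // N /= h; have := hN N h; rewrite divfK// expf_neq0//.
  by rewrite mulf_neq0 ?invr_eq0 ?gt_eqF.
have half : - l + l / 2 = - (l / 2) by field.
near=> N.
have -> : around0 q l N.+1 - around0 q (l / 2) N =
  dsquare q (l / 2) 0 (l / 2) N + dsquare q 0 (l / 2) (l / 2) N + dsquare q (l / 2) (l / 2) (l / 2) N +
  (dsquare q (- l) 0 (l / 2) N + dsquare q (- l) (l / 2) (l / 2) N + dsquare q (- (l / 2)) (l / 2) (l / 2) N) +
  (dsquare q 0 (- l) (l / 2) N + dsquare q (l / 2) (- l) (l / 2) N + dsquare q (l / 2) (- (l / 2)) (l / 2) N) +
  (dsquare q (- l) (- l) (l / 2) N + dsquare q (- (l / 2)) (- l) (l / 2) N + dsquare q (- l) (- (l / 2)) (l / 2) N).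
  by rewrite /around0 !dsquare_split !add0r half; ring.
have -> : e = e / 12 + e / 12 + e / 12 + (e / 12 + e / 12 + e / 12)
 + (e / 12 + e / 12 + e / 12) + (e / 12 + e / 12 + e / 12) by field.
do ! [apply: (le_trans (le_normcD _ _)); apply: lerD].
all: near: N; apply: good; clear -l0; try lra.
all: apply/or4P.
Unshelve. all: try by end_near.
all: by [constructor 1; lra|constructor 2; lra|constructor 3; lra|constructor 4; lra].
Qed.

End MeanValue.

(** * A maximum principle with a lossy constant *)

Section MaximumModulus.
Context {R : realType}.
Implicit Types (q f : R[i] -> R[i]) (z w d : R[i]) (l : R).

Lemma around0_iter q l : 0 < l ->
  (forall w, w != 0 -> `|complex.Re w| <= l -> `|complex.Im w| <= l ->
     exists D, cderiv q w D) ->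
  forall m e, 0 < e -> \forall N \near \oo,
    normc (around0 q l (m + N) - around0 q (l / 2 ^+ m) N) <= e.
Proof.
move=> l0 hq m; elim: m => [|m IH] e e0.
  by near=> N; rewrite expr0 divr1 subrr normc0 ltW.
have e2 : 0 < e / 2 by rewrite divr_gt0.
have [N0 _ h0] := IH _ e2.
have lm : 0 < l / 2 ^+ m by rewrite divr_gt0// exprn_gt0.
have lml : l / 2 ^+ m <= l.
  by rewrite ler_pdivrMr ?exprn_gt0// ler_peMr ?(ltW l0)// exprn_ege1// ler1n.
have [|N1 _ h1] := @around0_step _ q _ lm _ _ e2.
  by move=> w w0 h1 h2; apply: hq => //; [exact: le_trans h1 _|exact: le_trans h2 _].
exists (N0 + N1)%N => // N /= hN.
have -> : around0 q l (m.+1 + N) - around0 q (l / 2 ^+ m.+1) N =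
  (around0 q l (m + N.+1) - around0 q (l / 2 ^+ m) N.+1) +
  (around0 q (l / 2 ^+ m) N.+1 - around0 q (l / 2 ^+ m / 2) N).
  rewrite addnS addSn exprSr invfM mulrA; ring.
apply: (le_trans (le_normcD _ _)); have -> : e = e / 2 + e / 2 by field.
by apply: lerD; [apply: h0 => /=; lia|apply: h1 => /=; lia].
Unshelve. all: by end_near. Qed.

Lemma around0_edges q l N (n := (2 ^ N)%N) (d := (l / 2 ^+ N)%:C) : around0 q l N =
  edge q (l +i* 0) ('i%C * d) n + edge q (l -i* l) ('i%C * d) n
  - edge q (0 +i* l) d n - edge q ((- l) +i* l) d n
  - edge q ((- l) +i* 0) ('i%C * d) n - edge q ((- l) -i* l) ('i%C * d) n
  + edge q (0 -i* l) d n + edge q ((- l) -i* l) d n.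
Proof.
rewrite /around0 /dsquare /square -/d -/n.
have -> : n%:R * ('i%C * d) = 0 +i* l.
  by rewrite mulrCA dyadicK; simpc.
rewrite dyadicK.
have -> : 0 +i* 0 + l%:C = l +i* 0 by simpc.
have -> : 0 +i* 0 + 0 +i* l = 0 +i* l by simpc.
have -> : (- l) +i* 0 + l%:C = 0 +i* 0 by simpc; rewrite addNr.
have -> : (- l) +i* 0 + 0 +i* l = (- l) +i* l by simpc.
have -> : 0 +i* (- l) + l%:C = l -i* l by simpc.
have -> : 0 +i* (- l) + 0 +i* l = 0 +i* 0 by simpc; rewrite addNr.
have -> : (- l) +i* (- l) + l%:C = 0 -i* l by simpc; rewrite addNr.
have -> : (- l) +i* (- l) + 0 +i* l = (- l) +i* 0 by simpc; rewrite addNr.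
ring.
Qed.

Lemma dyadic_point (l : R) N k : (k <= 2 ^ N)%N -> 0 < l ->
  exists2 t : R, 0 <= t <= l &
    (k%:R : R[i]) * (l / 2 ^+ N)%:C = t%:C /\
    (k%:R : R[i]) * ('i%C * (l / 2 ^+ N)%:C) = 0 +i* t.
Proof.
move=> kN l0; exists (k%:R * (l / 2 ^+ N)); last first.
  split; first by rewrite natrC -rmorphM.
  by rewrite mulrCA natrC -rmorphM; simpc.
have p0 : 0 < 2 ^+ N :> R by rewrite exprn_gt0.
rewrite mulr_ge0 ?divr_ge0 ?(ltW l0) ?(ltW p0)//=.
rewrite mulrA ler_pdivrMr// mulrC ler_wpM2l ?(ltW l0)//.
by rewrite -natrX ler_nat.
Qed.

Lemma around0_le q l N (M : R) : 0 < l ->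
  (forall w, `|complex.Re w| <= l -> `|complex.Im w| <= l -> l <= normc w ->
     normc (q w) <= M) ->
  normc (around0 q l N) <= 8 * l * M.
Proof.
move=> l0 h.
have bd x y : `|x| <= l -> `|y| <= l -> (`|x| = l) \/ (`|y| = l) ->
    normc (q (x +i* y)) <= M.
  move=> hx hy xy; apply: h => //.
  by case: xy => <-; [exact: (le_Re_normc (x +i* y))|exact: (le_Im_normc (x +i* y))].
have nd : normc (l / 2 ^+ N)%:C = l / 2 ^+ N.
  by rewrite normc_real ger0_norm// divr_ge0 ?exprn_ge0// ltW.
have nid : normc ('i%C * (l / 2 ^+ N)%:C) = l / 2 ^+ N.
  by rewrite normcM normc_i mul1r nd.
have nl : (2 ^ N)%:R * (l / 2 ^+ N) = l.
  by rewrite natrX mulrC divfK// expf_neq0.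
have El z : (forall t : R, 0 <= t <= l -> normc (q (z + t%:C)) <= M) ->
    normc (edge q z (l / 2 ^+ N)%:C (2 ^ N)) <= l * M.
  move=> hz; apply: (le_trans (edge_le (M := M) _)); last by rewrite nd nl.
  by move=> k /dyadic_point /(_ l0)[t ht [-> _]]; exact: hz.
have Ei z : (forall t : R, 0 <= t <= l -> normc (q (z + 0 +i* t)) <= M) ->
    normc (edge q z ('i%C * (l / 2 ^+ N)%:C) (2 ^ N)) <= l * M.
  move=> hz; apply: (le_trans (edge_le (M := M) _)); last by rewrite nid nl.
  by move=> k /dyadic_point /(_ l0)[t ht [_ ->]]; exact: hz.
rewrite around0_edges.
have -> : 8 * l * M = l * M + l * M + l * M + l * M + l * M + l * M + l * M + l * M by ring.
have ll : `|l| = l by rewrite gtr0_norm.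
have lNl : `|- l| = l by rewrite normrN.
do ![apply: (le_trans (le_normcD _ _)); apply: lerD]; rewrite ?normcN.
all: first [apply: Ei | apply: El] => t /andP[t0 tl]; simpc; apply: bd.
all: try by [left|right].
all: by rewrite ler_norml; clear -l0 t0 tl; lra.
Qed.

(** The factor [s] is a sign in the application: one statement serves sides traversed in either
    direction. *)
Lemma edge_Im_ge (s : R) q z d n (c : R) :
  (forall k, (k <= n)%N -> c <= s * complex.Im (q (z + k%:R * d) * d)) ->
  n%:R * c <= s * complex.Im (edge q z d n).
Proof.
elim: n => [|n IH] h; first by rewrite /edge big_ord0 mul0r /= mulr0.
rewrite /edge big_ord_recr /= -/(edge q z d n).
have -> (a b : R[i]) : complex.Im (a + b) = complex.Im a + complex.Im b.
  by case: a b => ? ? [].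
rewrite mulrDr -natr1 mulrDl mul1r; apply: lerD.
  by apply: IH => k kn; apply: h; exact: leqW.
have -> (a b : R[i]) : (a + b) / 2 * d = (2^-1)%:C * (a * d + b * d).
  rewrite rmorphV ?unitfE//= rmorph_nat; ring.
have -> (a b : R[i]) : complex.Im ((2^-1)%:C * (a + b)) =
    (complex.Im a + complex.Im b) / 2.
  by case: a b => ? ? [? ?] /=; rewrite mul0r addr0 mulrC.
have := h n (leqnSn n); have := h n.+1 (leqnn _); lra.
Qed.

(** Stands in for the value 2 pi i of the integral of [1 / w]. On each of the eight half-sides the
    imaginary part of the summand, with the sign of the orientation, is at least the step length
    over [2 l], because |w|^2 is at most [2 l ^ 2] there; so each half-side contributes at least
    1/2, whatever the subdivision. *)
Lemma around0_inv_ge l N : 0 < l -> 4 <= normc (around0 (fun w => w^-1) l N).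
Proof.
move=> l0; rewrite (le_trans _ (le_Im_normc _))// (le_trans _ (ler_norm _))//.
set n := (2 ^ N)%N; set d := (l / 2 ^+ N).
have d0 : 0 < d by rewrite divr_gt0// exprn_gt0.
have nl : n%:R * d = l by rewrite /n /d natrX mulrC divfK// expf_neq0.
have I1 (x y : R) : complex.Im ((x +i* y)^-1 * d%:C) = - d * (y / (x ^+ 2 + y ^+ 2)).
  by rewrite /=; ring.
have I2 (x y : R) : complex.Im ((x +i* y)^-1 * ('i%C * d%:C)) = d * (x / (x ^+ 2 + y ^+ 2)).
  by rewrite /=; ring.
have key (x y : R) : x = l -> 0 <= y ^+ 2 <= l ^+ 2 -> (2 * l)^-1 <= x / (x ^+ 2 + y ^+ 2).
  move=> -> /andP[y0 yl]; rewrite -[X in _ <= X]invrK invf_div lef_pV2 ?posrE.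
  - by rewrite ler_pdivrMr//; nra.
  - by rewrite mulr_gt0.
  - by rewrite divr_gt0//; nra.
have E s q z c :
    (forall k, (k <= n)%N -> d / (2 * l) <= s * complex.Im (q (z + k%:R * c) * c)) ->
    1 / 2 <= s * complex.Im (edge q z c n).
  have -> : 1 / 2 = n%:R * (d / (2 * l)) by rewrite mulrA nl; field; rewrite gt_eqF.
  exact: edge_Im_ge.
have -> : complex.Im (around0 (fun w => w^-1) l N) =
  1 * complex.Im (edge (fun w => w^-1) (l +i* 0) ('i%C * d%:C) n)
  + 1 * complex.Im (edge (fun w => w^-1) (l -i* l) ('i%C * d%:C) n)
  + (-1) * complex.Im (edge (fun w => w^-1) (0 +i* l) d%:C n)
  + (-1) * complex.Im (edge (fun w => w^-1) ((- l) +i* l) d%:C n)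
  + (-1) * complex.Im (edge (fun w => w^-1) ((- l) +i* 0) ('i%C * d%:C) n)
  + (-1) * complex.Im (edge (fun w => w^-1) ((- l) -i* l) ('i%C * d%:C) n)
  + 1 * complex.Im (edge (fun w => w^-1) (0 -i* l) d%:C n)
  + 1 * complex.Im (edge (fun w => w^-1) ((- l) -i* l) d%:C n).
  rewrite around0_edges -/n -/d !raddfD !raddfN /=; ring.
have -> : 4 = 1 / 2 + 1 / 2 + 1 / 2 + 1 / 2 + 1 / 2 + 1 / 2 + 1 / 2 + 1 / 2 :> R by field.
do ![apply: lerD]; apply: E => k /dyadic_point /(_ l0)[t /andP[t0 tl]].
all: rewrite -/d => -[e1 e2]; rewrite ?e1 ?e2; simpc; rewrite ?I1 ?I2.
all: rewrite /= ?sqrrN ?(addrC _ (l ^+ 2)) [_ * d]mulrC ler_wpM2l ?(ltW d0)//.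
all: by apply: key => //; apply/andP; split; nra.
Qed.

(* The centre is allowed to be exceptional so that the principle applies to
   difference quotients. *)
Lemma center_le f l (M : R) : 0 < l ->
  (forall w, w != 0 -> `|complex.Re w| <= l -> `|complex.Im w| <= l ->
     exists D, cderiv f w D) ->
  ccont f 0 ->
  (forall w, `|complex.Re w| <= l -> `|complex.Im w| <= l -> l <= normc w ->
     normc (f w) <= M) ->
  normc (f 0) <= 2 * M.
Proof.
move=> l0 hf cf hM.
apply/ler_addgt0Pr => e e0.
have [|r r0 hr] := cf (e / 4); first by rewrite divr_gt0.
(* [m] halvings bring the square into the region where [f] is within [e / 4] of [f 0]. *)
have [m lm] := @exists_half_lt _ l (r / 2) (divr_gt0 r0 (ltr0n _ 2)).
pose l' := l / 2 ^+ m; rewrite -/l' in lm.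
have l'0 : 0 < l' by rewrite divr_gt0// exprn_gt0.
have hq w : w != 0 -> `|complex.Re w| <= l -> `|complex.Im w| <= l ->
    exists D, cderiv (fun w => f w / w) w D.
  move=> w0 h1 h2; have [D hD] := hf w w0 h1 h2.
  exact: cderiv_div hD (cderiv_id w).
have [N _ hN] := around0_iter l0 hq m (mulr_gt0 (ltr0n R 2) e0).
have {hN} := hN N (leqnn _); rewrite -/l' /= => hN.
have b1 : normc (around0 (fun w => f w / w) l (m + N)) <= 8 * M.
  have -> : 8 * M = 8 * l * (M / l) by field; rewrite gt_eqF.
  apply: around0_le => // w h1 h2 h3; rewrite normc_div.
  have M0 : 0 <= M by rewrite (le_trans _ (hM w _ _ _))// normc_ge0.
  by rewrite ler_pM ?normc_ge0 ?invr_ge0 ?normc_ge0 ?hM// lef_pV2 ?posrE// (lt_le_trans l0).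
have b2 : normc (around0 (fun w => (f w - f 0) / w) l' N) <= 2 * e.
  have -> : 2 * e = 8 * l' * (e / 4 / l') by field; rewrite gt_eqF.
  apply: around0_le => // w h1 h2 h3; rewrite normc_div.
  rewrite ler_pM ?normc_ge0 ?invr_ge0 ?normc_ge0//; last first.
    by rewrite lef_pV2 ?posrE// (lt_le_trans l'0).
  have := hr w; rewrite add0r; apply; apply: (le_lt_trans (normc_le_ReIm _)).
  lra.
have b3 := around0_inv_ge N l'0.
(* Cauchy's formula for sums: [f 0] factors out of the main part, and dividing the bound [8 * M] by
   the lower bound 4 for [1 / w] produces the constant 2. *)
have e1 : around0 (fun w => f w / w) l' N =
    f 0 * around0 (fun w => w^-1) l' N + around0 (fun w => (f w - f 0) / w) l' N.
  have -> : around0 (fun w => (f w - f 0) / w) l' N =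
      around0 (fun w => f w / w - f 0 * w^-1) l' N.
    by congr around0; apply/funext => w; rewrite mulrBl.
  by rewrite /around0 /dsquare !squareB !squareZ; ring.
have b4 : normc (f 0 * around0 (fun w => w^-1) l' N) <= 8 * M + 2 * e + 2 * e.
  have -> : f 0 * around0 (fun w => w^-1) l' N = around0 (fun w => f w / w) l (m + N)
    - (around0 (fun w => f w / w) l (m + N) - around0 (fun w => f w / w) l' N)
    - around0 (fun w => (f w - f 0) / w) l' N by rewrite e1; ring.
  by do ![apply: (le_trans (le_normcD _ _)); apply: lerD]; rewrite ?normcN.
rewrite normcM in b4; have := normc_ge0 (f 0); nra.
Qed.

End MaximumModulus.

(** * Bounds on derivatives and Taylor remainders *)

Section Cauchy.
Context {R : realType}.
Implicit Types (f g : R[i] -> R[i]) (z w h D : R[i]) (r M : R).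

Definition disc_hol f z r : Prop :=
  forall w, normc (w - z) < r -> exists D, cderiv f w D.

(** The value 0 is a default at points where [f] has no derivative. *)
Definition cd f z : R[i] := xget 0 [set D | cderiv f z D].

Lemma cdP f z : (exists D, cderiv f z D) -> cderiv f z (cd f z).
Proof. by move=> [D hD]; exact: (xgetPex 0 (ex_intro _ D hD)). Qed.

Lemma cd_eq f z D : cderiv f z D -> cd f z = D.
Proof. by move=> hD; apply: (cderiv_unique (cdP (ex_intro _ D hD)) hD). Qed.

Lemma disc_center_le f r M : 0 < r ->
  (forall w, w != 0 -> normc w < r -> exists D, cderiv f w D) -> ccont f 0 ->
  (forall w, r / 2 <= normc w < r -> normc (f w) <= M) -> normc (f 0) <= 2 * M.
Proof.
(* The boundary of the square of half-side [2 / 3 * r] lies between the circles of radius [r / 2]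
   and [r], since 2 sqrt 2 / 3 < 1. *)
move=> r0 hf cf hM; pose l := 2 / 3 * r.
have l0 : 0 < l by rewrite /l; lra.
have small w : `|complex.Re w| <= l -> `|complex.Im w| <= l -> normc w < r.
  move=> h1 h2; rewrite -(@ltr_pXn2r _ 2) ?nnegrE ?normc_ge0 ?(ltW r0)//.
  rewrite normcE2 -[complex.Re w ^+ 2]real_normK ?num_real//.
  rewrite -[complex.Im w ^+ 2]real_normK ?num_real//.
  have n1 := normr_ge0 (complex.Re w); have n2 := normr_ge0 (complex.Im w).
  have := ler_pM n1 n1 h1 h1; have := ler_pM n2 n2 h2 h2.
  rewrite /l -!expr2 => a1 a2; have := mulr_gt0 r0 r0; nra.
apply: (center_le l0) => // w; first by move=> w0 h1 h2; apply: hf => //; exact: small.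
move=> h1 h2 h3; apply: hM; rewrite small// andbT (le_trans _ h3)// /l; lra.
Qed.

(** With this value at 0 the quotient is continuous, so the maximum principle with an exceptional
    centre bounds the derivative itself. Iterated, it divides out zeros. *)
Definition dquot f z h : R[i] := if h == 0 then cd f z else (f (z + h) - f z) / h.

Lemma dquot_cont f z : (exists D, cderiv f z D) -> ccont (dquot f z) 0.
Proof.
move=> /cdP hD e e0; have [r r0 hr] := hD e e0; exists r => // h /hr.
rewrite add0r /dquot eqxx; case: eqVneq => [->|h0] H.
  by rewrite subrr normc0 ltW.
rewrite -(ler_pM2r (x := normc h)) ?normc_gt0// -normcM mulrBl divfK//.
Qed.

Lemma dquot_hol f z r h : h != 0 -> normc h < r -> disc_hol f z r ->
  exists D, cderiv (dquot f z) h D.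
Proof.
move=> h0 hr hf; have [|D hD] := hf (z + h); first by rewrite addrAC subrr add0r.
have e : z + h = z + 1 * h by rewrite mul1r.
rewrite e in hD; have := cderiv_affine_comp hD.
move=> /cderivB /(_ (cderiv_cst (f z) h)) H.
have [E hE] := cderiv_div h0 H (cderiv_id h).
exists E; apply: (@cderiv_ext _ _ _ _ _ (normc h)) hE; first by rewrite normc_gt0.
move=> k hk; rewrite /dquot mul1r; case: eqVneq => // k0; exfalso.
move: hk; rewrite -[k](addKr h) k0 addr0 normcN.
by rewrite ltxx.
Qed.

(** On the outer half of the disc the difference quotient is at most [2 M / (r / 2)]; the maximum
    principle doubles this. *)
Lemma cauchy_le f z r M : 0 < r -> disc_hol f z r ->
  (forall w, normc (w - z) < r -> normc (f w) <= M) -> normc (cd f z) <= 8 * M / r.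
Proof.
move=> r0 hf hM.
have := @disc_center_le (dquot f z) r (4 * M / r) r0.
rewrite {4}/dquot eqxx => H.
have -> : 8 * M / r = 2 * (4 * M / r) by ring.
have zz : normc (z - z) < r by rewrite subrr normc0.
have M0 : 0 <= M by rewrite (le_trans _ (hM z _))// normc_ge0.
apply: H => [w w0 wr||w /andP[w1 w2]]; first exact: dquot_hol wr hf.
  by apply: dquot_cont; apply: hf.
have w0 : w != 0 by rewrite -normc_gt0 (lt_le_trans _ w1)// divr_gt0.
rewrite /dquot (negbTE w0) normc_div.
have -> : 4 * M / r = (M + M) / (r / 2) by field; rewrite gt_eqF.
rewrite ler_pM ?normc_ge0 ?invr_ge0 ?normc_ge0//.
  rewrite (le_trans (le_normcD _ _))// lerD// ?normcN ?hM//.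
  by rewrite addrAC subrr add0r.
by rewrite lef_pV2 ?posrE ?normc_gt0// divr_gt0.
Qed.

(** [d a b] is the distance between the values of some map at the parameters [a] and [b]. Only the
    triangle inequality and symmetry enter, so the same argument applies to complex functions, to
    [chord] and to real Taylor remainders. *)
Lemma lipschitz_of_local (d : R -> R -> R) (K : R) :
  (forall a b c, d a c <= d a b + d b c) -> (forall a b, d a b = d b a) ->
  (forall t, 0 <= t <= 1 -> forall e, 0 < e -> exists2 r, 0 < r &
     forall s, 0 <= s <= 1 -> `|s - t| < r -> d s t <= (K + e) * `|s - t|) ->
  d 0 1 <= K.
Proof.
move=> tr sy loc; apply/ler_addgt0Pr => e e0.
suff : d 0 1 <= (K + e) * (1 - 0) by rewrite subr0 mulr1.
apply: (@cousin_segment _ (fun a b => d a b <= (K + e) * (b - a))).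
  move=> a m b _ h1 h2; apply: (le_trans (tr a m b)).
  have -> : b - a = (m - a) + (b - m) by ring.
  by rewrite mulrDr lerD.
move=> t ht; have [r r0 hr] := loc t ht e e0; exists r => // a b ha hb ab.
have -> : b - a = `|a - t| + `|b - t|.
  by rewrite ler0_norm ?ger0_norm; lra.
rewrite mulrDr (le_trans (tr a t b))// lerD//.
  by apply: hr; rewrite ?ler0_norm; lra.
by rewrite sy; apply: hr; rewrite ?ger0_norm; lra.
Qed.

Lemma mean_value_le f z w (K : R) :
  (forall t : R, 0 <= t <= 1 ->
     exists2 D, cderiv f (z + t%:C * (w - z)) D & normc D <= K) ->
  normc (f w - f z) <= K * normc (w - z).
Proof.
move=> h; pose p (t : R) := z + t%:C * (w - z); pose v := normc (w - z).
have -> : f w = f (p 1) by rewrite /p mul1r [z + _]addrC subrK.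
have -> : f z = f (p 0) by rewrite /p mul0r addr0.
rewrite normcB.
apply: (@lipschitz_of_local (fun a b => normc (f (p a) - f (p b)))) => [a b c|a b|].
- have -> : f (p a) - f (p c) = (f (p a) - f (p b)) + (f (p b) - f (p c)) by ring.
  exact: le_normcD.
- exact: normcB.
move=> t ht e e0; have [D hD DK] := h t ht.
have v0 : 0 <= v := normc_ge0 _; have v1 : 0 < v + 1 by lra.
have [|r r0 hr] := hD (e / (v + 1)); first by rewrite divr_gt0.
exists (r / (v + 1)); first by rewrite divr_gt0.
move=> s hs; rewrite ltr_pdivlMr// => hst.
have ps : p s = p t + (s - t)%:C * (w - z) by rewrite /p rmorphB; ring.
have nst : normc ((s - t)%:C * (w - z)) = `|s - t| * v by rewrite normcM normc_real.
have := hr ((s - t)%:C * (w - z)); rewrite -/(p t) -ps nst => /(_ _).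
have n0 := normr_ge0 (s - t).
have {}hst : `|s - t| * v < r by nra.
move=> /(_ hst) H.
have -> : f (p s) - f (p t) = (f (p s) - f (p t) - D * ((s - t)%:C * (w - z))) +
  D * ((s - t)%:C * (w - z)) by ring.
apply: (le_trans (le_normcD _ _)); rewrite normcM nst.
have h1 : e / (v + 1) * (`|s - t| * v) <= e * `|s - t|.
  rewrite mulrAC ler_pdivrMr// -!mulrA ler_wpM2l ?(ltW e0)//; nra.
have h2 : normc D * (`|s - t| * v) <= K * v * `|s - t|.
  by rewrite -mulrA [v * _]mulrC ler_wpM2r// mulr_ge0.
have := lerD (le_trans H h1) h2; rewrite -/v; lra.
Qed.

Lemma convex_disc z w w' r (t : R) : 0 <= t <= 1 ->
  normc (w - z) < r -> normc (w' - z) < r -> normc (w + t%:C * (w' - w) - z) < r.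
Proof.
move=> /andP[t0 t1] h1 h2.
have -> : w + t%:C * (w' - w) - z = (1 - t)%:C * (w - z) + t%:C * (w' - z).
  by rewrite rmorphB; ring.
apply: (le_lt_trans (le_normcD _ _)); rewrite !normcM !normc_real.
rewrite !ger0_norm//; last by lra.
have [->|tn] := eqVneq t 0; first by lra.
have {tn}t0 : 0 < t by rewrite lt_def tn.
have := ltr_pM2l t0 (normc (w' - z)) r; rewrite h2 => a.
have : (1 - t) * normc (w - z) <= (1 - t) * r by apply: ler_wpM2l; [lra|exact: ltW].
lra.
Qed.

Lemma sub_disc z w r s t : normc (w - z) < s -> s + t <= r ->
  forall x, normc (x - w) < t -> normc (x - z) < r.
Proof.
move=> h1 st x h2; have -> : x - z = (x - w) + (w - z) by ring.
apply: (le_lt_trans (le_normcD _ _)); lra.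
Qed.

Lemma disc_lip f z r M : 0 < r -> disc_hol f z r ->
  (forall w, normc (w - z) < r -> normc (f w) <= M) ->
  forall w w', normc (w - z) < r / 2 -> normc (w' - z) < r / 2 ->
  normc (f w' - f w) <= 16 * M / r * normc (w' - w).
Proof.
move=> r0 hf hM w w' hw hw'; apply: mean_value_le => t ht.
have hp := convex_disc ht hw hw'; set p := w + _ in hp *.
have sub : forall x, normc (x - p) < r / 2 -> normc (x - z) < r.
  by apply: sub_disc hp _; lra.
exists (cd f p); first by apply/cdP/hf; lra.
have -> : 16 * M / r = 8 * M / (r / 2) by field; rewrite gt_eqF.
apply: cauchy_le => [|x /sub /hf//|x /sub /hM//]; by rewrite divr_gt0.
Qed.

(** The derivative is not yet known to be holomorphic, so the Lipschitz estimate is applied to the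
    difference quotients with a fixed step [k], which are. They are bounded by [16 M / r] on the
    disc of radius [r / 4], whence [1024 = 16 * 16 * 4]; a small [k] then costs an arbitrarily small
    error. *)
Lemma cd_lip f z r M : 0 < r -> disc_hol f z r ->
  (forall w, normc (w - z) < r -> normc (f w) <= M) ->
  forall w w', normc (w - z) < r / 8 -> normc (w' - z) < r / 8 ->
  normc (cd f w' - cd f w) <= 1024 * M / r ^+ 2 * normc (w' - w).
Proof.
move=> r0 hf hM w w' hw hw'.
have M0 : 0 <= M by rewrite (le_trans _ (hM z _)) ?normc_ge0// subrr normc0.
have rn : r != 0 by rewrite gt_eqF.
apply/ler_addgt0Pr => e e0.
have hD : cderiv f w (cd f w) by apply/cdP/hf; lra.
have hD' : cderiv f w' (cd f w') by apply/cdP/hf; lra.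
have e2 : 0 < e / 2 by rewrite divr_gt0.
have [s s0 hs] := hD _ e2; have [s' s'0 hs'] := hD' _ e2.
pose m := Num.min (Num.min s s') (r / 4); pose k := (m / 2)%:C : R[i].
have m0 : 0 < m by rewrite !lt_min s0 s'0 divr_gt0.
have [ms ms' mr] : [/\ m <= s, m <= s' & m <= r / 4].
  by split; rewrite /m !ge_min lexx ?orbT.
have nk : normc k = m / 2 by rewrite normc_real gtr0_norm// divr_gt0.
have k0 : k != 0 by rewrite -normc_gt0 nk divr_gt0.
pose Q x := (f (x + k) - f x) / k.
have apx x E : normc (f (x + k) - f x - E * k) <= e / 2 * normc k ->
    normc (Q x - E) <= e / 2.
  by move=> H; rewrite -(ler_pM2r (x := normc k)) ?normc_gt0// -normcM mulrBl divfK.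
have a1 : normc (Q w - cd f w) <= e / 2 by apply/apx/hs; rewrite nk; lra.
have a2 : normc (Q w' - cd f w') <= e / 2 by apply/apx/hs'; rewrite nk; lra.
have sub x : normc (x - z) < r / 4 -> normc (x + k - z) < r / 2.
  move=> hx; have -> : x + k - z = (x - z) + k by ring.
  by apply: (le_lt_trans (le_normcD _ _)); lra.
have hQ : disc_hol Q z (r / 4).
  move=> x hx; have [|D1 h1] := hf (x + k); first by have := sub x hx; lra.
  have [|D2 h2] := hf x; first by lra.
  have -> : Q = fun y => k^-1 * (f (k + 1 * y) - f y).
    by apply/funext => y; rewrite /Q mul1r [k + y]addrC mulrC.
  eexists; apply: cderivZ; apply: cderivB h2; apply: cderiv_affine_comp.
  by rewrite mul1r addrC; exact: h1.
have QM x : normc (x - z) < r / 4 -> normc (Q x) <= 16 * M / r.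
  move=> hx; rewrite /Q normc_div ler_pdivrMr ?normc_gt0//.
  have := disc_lip r0 hf hM (w := x) (w' := x + k).
  rewrite [x + k - x]addrAC subrr add0r; apply; first by lra.
  exact: sub.
have r40 : 0 < r / 4 by lra.
have := disc_lip r40 hQ QM (w := w) (w' := w').
have -> : r / 4 / 2 = r / 8 by field.
move=> /(_ hw hw').
have -> : 16 * (16 * M / r) / (r / 4) = 1024 * M / r ^+ 2 by field; rewrite gt_eqF.
move=> H; have -> : cd f w' - cd f w = (Q w' - Q w) + (Q w - cd f w) - (Q w' - cd f w').
  by ring.
apply: (le_trans (le_normcD _ _)); rewrite normcN.
have := le_normcD (Q w' - Q w) (Q w - cd f w); lra.
Qed.

Lemma taylor2_le f z r M : 0 < r -> disc_hol f z r ->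
  (forall w, normc (w - z) < r -> normc (f w) <= M) ->
  forall h, normc h < r / 8 ->
  normc (f (z + h) - f z - cd f z * h) <= 1024 * M / r ^+ 2 * normc h ^+ 2.
Proof.
move=> r0 hf hM h hh; pose g w := f w - (0 + cd f z * w).
have := @mean_value_le g z (z + h) (1024 * M / r ^+ 2 * normc h).
have -> : g (z + h) - g z = f (z + h) - f z - cd f z * h by rewrite /g; ring.
have -> : z + h - z = h by ring.
have -> : 1024 * M / r ^+ 2 * normc h ^+ 2 = 1024 * M / r ^+ 2 * normc h * normc h.
  by rewrite -[RHS]mulrA -expr2.
apply=> t /andP[t0 t1].
have th : normc (t%:C * h) <= normc h.
  by rewrite normcM normc_real ger0_norm// ler_piMl// normc_ge0.
have e : z + t%:C * h - z = t%:C * h by ring.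
exists (cd f (z + t%:C * h) - cd f z).
  by apply: cderivB (cderiv_affine _ _ _); apply/cdP/hf; rewrite e; lra.
have := cd_lip r0 hf hM (w := z) (w' := z + t%:C * h).
rewrite subrr normc0 e => H; apply: (le_trans (H _ _)); [lra|lra|].
have M0 : 0 <= M by rewrite (le_trans _ (hM z _)) ?normc_ge0// subrr normc0.
by apply: (ler_wpM2l _ th); exact: divr_ge0 (mulr_ge0 (ler0n _ 1024) M0) (sqr_ge0 _).
Qed.

End Cauchy.

(** * Holomorphic functions on a normed space and their ultrafilter limits *)

Section NormedSpace.
Context {R : realType} {V : normedModType R[i]}.
Implicit Types (x y z h : V).

(** The norm of a module over [R[i]] takes its values in [R[i]]; this is the same number in [R]. *)
Definition nrm x : R := complex.Re `|x|.

Lemma normr_nrm x : `|x| = (nrm x)%:C.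
Proof. by rewrite /nrm RRe_real// ger0_real. Qed.

Lemma nrm_ge0 x : 0 <= nrm x.
Proof. by have := normr_ge0 x; rewrite normr_nrm ler0c. Qed.

Lemma nrm0 : nrm (0 : V) = 0.
Proof. by rewrite /nrm normr0. Qed.

Lemma nrm_eq0 x : nrm x = 0 -> x = 0.
Proof. by move=> x0; apply/normr0_eq0; rewrite normr_nrm x0. Qed.

Lemma nrmD x y : nrm (x + y) <= nrm x + nrm y.
Proof. by have := ler_normD x y; rewrite !normr_nrm -rmorphD lecR. Qed.

Lemma nrmB x y : nrm (x - y) = nrm (y - x).
Proof. by rewrite /nrm distrC. Qed.

Lemma nrmZ (t : R[i]) x : nrm (t *: x) = normc t * nrm x.
Proof. by apply: complexI; rewrite -normr_nrm normrZ normr_nrm rmorphM normrc_normc. Qed.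

Lemma nbhs_nrmP z (B : set V) :
  nbhs z B <-> exists2 r : R, 0 < r & forall w, nrm (w - z) < r -> B w.
Proof.
split=> [/nbhs_normP[e /= e0 h]|[r r0 h]].
  have er : e = (complex.Re e)%:C by rewrite RRe_real// gtr0_real.
  rewrite er ltcR in e0; exists (complex.Re e) => // w hw; apply: h => /=.
  by rewrite distrC normr_nrm er ltcR.
apply/nbhs_normP; exists r%:C => /=; first by rewrite ltcR.
by move=> w /=; rewrite distrC normr_nrm ltcR; exact: h.
Qed.

Lemma nrm_sub z w s t r : nrm (w - z) < s -> s + t <= r ->
  forall x, nrm (x - w) < t -> nrm (x - z) < r.
Proof.
move=> h1 st x h2; have -> : x - z = (x - w) + (w - z) by rewrite addrA subrK.
apply: (le_lt_trans (nrmD _ _)); lra.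
Qed.

Lemma convex_nrm z w w' r (t : R) : 0 <= t <= 1 ->
  nrm (w - z) < r -> nrm (w' - z) < r -> nrm (w + t%:C *: (w' - w) - z) < r.
Proof.
move=> /andP[t0 t1] h1 h2.
have -> : w + t%:C *: (w' - w) - z = (1 - t)%:C *: (w - z) + t%:C *: (w' - z).
  rewrite rmorphB rmorph1 scalerBl scale1r -[RHS]addrA [X in _ = _ + X]addrC -scalerBr.
  have -> : w' - z - (w - z) = w' - w by rewrite opprB addrA subrK.
  by rewrite addrAC.
apply: (le_lt_trans (nrmD _ _)); rewrite !nrmZ !normc_real.
rewrite !ger0_norm//; last by lra.
have [->|tn] := eqVneq t 0; first by lra.
have {tn}t0 : 0 < t by rewrite lt_def tn.
have := ltr_pM2l t0 (nrm (w' - z)) r; rewrite h2 => a.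
have : (1 - t) * nrm (w - z) <= (1 - t) * r by apply: ler_wpM2l; [lra|exact: ltW].
lra.
Qed.

End NormedSpace.

(** Bisection of a square around the disc, with the near-covering property on the part of the disc
    inside a subsquare as the predicate. Points outside the disc cause no trouble: small squares
    about them miss the disc. *)
Lemma compact_disc (R : realType) (z : R[i]) (r : R) :
  compact [set w : R[i] | normc (w - z) <= r].
Proof.
apply/compact_near_coveringP => I F P FF hP.
have [r0|r0] := ltP r 0.
  by apply: nearW => i w /= hw; exfalso; have := normc_ge0 (w - z); lra.
pose K := [set w : R[i] | normc (w - z) <= r].
case: z @K hP => zx zy K hP.
pose Q (x y l : R) := \forall i \near F, forall w, K w ->
  x <= complex.Re w <= x + l -> y <= complex.Im w <= y + l -> P i w.
suff : Q (zx - (r + 1)) (zy - (r + 1)) (2 * (r + 1)).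
  apply: filterS => i h [wx wy] Kw; apply: h => //=; move: (Kw); rewrite /K /= => {}Kw.
    by have := le_trans (le_Re_normc (wx +i* wy - zx +i* zy)) Kw; rewrite /= ler_norml; lra.
  by have := le_trans (le_Im_normc (wx +i* wy - zx +i* zy)) Kw; rewrite /= ler_norml; lra.
apply: (@cousin_square _ Q); first by lra.
  move=> x y l l0 q1 q2 q3 q4; near=> i => -[wx wy] Kw /= hx hy.
  have [wx1|wx1] := leP wx (x + l / 2); have [wy1|wy1] := leP wy (y + l / 2).
  - by apply: (near q1 i) => //=; lra.
  - by apply: (near q3 i) => //=; lra.
  - by apply: (near q2 i) => //=; lra.
  - by apply: (near q4 i) => //=; lra.
move=> a b _ _.
have [Kab|nK] := pselect (K (a +i* b)).
  have [[A B] /= [/nbhs_nrmP[d d0 hd] FB] AB] := hP _ Kab.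
  exists (d / 2); first by lra.
  move=> x y l hl hx hx' hy hy'; apply: filterS FB => i Bi [wx wy] _ /= h1 h2.
  apply: (AB (_, i)); split => //=; apply: hd.
  apply: (le_lt_trans (normc_le_ReIm _)) => /=.
  have : `|wx - a| <= l by rewrite ler_norml; lra.
  have : `|wy - b| <= l by rewrite ler_norml; lra.
  lra.
have {}nK : r < normc (a +i* b - zx +i* zy) by rewrite ltNge; apply/negP.
exists ((normc (a +i* b - zx +i* zy) - r) / 2); first by lra.
move=> x y l hl hx hx' hy hy'; apply: nearW => i [wx wy] Kw /= h1 h2; exfalso.
have : normc (a +i* b - zx +i* zy) <= normc (wx +i* wy - zx +i* zy) + 2 * l.
  have -> : a +i* b - zx +i* zy = (wx +i* wy - zx +i* zy) + (a - wx) +i* (b - wy).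
    by simpc; congr (_ +i* _); ring.
  apply: (le_trans (le_normcD _ _)); rewrite lerD2l.
  apply: (le_trans (normc_le_ReIm _)) => /=.
  have : `|a - wx| <= l by rewrite ler_norml; lra.
  have : `|b - wy| <= l by rewrite ler_norml; lra.
  lra.
have {}Kw : normc (wx +i* wy - zx +i* zy) <= r := Kw.
lra.
Unshelve. all: by end_near. Qed.

(** * Limits along an ultrafilter *)

Section Ultrafilter.
Context {R : realType} {U : set_system nat} {UU : UltraFilter U}.
Implicit Types (v : nat -> R[i]) (c : R[i]).

(** If no point of [K] were a limit, each would have a neighbourhood that [v] avoids on a set of the
    ultrafilter; compactness would then give a single index [j] with [v j] in [K] and different from
    every point of [K]. *)
Lemma ultra_compact (X : topologicalType) (K : set X) (v : nat -> X) :
  compact K -> U [set j | K (v j)] ->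
  exists2 c, K c & forall B, nbhs c B -> U [set j | B (v j)].
Proof.
move=> /compact_near_coveringP cK Kv; apply: contrapT => h.
have : \forall j \near U, K `<=` (fun x => v j <> x).
  apply: cK => x Kx.
  have [B [nB UB]] : exists B, nbhs x B /\ ~ U [set j | B (v j)].
    apply: contrapT => h'; apply: h; exists x => // B nB.
    by apply: contrapT => UB; apply: h'; exists B.
  exists (B, ~` [set j | B (v j)]) => /=.
    by split=> //; have [] := in_ultra_setVsetC [set j | B (v j)] UU.
  by move=> [y j] [/= By nBj] vy; apply: nBj; rewrite vy.
move=> hU; have [j [Kj /(_ _ Kj)]] := filter_ex (filterI Kv hU).
by apply.
Qed.

Definition ulim v c : Prop := forall e : R, 0 < e -> U [set j | normc (v j - c) <= e].

Lemma ulim_exists v (B : R) : U [set j | normc (v j) <= B] -> exists c, ulim v c.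
Proof.
move=> vB; have [|c _ hc] := @ultra_compact R[i] _ v (@compact_disc R 0 B).
  by apply: filterS vB => j /=; rewrite subr0.
exists c => e e0; apply: (hc [set w | normc (w - c) <= e]).
by apply/nbhs_nrmP; exists e => // w /ltW.
Qed.

Lemma ulim_cst c : ulim (fun=> c) c.
Proof. by move=> e e0; apply: nearW => j; rewrite subrr normc0 ltW. Qed.

Lemma ulimD v w c d : ulim v c -> ulim w d -> ulim (fun j => v j + w j) (c + d).
Proof.
move=> hv hw e e0; have e2 : 0 < e / 2 by lra.
apply: filterS2 (hv _ e2) (hw _ e2) => j /= h1 h2.
have -> : v j + w j - (c + d) = (v j - c) + (w j - d) by ring.
apply: (le_trans (le_normcD _ _)); lra.
Qed.

Lemma ulimZ (a : R[i]) v c : ulim v c -> ulim (fun j => a * v j) (a * c).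
Proof.
move=> hv e e0; have a0 : 0 < normc a + 1 by rewrite ltr_wpDl ?normc_ge0.
have e2 : 0 < e / (normc a + 1) by rewrite divr_gt0.
apply: filterS (hv _ e2) => j /=; rewrite -mulrBr normcM ler_pdivlMr// => h.
have := normc_ge0 (v j - c); lra.
Qed.

Lemma ulimB v w c d : ulim v c -> ulim w d -> ulim (fun j => v j - w j) (c - d).
Proof.
move=> hv /(ulimZ (-1)) hw; have := ulimD hv hw; rewrite mulN1r.
by congr ulim; apply/funext => j; rewrite mulN1r.
Qed.

Lemma ulim_le v c (B : R) : ulim v c -> U [set j | normc (v j) <= B] -> normc c <= B.
Proof.
move=> hv vB; apply/ler_addgt0Pr => e e0.
have [j [/= h1 h2]] := filter_ex (filterI (hv e e0) vB).
have -> : c = v j - (v j - c) by rewrite subKr.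
apply: (le_trans (le_normcD _ _)); rewrite normcN; lra.
Qed.

Lemma ulim_unique v c d : ulim v c -> ulim v d -> c = d.
Proof.
move=> hc hd; apply/eqP; rewrite -subr_eq0 -normc_eq0 eq_le normc_ge0 andbT.
apply: (ulim_le (ulimB hc hd)); by apply: nearW => j /=; rewrite subrr normc0.
Qed.

Lemma ulim_ext v w c : U [set j | v j = w j] -> ulim v c -> ulim w c.
Proof.
by move=> vw hv e e0; apply: filterS2 vw (hv e e0) => j /= ->.
Qed.

End Ultrafilter.

(** * Holomorphic functions on a normed space and Weierstrass' theorem *)

Section Holomorphy.
Context {R : realType} {V : normedModType R[i]}.
Implicit Types (f g : V -> R[i]) (L : V -> R[i]) (z w h : V) (r M : R).

Definition clin L : Prop := [/\ forall x y, L (x + y) = L x + L y,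
  forall t x, L (t *: x) = t * L x &
  exists K : R, forall h, normc (L h) <= K * nrm h].

Definition Dat f z L : Prop := forall e : R, 0 < e ->
  exists2 r : R, 0 < r & forall h, nrm h < r ->
    normc (f (z + h) - f z - L h) <= e * nrm h.

Definition hol_at f z : Prop := exists2 L, clin L & Dat f z L.

Lemma clin0 L : clin L -> L 0 = 0.
Proof. by move=> [_ lZ _]; rewrite -[0 in LHS](scale0r 0) lZ mul0r. Qed.

Lemma cderiv_line f z h L (t : R[i]) : clin L -> Dat f (z + t *: h) L ->
  cderiv (fun s => f (z + s *: h)) t (L h).
Proof.
move=> [lD lZ _] hL e e0; have n0 := nrm_ge0 h.
have K0 : 0 < nrm h + 1 by lra.
have [|r r0 hr] := hL (e / (nrm h + 1)); first by rewrite divr_gt0.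
exists (r / (nrm h + 1)) => [|k]; first by rewrite divr_gt0.
rewrite ltr_pdivlMr// => kr; have k0 := normc_ge0 k.
have := hr (k *: h); rewrite nrmZ lZ scalerDl addrA [L h * k]mulrC => H.
apply: (le_trans (H _)); first by lra.
rewrite mulrAC ler_pdivrMr// -mulrA ler_wpM2l ?(ltW e0)//; lra.
Qed.

(** Restriction to the complex line through [z] in direction [h] is holomorphic on a disc of radius
    [r / nrm h], so the one-variable estimates scale to bounds that depend neither on the direction
    nor on [f]. That uniformity is what survives passage to a limit. *)
Lemma hol_at_taylor f z r M : 0 < r ->
  (forall w, nrm (w - z) < r -> hol_at f w /\ normc (f w) <= M) ->
  exists L, [/\ clin L, Dat f z L,
    forall h, normc (L h) <= 8 * M / r * nrm h &
    forall h, nrm h < r / 8 ->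
      normc (f (z + h) - f z - L h) <= 1024 * M / r ^+ 2 * nrm h ^+ 2].
Proof.
move=> r0 hf.
have zz : nrm (z - z) < r by rewrite subrr nrm0.
have [[L lL DL] fM] := hf z zz.
have M0 : 0 <= M by rewrite (le_trans _ fM)// normc_ge0.
have L0 := clin0 lL.
have aux h : 0 < nrm h -> let F s := f (z + s *: h) in
  [/\ 0 < r / nrm h, disc_hol F 0 (r / nrm h),
   forall s, normc (s - 0) < r / nrm h -> normc (F s) <= M & cd F 0 = L h].
  move=> h0 F; split; first by rewrite divr_gt0.
  - move=> s; rewrite subr0 ltr_pdivlMr// -nrmZ => hs.
    have [|[L' lL' DL'] _] := hf (z + s *: h); first by rewrite addrAC subrr add0r.
    by exists (L' h); exact: cderiv_line.
  - move=> s; rewrite subr0 ltr_pdivlMr// -nrmZ => hs.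
    by have [|_ ->] := hf (z + s *: h); first by rewrite addrAC subrr add0r.
  - by apply: cd_eq; apply: cderiv_line => //; rewrite scale0r addr0.
exists L; split=> // h.
  have [h0|h0] := eqVneq (nrm h) 0.
    by rewrite (nrm_eq0 h0) L0 normc0 nrm0 mulr0.
  have hp : 0 < nrm h by rewrite lt_def h0 nrm_ge0.
  have [r1 F1 F2 <-] := aux h hp.
  have := cauchy_le r1 F1 F2.
  by have -> : 8 * M / (r / nrm h) = 8 * M / r * nrm h by field; rewrite h0 gt_eqF.
move=> hr; have [h0|h0] := eqVneq (nrm h) 0.
  rewrite (nrm_eq0 h0) addr0 subrr L0 subrr normc0.
  exact: (mulr_ge0 (divr_ge0 (mulr_ge0 (ler0n _ 1024) M0) (sqr_ge0 _)) (sqr_ge0 _)).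
have hp : 0 < nrm h by rewrite lt_def h0 nrm_ge0.
have [r1 F1 F2 FL] := aux h hp.
have := taylor2_le r1 F1 F2 (h := 1).
rewrite FL add0r scale1r scale0r addr0 mulr1 normc1 expr1n mulr1.
have -> : 1024 * M / (r / nrm h) ^+ 2 = 1024 * M / r ^+ 2 * nrm h ^+ 2.
  by field; rewrite h0 gt_eqF.
apply; rewrite -[r / nrm h / 8]mulrA -invfM ltr_pdivlMr ?mul1r ?mulr_gt0//; lra.
Qed.

Context {U : set_system nat} {UU : UltraFilter U}.

(** Weierstrass' theorem from pointwise limits: the derivatives at [z] are bounded in each direction
    and have a limit, and the quadratic remainder bound, with its common constant, passes to the
    limit and makes it the derivative of [g]. *)
Lemma hol_at_ulim (u : nat -> V -> R[i]) g z r M : 0 < r ->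
  U [set j | forall w, nrm (w - z) < r -> hol_at (u j) w /\ normc (u j w) <= M] ->
  (forall w, nrm (w - z) < r -> ulim (U := U) (u^~ w) (g w)) ->
  exists L, [/\ clin L, Dat g z L & forall h e, 0 < e ->
    U [set j | exists L', [/\ clin L', Dat (u j) z L' & normc (L' h - L h) <= e]]].
Proof.
move=> r0 hu hg.
have zz : nrm (z - z) < r by rewrite subrr nrm0.
have [j0 /= hj0] := filter_ex hu.
have M0 : 0 <= M by have [_] := hj0 _ zz; apply: le_trans; exact: normc_ge0.
pose T j L := [/\ clin L, Dat (u j) z L,
    forall h, normc (L h) <= 8 * M / r * nrm h &
    forall h, nrm h < r / 8 ->
      normc (u j (z + h) - u j z - L h) <= 1024 * M / r ^+ 2 * nrm h ^+ 2].
have [Lj hL] : {Lj & forall j, (exists L, T j L) -> T j (Lj j)}.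
  apply: (@boolp.choice _ _ (fun j L => (exists L, T j L) -> T j L)) => j.
  have [[L hL]|h] := pselect (exists L, T j L); first by exists L.
  by exists (fun=> 0).
have {}hL : U [set j | T j (Lj j)].
  by apply: filterS hu => j h; apply: hL; exact: hol_at_taylor.
have [L LL] : {L & forall h, ulim (U := U) (Lj^~ h) (L h)}.
  apply: (@boolp.choice _ _ (fun h c => ulim (U := U) (Lj^~ h) c)) => h.
  apply: (@ulim_exists _ _ _ _ (8 * M / r * nrm h)).
  by apply: filterS hL => j [_ _ + _]; exact.
have lL : clin L.
  split=> [x y|t x|].
  - apply: (ulim_unique (LL _)); apply: (ulim_ext _ (ulimD (LL x) (LL y))).
    by apply: filterS hL => j [[lD _ _] _ _ _] /=; rewrite lD.
  - apply: (ulim_unique (LL _)); apply: (ulim_ext _ (ulimZ t (LL x))).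
    by apply: filterS hL => j [[_ lZ _] _ _ _] /=; rewrite lZ.
  - exists (8 * M / r) => h; apply: (ulim_le (LL h)).
    by apply: filterS hL => j [_ _ + _]; exact.
exists L; split=> //; last first.
  move=> h e e0; apply: filterS2 hL (LL h e e0) => j [h1 h2 _ _] /= h3.
  by exists (Lj j).
have quad h : nrm h < r / 8 ->
    normc (g (z + h) - g z - L h) <= 1024 * M / r ^+ 2 * nrm h ^+ 2.
  move=> hr; have zh : nrm (z + h - z) < r by rewrite addrAC subrr add0r; lra.
  apply: (ulim_le (ulimB (ulimB (hg _ zh) (hg _ zz)) (LL h))).
  by apply: filterS hL => j [_ _ _ +]; exact.
move=> e e0; set K := 1024 * M / r ^+ 2 in quad *.
have K0 : 0 <= K := divr_ge0 (mulr_ge0 (ler0n _ 1024) M0) (sqr_ge0 _).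
clearbody K; have K1 : 0 < K + 1 by lra.
exists (Num.min (r / 8) (e / (K + 1))) => [|h].
  by rewrite lt_min !divr_gt0.
rewrite lt_min => /andP[/quad h1]; rewrite ltr_pdivlMr// => h2; apply: (le_trans h1).
by have := nrm_ge0 h; rewrite expr2; nra.
Qed.

End Holomorphy.

(** * Limits and higher derivatives in one variable *)

Section OneVariable.
Context {R : realType}.
Implicit Types (f g : R[i] -> R[i]) (z w l : R[i]) (r M : R).

Lemma clin_mul l : @clin R R[i] (fun h => l * h).
Proof.
split=> [x y|t x|]; first by rewrite mulrDr.
  by rewrite [t *: x]/(t * x) mulrCA.
by exists (normc l) => h; rewrite normcM.
Qed.

Lemma cderiv_Dat f z l : cderiv f z l -> @Dat R R[i] f z (fun h => l * h).
Proof. by []. Qed.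

Lemma Dat_cderiv f z (L : R[i] -> R[i]) : @clin R R[i] L -> Dat f z L -> cderiv f z (L 1).
Proof.
move=> [_ lZ _] hL e e0; have [r r0 hr] := hL e e0; exists r => // h /hr.
by rewrite -[L h](_ : L 1 * h = _)// mulrC -lZ; congr L; exact: mulr1.
Qed.

Lemma cderiv_hol_at f z : (exists l, cderiv f z l) -> @hol_at R R[i] f z.
Proof. by move=> [l h]; exists (fun h => l * h); [exact: clin_mul|]. Qed.

Lemma hol_at_cderiv f z : @hol_at R R[i] f z -> exists l, cderiv f z l.
Proof. by move=> [L lL hL]; exists (L 1); exact: Dat_cderiv. Qed.

Lemma cderiv_ulim {U : set_system nat} {UU : UltraFilter U}
    (u : nat -> R[i] -> R[i]) g z r M : 0 < r ->
  U [set j | disc_hol (u j) z r /\ forall w, normc (w - z) < r -> normc (u j w) <= M] ->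
  (forall w, normc (w - z) < r -> ulim (U := U) (u^~ w) (g w)) ->
  (exists l, cderiv g z l) /\ ulim (U := U) (fun j => cd (u j) z) (cd g z).
Proof.
move=> r0 hu hg.
have [|L [lL DL hL]] := @hol_at_ulim R R[i] U UU u g z r M r0 _ hg.
  apply: filterS hu => j [h1 h2] w hw.
  by split; [apply/cderiv_hol_at/h1|exact: h2].
have Dg := Dat_cderiv lL DL; split; first by exists (L 1).
rewrite (cd_eq Dg) => e e0; apply: filterS (hL 1 e e0) => j [L' [lL' DL' h]] /=.
by rewrite (cd_eq (Dat_cderiv lL' DL')).
Qed.

Lemma disc_holS f z r w s : disc_hol f z r -> normc (w - z) + s <= r -> disc_hol f w s.
Proof.
move=> hf h x hx; apply: hf; have -> : x - z = (x - w) + (w - z) by ring.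
apply: (le_lt_trans (le_normcD _ _)); lra.
Qed.

(** Near-covering with the filter of large real numbers [M] merges the local bounds into a common
    one. *)
Lemma disc_hol_bound f z r s : disc_hol f z r -> s < r ->
  exists M, forall w, normc (w - z) <= s -> normc (f w) <= M.
Proof.
move=> hf sr; have := @compact_disc R z s; move=> /compact_near_coveringP.
move=> /(_ R (pinfty_nbhs R) (fun M w => normc (f w) <= M) _)[].
  move=> x /= xs; have [l hl] := hf x (le_lt_trans xs sr).
  have [r1 r10 h1] := ccont_bound (cderiv_cont hl).
  exists ([set w | normc (w - x) < r1], [set M | normc (f x) + 1 < M]) => /=.
    split; first by apply/nbhs_nrmP; exists r1.
    by exists (normc (f x) + 1); split; [exact: num_real|].
  move=> [w M] /= [hw hM]; apply/ltW/(le_lt_trans _ hM).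
  by have := h1 (w - x); rewrite [x + _]addrC subrK; exact.
move=> N [_ hN]; exists (N + 1) => w hw; apply: hN hw => //; lra.
Qed.

(** The derivative is the limit of the difference quotients with steps of modulus [1 / (j + 1)].
    These are holomorphic and uniformly bounded near [z], so Weierstrass' theorem makes the limit
    differentiable. *)
Lemma cderiv_cd f z r : 0 < r -> disc_hol f z r -> exists l, cderiv (cd f) z l.
Proof.
move=> r0 hf.
have r2 : r / 2 < r by lra.
have [M hM] := disc_hol_bound hf r2.
have r20 : 0 < r / 2 by lra.
have hf2 : disc_hol f z (r / 2) by apply: (disc_holS hf); rewrite subrr normc0; lra.
have hM2 w : normc (w - z) < r / 2 -> normc (f w) <= M by move=> /ltW /hM.
have [U [UU Uoo]] := ultraFilterLemma (eventually_filter).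
have [k nk] : exists k : nat -> R[i], forall j, normc (k j) = j.+1%:R^-1.
  exists (fun j => (j.+1%:R^-1 : R)%:C) => j.
  by rewrite normc_real ger0_norm// invr_ge0.
have k0 j : k j != 0 by rewrite -normc_gt0 nk invr_gt0.
have small e : 0 < e -> U [set j | normc (k j) < e].
  move=> e0; apply: Uoo; have [N hN] : exists N, e^-1 < N.+1%:R.
    by exists (Num.truncn e^-1); exact: truncnS_gt.
  exists N => // j /= Nj; rewrite nk invf_plt ?posrE//.
  by rewrite (lt_le_trans hN)// ler_nat.
have [] // := @cderiv_ulim U UU (fun j w => (f (w + k j) - f w) / k j) (cd f) z (r / 8)
  (16 * M / (r / 2)).
- by lra.
- apply: filterS (small (r / 8) _); last by lra.
  move=> j /= kj; split.
    move=> w hw; have [|D1 h1] := hf (w + k j).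
      have -> : w + k j - z = (w - z) + k j by ring.
      by apply: (le_lt_trans (le_normcD _ _)); lra.
    have [|D2 h2] := hf w; first by lra.
    have -> : (fun w => (f (w + k j) - f w) / k j) =
        (fun w => (k j)^-1 * (f (k j + 1 * w) - f w)).
      by apply/funext => x; rewrite mul1r [k j + x]addrC mulrC.
    eexists; apply: cderivZ; apply: cderivB h2; apply: cderiv_affine_comp.
    by rewrite mul1r addrC; exact: h1.
  move=> w hw; rewrite normc_div ler_pdivrMr ?normc_gt0//.
  have := disc_lip r20 hf2 hM2 (w := w) (w' := w + k j).
  rewrite [w + k j - w]addrAC subrr add0r; apply; first by lra.
  have -> : w + k j - z = (w - z) + k j by ring.
  by apply: (le_lt_trans (le_normcD _ _)); lra.
move=> w hw e e0; have [|s s0 hs] := cdP (hf w _) e0; first by lra.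
apply: filterS (small s s0) => j /= /hs H.
by rewrite -(ler_pM2r (x := normc (k j))) ?normc_gt0// -normcM mulrBl divfK.
Qed.

Lemma disc_hol_cd f z r : disc_hol f z r -> disc_hol (cd f) z r.
Proof.
move=> hf w hw; apply: (@cderiv_cd _ _ (r - normc (w - z))); first by lra.
by apply: (disc_holS hf); lra.
Qed.

End OneVariable.

(** * From pointwise to uniform convergence *)

Section Uniformity.
Context {R : realType} {V : normedModType R[i]}.
Implicit Types (f g : V -> R[i]) (z w h : V) (r M : R).

(** Differentiability along each complex line. The estimates only look at lines, and reciprocals
    then need no more than the one-variable rule. *)
Definition line_hol f w : Prop := forall h,
  exists l, cderiv (fun t => f (w + t *: h)) 0 l.

Lemma hol_at_line f w : hol_at f w -> line_hol f w.
Proof.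
move=> [L lL DL] h; exists (L h); apply: cderiv_line => //.
by rewrite scale0r addr0.
Qed.

Lemma line_hol_cderiv f w h t : line_hol f (w + t *: h) ->
  exists l, cderiv (fun s => f (w + s *: h)) t l.
Proof.
move=> /(_ h)[l hl].
have : cderiv (fun s => f (w + t *: h + s *: h)) (- t + 1 * t) l.
  by rewrite mul1r addNr.
move=> /cderiv_affine_comp; rewrite mul1r => H; exists l.
apply: (@cderiv_ext _ _ _ _ _ 1 _ _ H) => // k _.
by congr f; rewrite -addrA -scalerDl; congr (_ + _ *: _); ring.
Qed.

Lemma line_holV f w : line_hol f w -> f w != 0 -> line_hol (fun x => (f x)^-1) w.
Proof.
move=> hf fw h; have [l hl] := hf h; eexists; apply: cderivV hl.
by rewrite scale0r addr0.
Qed.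

Lemma line_hol_disc f z h r : (forall w, nrm (w - z) < r -> line_hol f w) ->
  0 < nrm h -> disc_hol (fun t => f (z + t *: h)) 0 (r / nrm h).
Proof.
move=> hf h0 t; rewrite subr0 ltr_pdivlMr// -nrmZ => ht.
by apply/line_hol_cderiv/hf; rewrite addrAC subrr add0r.
Qed.

Lemma line_hol_lip f z r M : 0 < r ->
  (forall w, nrm (w - z) < r -> line_hol f w /\ normc (f w) <= M) ->
  forall w w', nrm (w - z) < r / 2 -> nrm (w' - z) < r / 2 ->
  normc (f w' - f w) <= 16 * M / r * nrm (w' - w).
Proof.
move=> r0 hf w w' hw hw'; pose v := w' - w.
have [v0|v0] := eqVneq (nrm v) 0.
  have -> : w' = w by apply/eqP; rewrite -subr_eq0; apply/eqP/nrm_eq0.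
  by rewrite subrr normc0 subrr nrm0 mulr0.
have vp : 0 < nrm v by rewrite lt_def v0 nrm_ge0.
have := @mean_value_le R (fun t => f (w + t *: v)) 0 1 (16 * M / r * nrm v).
rewrite scale1r scale0r addr0 subr0 normc1 mulr1 [w + v]addrC subrK; apply.
move=> t ht; rewrite mulr1 add0r.
have pz := convex_nrm ht hw hw'; rewrite -/v in pz.
have hp x : nrm (x - (w + t%:C *: v)) < r / 2 -> line_hol f x /\ normc (f x) <= M.
  by move=> hx; apply: hf; apply: (nrm_sub pz) hx; lra.
have dh : disc_hol (fun s => f (w + t%:C *: v + s *: v)) 0 (r / 2 / nrm v).
  by apply: line_hol_disc => // x /hp [].
have [|l hl] := @line_hol_cderiv f w v t%:C.
  by have [] := hp (w + t%:C *: v); [rewrite subrr nrm0; lra|].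
exists l => //.
have := cauchy_le _ dh (M := M).
have -> : 8 * M / (r / 2 / nrm v) = 16 * M / r * nrm v by field; rewrite v0 gt_eqF.
suff -> : cd (fun s => f (w + t%:C *: v + s *: v)) 0 = l.
  apply; first by rewrite !divr_gt0.
  move=> s; rewrite subr0 ltr_pdivlMr// -nrmZ => hs.
  by have [] := hp (w + t%:C *: v + s *: v); first by rewrite addrAC subrr add0r.
apply: cd_eq.
have e : t%:C = t%:C + 1 * 0 :> R[i] by rewrite mulr0 addr0.
rewrite e in hl; have := cderiv_affine_comp hl; rewrite mul1r.
apply: (@cderiv_ext _ _ _ _ _ 1) => // k _.
by rewrite mul1r add0r scalerDl addrA.
Qed.

Context {U : set_system nat} {UU : UltraFilter U}.

Definition ev_bounded (u : nat -> V -> R[i]) z r M : Prop :=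
  U [set j | forall w, nrm (w - z) < r -> line_hol (u j) w /\ normc (u j w) <= M].

(** Cauchy estimates give a common Lipschitz constant near each point; the limit inherits it, so
    closeness at one point spreads to a neighbourhood, and compactness does the rest. *)
Lemma ulim_uniform (u : nat -> V -> R[i]) g (K : set V) : compact K ->
  (forall x, K x -> exists r M, [/\ 0 < r, ev_bounded u x r M &
     forall w, nrm (w - x) < r -> ulim (U := U) (u^~ w) (g w)]) ->
  forall e, 0 < e -> U [set j | forall w, K w -> normc (u j w - g w) <= e].
Proof.
move=> /compact_near_coveringP cK hu e e0.
apply: (cK nat U (fun j w => normc (u j w - g w) <= e)) => x Kx.
have [r [M [r0 bu lu]]] := hu x Kx.
have xx : nrm (x - x) < r by rewrite subrr nrm0.
have M0 : 0 <= M.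
  have [j /= /(_ x xx)[_]] := filter_ex bu.
  by apply: le_trans; exact: normc_ge0.
pose C := 16 * M / r + 1.
have C0 : 0 < C.
  have : 0 <= 16 * M / r := divr_ge0 (mulr_ge0 (ler0n _ 16) M0) (ltW r0).
  by rewrite /C; lra.
have lip j w : (forall w, nrm (w - x) < r -> line_hol (u j) w /\ normc (u j w) <= M) ->
    nrm (w - x) < r / 2 -> normc (u j w - u j x) <= C * nrm (w - x).
  move=> h hw; have H := line_hol_lip r0 h (w := x) (w' := w).
  apply: (le_trans (H _ hw)); first by rewrite subrr nrm0; lra.
  by rewrite /C; have := nrm_ge0 (w - x); lra.
have glip w : nrm (w - x) < r / 2 -> normc (g w - g x) <= C * nrm (w - x).
  move=> hw; apply: (ulim_le (ulimB (lu w _) (lu x xx))); first by lra.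
  by apply: filterS bu => j h; exact: lip.
have e3 : 0 < e / 3 by lra.
exists ([set w | nrm (w - x) < Num.min (r / 2) (e / 3 / C)],
  [set j | (forall w, nrm (w - x) < r -> line_hol (u j) w /\ normc (u j w) <= M)
    /\ normc (u j x - g x) <= e / 3]) => /=.
  split; last by apply: filterS2 bu (lu x xx (e / 3) e3) => j; split.
  apply/nbhs_nrmP; exists (Num.min (r / 2) (e / 3 / C)) => //.
  by rewrite lt_min !divr_gt0.
move=> [w j] /= []; rewrite lt_min => /andP[hw]; rewrite ltr_pdivlMr// => hC [b1 b2].
have := lip _ _ b1 hw; have := glip _ hw => h1 h2.
have -> : u j w - g w = (u j w - u j x) + (u j x - g x) - (g w - g x) by ring.
apply: (le_trans (le_normcD _ _)); rewrite normcN.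
have := le_normcD (u j w - u j x) (u j x - g x); lra.
Qed.

End Uniformity.

(** * Orders of zeros and Hurwitz' theorem *)

Section Zeros.
Context {R : realType}.
Implicit Types (f g q : R[i] -> R[i]) (z w l : R[i]) (r M : R).

Lemma taylor2 f z r c : 0 < r -> disc_hol f z r -> cderiv (cd f) z c ->
  forall e, 0 < e -> exists2 s : R, 0 < s & forall h, normc h < s ->
    normc (f (z + h) - f z - cd f z * h - c / 2 * h ^+ 2) <= e * normc h ^+ 2.
Proof.
move=> r0 hf hc e e0; have [s s0 hs] := hc e e0.
exists (Num.min r s) => [|h]; first by rewrite lt_min r0.
rewrite lt_min => /andP[hr hhs].
pose g w := f w - ((0 + cd f z * w) + c / 2 * (((- z) + 1 * w) * ((- z) + 1 * w))).
have := @mean_value_le R g z (z + h) (e * normc h).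
have -> : g (z + h) - g z = f (z + h) - f z - cd f z * h - c / 2 * h ^+ 2.
  by rewrite /g; ring.
have -> : z + h - z = h by ring.
have -> : e * normc h ^+ 2 = e * normc h * normc h by rewrite expr2 mulrA.
apply=> t /andP[t0 t1].
have th : normc (t%:C * h) <= normc h.
  by rewrite normcM normc_real ger0_norm// ler_piMl// normc_ge0.
eexists.
  apply: cderivB; first by apply/cdP/hf; rewrite addrAC subrr add0r; lra.
  apply: cderivD; first exact: cderiv_affine.
  by apply: cderivZ; apply: cderivM; exact: cderiv_affine.
have := hs (t%:C * h).
set p := z + t%:C * h.
have -> : cd f p - cd f z - c * (t%:C * h) =
    cd f p - (cd f z + c / 2 * (1 * (- z + 1 * p) + (- z + 1 * p) * 1)).
  by rewrite /p; field.
move=> H; apply: (le_trans (H _)); first by lra.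
by rewrite ler_wpM2l// ltW.
Qed.

(** The second-order expansion shows that the quotient has derivative [c / 2] at 0, so dividing by
    [h] does not leave the class of holomorphic functions. *)
Lemma disc_hol_dquot f z r : 0 < r -> disc_hol f z r -> disc_hol (dquot f z) 0 r.
Proof.
move=> r0 hf w; rewrite subr0 => wr.
have [->|w0] := eqVneq w 0; last exact: dquot_hol wr hf.
have [c hc] := cderiv_cd r0 hf; exists (c / 2) => e e0.
have [s s0 hs] := taylor2 r0 hf hc e0; exists s => // h /hs.
rewrite add0r /dquot eqxx; case: eqVneq => [-> _|h0 H].
  by rewrite subrr mulr0 subr0 normc0 mulr0.
rewrite -(ler_pM2r (x := normc h)) ?normc_gt0// -normcM.
have -> : ((f (z + h) - f z) / h - cd f z - c / 2 * h) * h =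
  f (z + h) - f z - cd f z * h - c / 2 * h ^+ 2 by field.
by move: H; rewrite [normc h ^+ 2]expr2 mulrA.
Qed.

(** If [h ^ m] divides [f], the maximum principle for the quotient bounds |f(w)| by [(r / 8) ^ m * 2
    M / (r / 4) ^ m = 2 M / 2 ^ m], and [m] is arbitrary. *)
Lemma flat_zero f z r : 0 < r -> disc_hol f z r ->
  (forall m, exists2 q, disc_hol q 0 r &
     forall h, normc h < r -> f (z + h) = h ^+ m * q h) ->
  forall w, normc (w - z) < r / 8 -> f w = 0.
Proof.
move=> r0 hf hq w hw; pose a := w - z; rewrite -/a in hw.
have [|M hM] := disc_hol_bound (s := 7 / 8 * r) hf; first by lra.
have M0 : 0 <= M by rewrite (le_trans _ (hM z _)) ?normc_ge0// subrr normc0; lra.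
have bd m : normc (f w) <= 2 * M / 2 ^+ m.
  have [q hq1 hq2] := hq m.
  have ea : w = z + a by rewrite /a addrC subrK.
  rewrite ea hq2; last by lra.
  (* The disc of radius [3 / 4 * r] about [a] stays within [7 / 8 * r] of 0, and its outer half
     keeps distance [r / 4] from 0, which is where [q] can be estimated through [f]. *)
  have := @disc_center_le R (fun x => q (a + 1 * x)) (3 / 4 * r) (M / (r / 4) ^+ m).
  rewrite mulr0 addr0 normcM normcX => H.
  have r4 : 0 < (r / 4) ^+ m by rewrite exprn_gt0// divr_gt0.
  have {}H : normc (q a) <= 2 * (M / (r / 4) ^+ m).
    have hqa x : normc x < 3 / 4 * r -> exists D, cderiv (fun x => q (a + 1 * x)) x D.
      move=> hx; have [|D hD] := hq1 (a + 1 * x).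
        by rewrite subr0 mul1r (le_lt_trans (le_normcD _ _))//; lra.
      by exists (1 * D); exact: cderiv_affine_comp.
    apply: H => [|x _|| x /andP[x1 x2]]; first by lra.
    - exact: hqa.
    - by have [|D hD] := hqa 0; [rewrite normc0; lra|exact: cderiv_cont hD].
    have n1 := le_normc_sub x (- a); rewrite normcN opprK addrC in n1.
    have n2 := le_normcD a x.
    have n3 : r / 4 <= normc (a + x) by rewrite addrC; lra.
    rewrite mul1r ler_pdivlMr//.
    have := hM (z + (a + x)); rewrite hq2; last by lra.
    rewrite [z + _]addrC addrK normcM normcX => H.
    apply: le_trans (H _); last by lra.
    rewrite mulrC ler_wpM2r ?normc_ge0// lerXn2r// nnegrE ?normc_ge0//; lra.
  apply: (@le_trans _ _ ((r / 8) ^+ m * (2 * (M / (r / 4) ^+ m)))).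
    rewrite ler_pM ?exprn_ge0 ?normc_ge0// lerXn2r ?nnegrE ?normc_ge0//; lra.
  have -> : (r / 4) ^+ m = (r / 8) ^+ m * 2 ^+ m by rewrite -exprMn; congr (_ ^+ _); field.
  have n8 : (r / 8) ^+ m != 0 by rewrite expf_neq0// gt_eqF// divr_gt0.
  rewrite le_eqVlt; apply/orP; left; apply/eqP; field.
  by rewrite n8 expf_neq0.
apply/eqP; rewrite -normc_eq0; apply/eqP/le_anti; rewrite normc_ge0 andbT.
apply/ler_addgt0Pr => e e0; rewrite add0r.
have [m hm] := exists_half_lt (2 * M) e0.
exact: le_trans (bd m) (ltW hm).
Qed.

(** As long as the quotient vanishes at the centre, another factor [h] can be divided out. Either
    this never stops and [f] is flat, or it stops at the order [m], which is 0 where [f] does not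
    vanish. *)
Lemma zero_dichotomy f z r : 0 < r -> disc_hol f z r ->
  (forall w, normc (w - z) < r / 8 -> f w = 0) \/
  exists m q, [/\ disc_hol q 0 r, q 0 != 0 &
    forall h, normc h < r -> f (z + h) = h ^+ m * q h].
Proof.
move=> r0 hf; have [|ne] := pselect (exists m q, [/\ disc_hol q 0 r, q 0 != 0 &
    forall h, normc h < r -> f (z + h) = h ^+ m * q h]); first by right.
left; apply: flat_zero => // m; elim: m => [|m [q hq fq]].
  exists (fun h => f (z + 1 * h)) => [w|h _]; last by rewrite expr0 !mul1r.
  rewrite subr0 => wr; have [|D hD] := hf (z + 1 * w).
    by rewrite mul1r addrAC subrr add0r.
  by exists (1 * D); exact: cderiv_affine_comp.
have q0 : q 0 = 0.
  by apply: contrapT => q0; apply: ne; exists m, q; split=> //; exact/eqP.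
exists (dquot q 0); first exact: disc_hol_dquot.
move=> h hr; rewrite fq// /dquot add0r q0 subr0.
have [->|h0] := eqVneq h 0; first by rewrite q0 mulr0 exprS !mul0r.
by rewrite exprS; field.
Qed.

Context {U : set_system nat} {UU : UltraFilter U}.

(** If [g] had a zero of finite order at [z], then |g| would be at least some [c > 0] on a thin
    annulus. There |u j| would eventually be at least [c / 2], and the maximum principle for the
    reciprocal of the zero-free [u j] would give |u j z| at least [c / 4], although [u j z] tends to
    [g z = 0]. *)
Lemma hurwitz (u : nat -> R[i] -> R[i]) g z r M : 0 < r ->
  U [set j | disc_hol (u j) z r /\ forall w, normc (w - z) < r -> normc (u j w) <= M] ->
  (forall w, normc (w - z) < r -> ulim (U := U) (u^~ w) (g w)) ->
  U [set j | forall w, normc (w - z) < r -> u j w != 0] ->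
  g z = 0 -> forall w, normc (w - z) < r / 8 -> g w = 0.
Proof.
move=> r0 hu hg nz gz.
have ev w s : normc (w - z) + s <= r -> U [set j | disc_hol (u j) w s /\
    forall x, normc (x - w) < s -> normc (u j x) <= M].
  move=> hs; apply: filterS hu => j [h1 h2]; split; first exact: (disc_holS h1).
  move=> x hx; apply: h2; have -> : x - z = (x - w) + (w - z) by ring.
  by apply: (le_lt_trans (le_normcD _ _)); lra.
have lg w s : normc (w - z) + s <= r -> forall x, normc (x - w) < s ->
    ulim (U := U) (u^~ x) (g x).
  move=> hs x hx; apply: hg; have -> : x - z = (x - w) + (w - z) by ring.
  by apply: (le_lt_trans (le_normcD _ _)); lra.
have holg : disc_hol g z r.
  move=> w hw; have s0 : 0 < r - normc (w - z) by lra.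
  have hs : normc (w - z) + (r - normc (w - z)) <= r by lra.
  by have [] := cderiv_ulim s0 (ev _ _ hs) (lg _ _ hs).
have [//|[m [q [hq q0 gq]]]] := zero_dichotomy r0 holg; exfalso.
have n0 : 0 < normc (q 0) by rewrite normc_gt0.
have [|D hD] := hq 0; first by rewrite subrr normc0.
have [|s s0 hs] := cderiv_cont hD (e := normc (q 0) / 2); first by lra.
pose t := Num.min s (r / 2).
have t0 : 0 < t by rewrite lt_min s0 divr_gt0.
have [ts tr] : t <= s /\ t <= r / 2 by split; rewrite /t ge_min lexx ?orbT.
pose c := (t / 2) ^+ m * (normc (q 0) / 2).
have c0 : 0 < c by rewrite mulr_gt0 ?exprn_gt0 ?divr_gt0.
have gc h : t / 2 <= normc h < t -> c <= normc (g (z + h)).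
  move=> /andP[h1 h2]; rewrite gq; last by lra.
  rewrite normcM normcX /c ler_pM ?exprn_ge0 ?divr_ge0 ?normc_ge0 ?(ltW t0)//.
    by rewrite lerXn2r ?nnegrE ?normc_ge0 ?divr_ge0 ?(ltW t0).
  have := hs h; rewrite add0r => /(_ (lt_le_trans h2 ts)) H.
  by have := le_normc_sub (q 0) (q 0 - q h); rewrite subKr normcB; lra.
have unif : U [set j | forall w, normc (w - z) <= t -> normc (u j w - g w) <= c / 2].
  apply: (@ulim_uniform R R[i] U UU u g _ (@compact_disc R z t)); last by lra.
  move=> x /= xt; exists (r / 2), M; split; first by lra.
    have xr : normc (x - z) + r / 2 <= r by lra.
    apply: filterS (ev x _ xr) => j [h1 h2] w hw; split; last exact: h2.
    by apply/hol_at_line/cderiv_hol_at/h1.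
  by apply: lg; lra.
have zz : normc (z - z) < r by rewrite subrr normc0.
have c8 : 0 < c / 8 by lra.
have [j [[/= h1 _] [h2 [h3 h4]]]] := filter_ex (filterI hu (filterI nz
  (filterI unif (hg z zz _ c8)))).
rewrite gz subr0 in h4.
have := @disc_center_le R (fun h => (u j (z + 1 * h))^-1) t (2 / c) t0.
rewrite mulr0 addr0 normcV => H.
have hol h : normc h < t -> exists D, cderiv (fun h => (u j (z + 1 * h))^-1) h D.
  move=> ht; have hzr : normc (z + 1 * h - z) < r.
    by rewrite mul1r addrAC subrr add0r; lra.
  have [E hE] := h1 _ hzr; eexists; apply: cderivV; first exact: h2.
  exact: cderiv_affine_comp hE.
have {}H : (normc (u j z))^-1 <= 2 * (2 / c).
  apply: H => [h _|| h ht]; first exact: hol.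
    by have [|E hE] := hol 0; [rewrite normc0|exact: cderiv_cont hE].
  rewrite normcV mul1r -[2 / c]invf_div lef_pV2 ?posrE; last 2 first.
  - by rewrite normc_gt0; apply: h2; rewrite addrAC subrr add0r; case/andP: ht; lra.
  - by rewrite divr_gt0.
  have := gc h ht; have := h3 (z + h).
  rewrite [z + h - z]addrAC subrr add0r => /(_ (ltW (proj2 (andP ht)))) a b.
  by have := le_normc_sub (g (z + h)) (g (z + h) - u j (z + h)); rewrite subKr normcB; lra.
have uz : 0 < normc (u j z) by rewrite normc_gt0; apply: h2; rewrite subrr normc0.
have : 1 <= 2 * (2 / c) * normc (u j z).
  by rewrite -ler_pdivrMr// div1r.
have -> : 2 * (2 / c) * normc (u j z) = 4 * normc (u j z) / c by ring.
rewrite ler_pdivlMr//; lra.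
Qed.

End Zeros.

(** * Marty's theorem *)

Section Marty.
Context {R : realType} {V : normedModType R[i]}.
Implicit Types (f g : V -> R[i]) (z w h : V) (r M C : R).

(** The spherical derivative is at most [C], measured in the norm of [V] and stated without quotient
    or supremum. *)
Definition spherical_bound f C w : Prop := exists L, [/\ clin L, Dat f w L &
  forall h, normc (L h) <= C * nrm h * (1 + normc (f w) ^+ 2)].

(* A bound on the spherical derivative makes [chord f] Lipschitz; it replaces
   the chordal metric of the sphere. *)
Definition chord f w : R := (1 + normc (f w) ^+ 2)^-1.

(** The denominator [1 + b ^ 2] is what cancels the same factor in the spherical bound, making the
    Lipschitz constant of [chord] independent of the size of [f]. *)
Lemma inv_sqr_le (a b d : R) : 0 <= a -> 0 <= b -> `|a - b| <= d -> d <= 1 ->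
  `|(1 + a ^+ 2)^-1 - (1 + b ^+ 2)^-1| <= 2 * d / (1 + b ^+ 2).
Proof.
move=> a0 b0 ab d1.
have A : 0 < 1 + a ^+ 2 by nra.
have B : 0 < 1 + b ^+ 2 by nra.
have -> : (1 + a ^+ 2)^-1 - (1 + b ^+ 2)^-1 = (b - a) * (a + b) / (1 + a ^+ 2) / (1 + b ^+ 2).
  by field; rewrite !gt_eqF.
rewrite !normrM !normfV (gtr0_norm A) (gtr0_norm B) (ger0_norm (addr_ge0 a0 b0)) distrC.
rewrite ler_wpM2r ?invr_ge0 ?(ltW B)// ler_pdivrMr//.
have : a + b <= 2 * (1 + a ^+ 2).
  by move: ab; rewrite ler_norml => /andP[h1 h2]; have := sqr_ge0 (a - 1); nra.
have d0 : 0 <= d := le_trans (normr_ge0 _) ab.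
move=> h; have := ler_pM (normr_ge0 _) (addr_ge0 a0 b0) ab h; lra.
Qed.

Lemma chord_lip f z r C : 0 <= C -> (forall w, nrm (w - z) < r -> spherical_bound f C w) ->
  forall w w', nrm (w - z) < r -> nrm (w' - z) < r ->
  `|chord f w - chord f w'| <= 2 * (C + 1) * nrm (w' - w).
Proof.
move=> C0 hf w w' hw hw'; pose v := w' - w; pose p (t : R) := w + t%:C *: v.
have -> : chord f w = chord f (p 0) by rewrite /p scale0r addr0.
have -> : chord f w' = chord f (p 1) by rewrite /p scale1r addrC subrK.
apply: (@lipschitz_of_local _ (fun a b => `|chord f (p a) - chord f (p b)|)) => [a b c|a b|].
- have -> : chord f (p a) - chord f (p c) =
    (chord f (p a) - chord f (p b)) + (chord f (p b) - chord f (p c)) by ring.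
  exact: ler_normD.
- exact: distrC.
move=> t ht e e0; have [L [lL DL CL]] := hf _ (convex_nrm ht hw hw').
rewrite -/v -/(p t) in DL CL.
set y := normc (f (p t)) in CL.
have v0 : 0 <= nrm v := nrm_ge0 _.
have Y : 0 < 1 + y ^+ 2 by have := sqr_ge0 y; lra.
pose K := (nrm v + 1) * ((C + 1) * (1 + y ^+ 2)).
have K0 : 0 < K by rewrite !mulr_gt0//; lra.
have [r1 r10 h1] := DL 1 ltr01.
exists (Num.min (r1 / (nrm v + 1)) K^-1) => [|s hs].
  by rewrite lt_min divr_gt0 ?invr_gt0//; lra.
have n0 := normr_ge0 (s - t).
rewrite lt_min ltr_pdivlMr; last by lra.
rewrite -[K^-1]div1r ltr_pdivlMr// => /andP[hr1 hK].
have ps : p s = p t + (s - t)%:C *: v.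
  by rewrite /p -addrA -scalerDl; congr (_ + _ *: _); rewrite rmorphB addrC subrK.
have nst : nrm ((s - t)%:C *: v) = `|s - t| * nrm v by rewrite nrmZ normc_real.
have := h1 ((s - t)%:C *: v); rewrite -ps nst => /(_ _).
have hr : `|s - t| * nrm v < r1 by lra.
move=> /(_ hr) H.
pose d := (C + 1) * (1 + y ^+ 2) * (nrm v * `|s - t|).
have d1 : d <= 1.
  have : d <= K * `|s - t|.
    rewrite /d /K [(nrm v + 1) * _]mulrC -[X in _ <= X]mulrA ler_wpM2l//.
      by rewrite mulr_ge0 ?(ltW Y)//; lra.
    by rewrite ler_wpM2r//; lra.
  by lra.
have xy : normc (f (p s) - f (p t)) <= d.
  have -> : f (p s) - f (p t) = (f (p s) - f (p t) - L ((s - t)%:C *: v)) + L ((s - t)%:C *: v).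
    by ring.
  apply: (le_trans (le_normcD _ _)); have := CL ((s - t)%:C *: v); rewrite nst => H2.
  apply: (le_trans (lerD H H2)); rewrite /d.
  set q := `|s - t| * nrm v; have q0 : 0 <= q by rewrite mulr_ge0.
  rewrite [nrm v * _]mulrC -/q.
  have : 0 <= y ^+ 2 * q by rewrite mulr_ge0 ?sqr_ge0.
  lra.
have xy' : `|normc (f (p s)) - y| <= d.
  rewrite ler_norml; have := le_normc_sub (f (p s)) (f (p t)).
  by have := le_normc_sub (f (p t)) (f (p s)); rewrite normcB -/y; lra.
have := inv_sqr_le (normc_ge0 _) (normc_ge0 _) xy' d1.
rewrite -/(chord f (p s)) -/(chord f (p t)) => H3; apply: (le_trans H3).
have -> : 2 * d / (1 + y ^+ 2) = 2 * (C + 1) * nrm v * `|s - t|.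
  by rewrite /d; field; rewrite gt_eqF.
by have := mulr_ge0 (ltW e0) n0; rewrite -/v; lra.
Qed.

Lemma spherical_bound_hol f C w : spherical_bound f C w -> hol_at f w.
Proof. by move=> [L [h1 h2 _]]; exists L. Qed.

Context {U : set_system nat} {UU : UltraFilter U}.
Variables (u : nat -> V -> R[i]).
Hypothesis compact_balls : forall z r, compact [set w : V | nrm (w - z) <= r].

Let sb z r C := 0 < r /\
  U [set j | forall w, nrm (w - z) < r -> spherical_bound (u j) C w].

Let bdd z := exists B, U [set j | normc (u j z) <= B].

Let notbdd z (B : R) : ~ bdd z -> U [set j | B < normc (u j z)].
Proof.
move=> nb; have [h|] := in_ultra_setVsetC [set j | normc (u j z) <= B] UU.
  by exfalso; apply: nb; exists B.
by apply: filterS => j /= /negP; rewrite -ltNge.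
Qed.

Let sbC z r C : sb z r C -> exists2 C', 0 <= C' & sb z r C'.
Proof.
move=> [r0 h]; exists `|C| => //; split=> //; apply: filterS h => j h w /h [L [h1 h2 h3]].
exists L; split=> // k; apply: (le_trans (h3 k)).
rewrite ler_wpM2r ?addr_ge0 ?sqr_ge0// ler_wpM2r ?nrm_ge0//; exact: ler_norm.
Qed.

(** A bound on [u j z] keeps [chord] away from 0 at [z]; being Lipschitz uniformly in [j], it stays
    above half that level on a common ball, which bounds [u j] there. *)
Lemma bounded_nbhs z r C : sb z r C -> bdd z -> exists s M, [/\ 0 < s, s <= r &
  U [set j | forall w, nrm (w - z) < s -> hol_at (u j) w /\ normc (u j w) <= M]].
Proof.
move=> /sbC[{}C C0 [r0 hs]] [B0 hB0]; pose B := `|B0|.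
have hB : U [set j | normc (u j z) <= B].
  by apply: filterS hB0 => j /= h; apply: (le_trans h); exact: ler_norm.
have B1 : 0 < 1 + B ^+ 2 by have := sqr_ge0 B; lra.
pose s0 := (1 + B ^+ 2)^-1; have s00 : 0 < s0 by rewrite invr_gt0.
pose K := 2 * (C + 1); have K0 : 0 < K by rewrite /K; lra.
exists (Num.min r (s0 / 2 / K)), (2 / s0); split.
- by rewrite lt_min r0 !divr_gt0.
- by rewrite ge_min lexx.
apply: filterS2 hs hB => j hj /= Bj w; rewrite lt_min ltr_pdivlMr// => /andP[wr wK].
split; first exact/spherical_bound_hol/hj.
have zr : nrm (z - z) < r by rewrite subrr nrm0.
have := chord_lip C0 hj zr wr; rewrite -/K => H.
have sz : s0 <= chord (u j) z.
  rewrite lef_pV2 ?posrE//; last by have := sqr_ge0 (normc (u j z)); lra.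
  by rewrite lerD2l lerXn2r ?nnegrE ?normc_ge0// normr_ge0.
have sw : s0 / 2 <= chord (u j) w by move: H; rewrite ler_norml; lra.
set x := normc (u j w); have x0 : 0 <= x := normc_ge0 _.
have X : 0 < 1 + x ^+ 2 by nra.
have : 1 + x ^+ 2 <= 2 / s0.
  rewrite -(invf_div s0 2) -[X in X <= _]invrK lef_pV2 ?posrE ?invr_gt0//.
  by rewrite divr_gt0.
by have := sqr_ge0 (x - 1); nra.
Qed.

(** Along the ultrafilter, not bounded means tending to infinity. [chord] is then at most 1/4 at [z]
    and at most 1/2 nearby, so |u j| is at least 1 there. The reciprocals are bounded and zero-free,
    with a limit vanishing at [z]; Hurwitz on every complex line through [z] makes this limit 0 on a
    ball, and uniformity gives divergence to infinity. *)
Lemma unbounded_nbhs z r C : sb z r C -> ~ bdd z -> exists2 s, 0 < s &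
  forall B, U [set j | forall w, nrm (w - z) < s -> B < normc (u j w)].
Proof.
move=> /sbC[{}C C0 [r0 hs]] nb.
pose K := 2 * (C + 1); have K0 : 0 < K by rewrite /K; lra.
pose s := Num.min r (1 / 4 / K).
have s0 : 0 < s by rewrite lt_min r0 !divr_gt0.
have ge1 : U [set j | forall w, nrm (w - z) < s ->
    line_hol (u j) w /\ 1 <= normc (u j w)].
  apply: filterS2 hs (notbdd 2 nb) => j hj /= Bj w.
  rewrite lt_min => /andP[wr]; rewrite ltr_pdivlMr// => wK.
  split; first exact/hol_at_line/spherical_bound_hol/hj.
  have zr : nrm (z - z) < r by rewrite subrr nrm0.
  have := chord_lip C0 hj zr wr; rewrite -/K => H.
  have sz : chord (u j) z <= 4^-1.
    rewrite lef_pV2 ?posrE//; last by have := sqr_ge0 (normc (u j z)); lra.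
    by have := sqr_ge0 (normc (u j z) - 2); nra.
  have sw : chord (u j) w <= 2^-1 by move: H; rewrite ler_norml; lra.
  move: sw; rewrite lef_pV2 ?posrE//; last first.
    by have := sqr_ge0 (normc (u j w)); lra.
  by have := normc_ge0 (u j w); nra.
pose h j w := (u j w)^-1.
have hb : U [set j | forall w, nrm (w - z) < s ->
    [/\ line_hol (h j) w, normc (h j w) <= 1 & h j w != 0]].
  apply: filterS ge1 => j hj w /hj [h1 h2].
  have u0 : u j w != 0 by rewrite -normc_gt0; lra.
  split; [exact: line_holV|rewrite normcV|by rewrite invr_eq0].
  by rewrite invf_le1//; lra.
have [g hg] : {g & forall w, nrm (w - z) < s -> ulim (U := U) (h^~ w) (g w)}.
  apply: (@boolp.choice _ _ (fun w c => nrm (w - z) < s -> ulim (U := U) (h^~ w) c)) => w.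
  have [ws|ws] := boolP (nrm (w - z) < s); last by exists 0.
  have [|c hc] := @ulim_exists _ U UU (h^~ w) 1; last by exists c.
  by apply: filterS hb => j /(_ w ws)[].
have zs : nrm (z - z) < s by rewrite subrr nrm0.
have gz : g z = 0.
  apply: (ulim_unique (hg z zs)) => e e0.
  apply: filterS (notbdd e^-1 nb) => j /= hj; rewrite subr0 normcV.
  by rewrite invf_ple ?posrE ?ltW// (lt_trans _ hj)// invr_gt0.
have g0 w : nrm (w - z) < s / 16 -> g w = 0.
  move=> ws; pose v := w - z.
  have [v0|v0] := eqVneq (nrm v) 0.
    by have -> : w = z; [apply/eqP; rewrite -subr_eq0; apply/eqP/nrm_eq0|].
  have vp : 0 < nrm v by rewrite lt_def v0 nrm_ge0.
  have lv t : normc (t - 0) < s / nrm v -> nrm (z + t *: v - z) < s.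
    by rewrite subr0 ltr_pdivlMr// -nrmZ addrAC subrr add0r.
  have := @hurwitz R U UU (fun j t => h j (z + t *: v)) (fun t => g (z + t *: v))
    0 (s / nrm v) 1.
  rewrite scale0r addr0 => H.
  have -> : g w = g (z + 1 *: v) by rewrite scale1r /v addrC subrK.
  apply: H => //.
  - by rewrite divr_gt0.
  - apply: filterS hb => j hj; split; last by move=> t /lv /hj [].
    by apply: line_hol_disc => // x /hj [].
  - by move=> t /lv; exact: hg.
  - by apply: filterS hb => j hj t /lv /hj [].
  - rewrite subr0 normc1 -[s / nrm v / 8]mulrA -invfM ltr_pdivlMr ?mulr_gt0// mul1r.
    by rewrite -/v in ws; lra.
have s16 : 0 < s / 32 by lra.
exists (s / 32) => // B.
have B0 : 0 < (`|B| + 1)^-1 by rewrite invr_gt0; have := normr_ge0 B; lra.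
have unif : U [set j | forall w, nrm (w - z) <= s / 32 ->
    normc (h j w - g w) <= (`|B| + 1)^-1].
  apply: (@ulim_uniform R V U UU h g _ (@compact_balls z (s / 32)) _ _ B0) => x /= xs.
  exists (s / 2), 1; split; first by lra.
    apply: filterS hb => j hj w hw.
    have [|h1 h2 _] := hj w; last by [].
    by apply: (@nrm_sub _ _ z x (s / 2) (s / 2)) hw; lra.
  move=> w hw; apply: hg; apply: (@nrm_sub _ _ z x (s / 2) (s / 2)) hw; lra.
apply: filterS2 unif ge1 => j h1 h2 w hw.
have := h1 w (ltW hw); rewrite g0; last by lra.
rewrite subr0 normcV => H.
have u1 : 1 <= normc (u j w) by have [|_] := h2 w; first by lra.
have Bp : 0 < `|B| + 1 by have := normr_ge0 B; lra.
move: H; rewrite lef_pV2 ?posrE; [|lra|exact: Bp].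
by have := ler_norm B; lra.
Qed.

(** The points of [D] where the sequence is bounded and those where it is not form two open sets, so
    by connectedness one behaviour holds throughout. *)
Theorem marty (D : set V) : open D -> connected D ->
  (forall z, D z -> exists r C, sb z r C) ->
  (exists g, forall z, D z -> [/\ hol_at g z, ulim (U := U) (u^~ z) (g z) &
     exists s M, [/\ 0 < s, 
       U [set j | forall w, nrm (w - z) < s -> hol_at (u j) w /\ normc (u j w) <= M] &
       forall e, 0 < e -> U [set j | forall w, nrm (w - z) < s -> normc (u j w - g w) <= e]]])
  \/ (forall z, D z -> exists2 s, 0 < s &
     forall B, U [set j | forall w, nrm (w - z) < s -> B < normc (u j w)]).
Proof.
move=> oD cD hD.
pose A := [set z | D z /\ bdd z].
have oA : open A.
  rewrite openE => z [Dz bz]; have [r [C hr]] := hD z Dz.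
  have [s [M [s0 _ hs]]] := bounded_nbhs hr bz.
  have := oD; rewrite openE => /(_ z Dz) /nbhs_nrmP[d d0 hd].
  apply/nbhs_nrmP; exists (Num.min d s); first by rewrite lt_min d0.
  move=> w; rewrite lt_min => /andP[wd ws]; split; first exact: hd.
  by exists M; apply: filterS hs => j /(_ w ws)[].
have oB : open [set z | D z /\ ~ bdd z].
  rewrite openE => z [Dz bz]; have [r [C hr]] := hD z Dz.
  have [s s0 hs] := unbounded_nbhs hr bz.
  have := oD; rewrite openE => /(_ z Dz) /nbhs_nrmP[d d0 hd].
  apply/nbhs_nrmP; exists (Num.min d s); first by rewrite lt_min d0.
  move=> w; rewrite lt_min => /andP[wd ws]; split; first exact: hd.
  move=> [M hM]; have [j [h1 h2]] := filter_ex (filterI hM (hs M)).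
  by have := lt_le_trans (h2 w ws) h1; rewrite ltxx.
have [A0|nA0] := pselect (A !=set0); last first.
  right=> z Dz; have [r [C hr]] := hD z Dz; apply: (unbounded_nbhs hr).
  by move=> bz; apply: nA0; exists z.
have AD : A = D.
  apply: cD => //.
    by exists A => //; apply/seteqP; split=> [z [Dz bz]|z [Dz] //]; split.
  exists (~` [set z | D z /\ ~ bdd z]); first exact: open_closedC.
  apply/seteqP; split=> [z [Dz bz]|z [Dz nz]].
    by split=> // -[].
  by split=> //; apply: contrapT => nbz; apply: nz.
have bD z : D z -> bdd z by rewrite -AD => -[].
left.
have [g hg] : {g & forall z, D z -> ulim (U := U) (u^~ z) (g z)}.
  apply: (@boolp.choice _ _ (fun z c => D z -> ulim (U := U) (u^~ z) c)) => z.
  have [Dz|nDz] := pselect (D z); last by exists 0.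
  have [B hB] := bD z Dz; have [c hc] := ulim_exists hB; by exists c.
exists g => z Dz; have [r [C hr]] := hD z Dz.
have [s [M [s0 _ hs]]] := bounded_nbhs hr (bD z Dz).
have := oD; rewrite openE => /(_ z Dz) /nbhs_nrmP[d d0 hd].
pose t := Num.min d s; have t0 : 0 < t by rewrite lt_min d0.
have [td ts] : t <= d /\ t <= s by split; rewrite /t ge_min lexx ?orbT.
have ht : U [set j | forall w, nrm (w - z) < t -> hol_at (u j) w /\ normc (u j w) <= M].
  by apply: filterS hs => j hj w wt; apply: hj; lra.
have gt w : nrm (w - z) < t -> ulim (U := U) (u^~ w) (g w).
  by move=> wt; apply/hg/hd; lra.
split; [|exact: hg|].
  by have [L [lL DL _]] := hol_at_ulim t0 ht gt; exists L.
exists (t / 2), M; split; first by lra.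
  by apply: filterS ht => j hj w wt; apply: hj; lra.
move=> e e0.
suff : U [set j | forall w, nrm (w - z) <= t / 2 -> normc (u j w - g w) <= e].
  by apply: filterS => j hj w /ltW; exact: hj.
apply: (@ulim_uniform R V U UU u g _ (@compact_balls z (t / 2)) _ _ e0) => x /= xt.
have xt2 : nrm (x - z) < 3 / 4 * t by lra.
have st : 3 / 4 * t + t / 4 <= t by lra.
exists (t / 4), M; split; first by lra.
  apply: filterS ht => j hj w hw; have [|h1 h2] := hj w; last by split=> //; exact: hol_at_line.
  exact: (nrm_sub xt2 st).
by move=> w hw; apply: gt; exact: (nrm_sub xt2 st).
Qed.

End Marty.

(** * Ahlfors' lemma *)

Section Laplacian.
Context {R : realType}.
Implicit Types (u v : R[i] -> R) (f F : R[i] -> R[i]) (z w h a b : R[i]) (c r : R).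

(* [a] is twice the holomorphic gradient of [u] at [z], and [c] a quarter of
   its Laplacian. *)
Definition lap u z a c : Prop := exists b, forall e : R, 0 < e ->
  exists2 s : R, 0 < s & forall h, normc h < s ->
    `|u (z + h) - u z - (complex.Re (a * h + b * h ^+ 2) + c * normc h ^+ 2)|
      <= e * normc h ^+ 2.

Definition expand2 (phi : R -> R) (x p1 p2 : R) : Prop := forall e : R, 0 < e ->
  exists2 s : R, 0 < s & forall t, `|t| < s ->
    `|phi (x + t) - phi x - (p1 * t + p2 * t ^+ 2)| <= e * t ^+ 2.

Lemma ReD a b : complex.Re (a + b) = complex.Re a + complex.Re b.
Proof. by case: a b => ? ? []. Qed.

Lemma ReZ c a : complex.Re (c%:C * a) = c * complex.Re a.
Proof. by case: a => ? ? /=; rewrite mul0r subr0. Qed.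

Lemma lapD u v z a b c d : lap u z a c -> lap v z b d ->
  lap (fun w => u w + v w) z (a + b) (c + d).
Proof.
move=> [b1 h1] [b2 h2]; exists (b1 + b2) => e e0.
have e2 : 0 < e / 2 by lra.
have [s1 s10 k1] := h1 _ e2; have [s2 s20 k2] := h2 _ e2.
exists (Num.min s1 s2) => [|h]; first by rewrite lt_min s10.
rewrite lt_min => /andP[/k1 {}k1 /k2 {}k2].
have -> : u (z + h) + v (z + h) - (u z + v z) -
  (complex.Re ((a + b) * h + (b1 + b2) * h ^+ 2) + (c + d) * normc h ^+ 2) =
  (u (z + h) - u z - (complex.Re (a * h + b1 * h ^+ 2) + c * normc h ^+ 2)) +
  (v (z + h) - v z - (complex.Re (b * h + b2 * h ^+ 2) + d * normc h ^+ 2)).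
  by rewrite !mulrDl !ReD; ring.
apply: (le_trans (ler_normD _ _)); lra.
Qed.

Lemma lapZ (k : R) u z a c : lap u z a c -> lap (fun w => k * u w) z (k%:C * a) (k * c).
Proof.
move=> [b hb]; exists (k%:C * b) => e e0.
have K0 : 0 < `|k| + 1 by have := normr_ge0 k; lra.
have [|s s0 hs] := hb (e / (`|k| + 1)); first by rewrite divr_gt0.
exists s => // h /hs H.
have -> : k * u (z + h) - k * u z -
  (complex.Re (k%:C * a * h + k%:C * b * h ^+ 2) + k * c * normc h ^+ 2) =
  k * (u (z + h) - u z - (complex.Re (a * h + b * h ^+ 2) + c * normc h ^+ 2)).
  by rewrite -!mulrA -mulrDr ReZ; ring.
rewrite normrM; apply: (le_trans (ler_wpM2l (normr_ge0 _) H)).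
have -> : `|k| * (e / (`|k| + 1) * normc h ^+ 2) =
  e * normc h ^+ 2 * (`|k| / (`|k| + 1)) by field; rewrite gt_eqF.
apply: ler_piMr; first by rewrite mulr_ge0 ?sqr_ge0// ltW.
by rewrite ler_pdivrMr//; lra.
Qed.

Lemma lap_shift k u z a c : lap u z a c -> lap (fun w => k + u w) z a c.
Proof.
move=> [b hb]; exists b => e /hb[s s0 hs]; exists s => // h /hs.
by have -> : k + u (z + h) - (k + u z) = u (z + h) - u z by ring.
Qed.

Lemma Re_sqr a : complex.Re a ^+ 2 = normc a ^+ 2 / 2 + complex.Re (a ^+ 2) / 2.
Proof. by rewrite normcE2; case: a => x y /=; field. Qed.

(** The square of the linear term is [Re(a h)^2 = |a h|^2 / 2 + Re((a h)^2) / 2]. The first half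
    feeds the Laplacian; the second is absorbed by the coefficient of [h ^ 2], which [lap] leaves
    free. *)
Lemma lap_comp (phi : R -> R) u z a c p1 p2 : lap u z a c -> expand2 phi (u z) p1 p2 ->
  lap (fun w => phi (u w)) z (p1%:C * a) (p1 * c + p2 / 2 * normc a ^+ 2).
Proof.
move=> [b hb] hphi; exists (p1%:C * b + (p2 / 2)%:C * a ^+ 2) => e e0.
have na := normc_ge0 a; have nb := normc_ge0 b; have nc := normr_ge0 c.
pose B := normc b + `|c| + 1; have B0 : 0 < B by rewrite /B; lra.
pose A := normc a + B; have A0 : 0 < A by rewrite /A; lra.
have [s1 s10 h1] := hb 1 ltr01.
have n1 := normr_ge0 p1; have n2 := normr_ge0 p2.
have [|s2 s20 h2] := hb (e / 3 / (`|p1| + 1)); first by rewrite !divr_gt0// ltr_wpDl.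
have [|s3 s30 h3] := hphi (e / 3 / A ^+ 2); first by rewrite !divr_gt0// exprn_gt0.
pose K := (`|p2| + 1) * (2 * normc a * B + B ^+ 2 + 1).
have K0 : 0 < K by rewrite mulr_gt0//; nra.
exists (Num.min (Num.min s1 s2) (Num.min (s3 / A) (Num.min 1 (e / 3 / K)))) => [|h].
  by rewrite !lt_min s10 s20 !divr_gt0//; lra.
rewrite !lt_min => /andP[/andP[/h1 {}h1 /h2 {}h2] /and3P[hs3 hl1 hK]].
set t := u (z + h) - u z in h1 h2 *; set n := normc h in h1 h2 hs3 hl1 hK *.
have n0 : 0 <= n := normc_ge0 h.
have nn : n ^+ 2 <= n by nra.
set rho := t - complex.Re (a * h).
have rB : `|rho| <= B * n ^+ 2.
  have -> : rho = (t - (complex.Re (a * h + b * h ^+ 2) + c * n ^+ 2))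
     + (complex.Re (b * h ^+ 2) + c * n ^+ 2) by rewrite /rho ReD; ring.
  have k1 := ler_normD (t - (complex.Re (a * h + b * h ^+ 2) + c * n ^+ 2))
     (complex.Re (b * h ^+ 2) + c * n ^+ 2).
  have k2 := ler_normD (complex.Re (b * h ^+ 2)) (c * n ^+ 2).
  have := le_Re_normc (b * h ^+ 2); rewrite normcM normcX -/n => k3.
  have : `|c * n ^+ 2| = `|c| * n ^+ 2 by rewrite normrM (ger0_norm (sqr_ge0 n)).
  rewrite /B; lra.
have ra : `|complex.Re (a * h)| <= normc a * n.
  by have := le_Re_normc (a * h); rewrite normcM.
have et : t = complex.Re (a * h) + rho by rewrite /rho; ring.
have tA : `|t| <= A * n.
  have := ler_normD (complex.Re (a * h)) rho; rewrite -et /A; nra.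
have {}h3 := h3 t; move: h3; rewrite [u z + t]addrC subrK => /(_ _) h3.
have {}h3 : `|phi (u (z + h)) - phi (u z) - (p1 * t + p2 * t ^+ 2)| <= e / 3 * n ^+ 2.
  apply: (le_trans (h3 _)).
    by apply: (le_lt_trans tA); rewrite mulrC -ltr_pdivlMr.
  have : t ^+ 2 <= A ^+ 2 * n ^+ 2.
    rewrite -exprMn -(real_normK (num_real t)) lerXn2r ?nnegrE//.
    by rewrite mulr_ge0// ltW.
  move=> tt; apply: (le_trans (ler_wpM2l _ tt)).
    by rewrite ltW// !divr_gt0// exprn_gt0.
  by rewrite mulrA divfK// expf_neq0// gt_eqF.
have {}h2 : `|p1 * (t - (complex.Re (a * h + b * h ^+ 2) + c * n ^+ 2))| <= e / 3 * n ^+ 2.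
  rewrite normrM; apply: (le_trans (ler_wpM2l n1 h2)).
  rewrite mulrA ler_wpM2r ?sqr_ge0// mulrA ler_pdivrMr; last by lra.
  nra.
have h4 : `|p2 * (2 * complex.Re (a * h) * rho + rho ^+ 2)| <= e / 3 * n ^+ 2.
  have k1 : `|2 * complex.Re (a * h) * rho + rho ^+ 2| <= (2 * normc a * B + B ^+ 2) * n * n ^+ 2.
    apply: (le_trans (ler_normD _ _)).
    have m1 : `|2 * complex.Re (a * h) * rho| <= 2 * (normc a * n) * (B * n ^+ 2).
      rewrite !normrM [`|2|]ger0_norm// -mulrA -[X in _ <= X]mulrA ler_wpM2l//.
      by rewrite ler_pM.
    have m2 : `|rho ^+ 2| <= B ^+ 2 * n * n ^+ 2.
      rewrite normrX; apply: (@le_trans _ _ ((B * n ^+ 2) ^+ 2)).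
        by rewrite lerXn2r ?nnegrE// mulr_ge0 ?sqr_ge0// ltW.
      rewrite exprMn -mulrA ler_wpM2l ?sqr_ge0// [(n ^+ 2) ^+ 2]expr2.
      by rewrite ler_wpM2r ?sqr_ge0.
    lra.
  rewrite normrM; apply: (@le_trans _ _ (K * n * n ^+ 2)).
    have -> : K * n * n ^+ 2 = (`|p2| + 1) *
      ((2 * normc a * B + B ^+ 2 + 1) * n * n ^+ 2) by rewrite /K; ring.
    apply: ler_pM => //; first by lra.
    apply: (le_trans k1); rewrite -[X in X <= _]mulrA -[X in _ <= X]mulrA.
    by rewrite ler_wpM2r ?mulr_ge0 ?sqr_ge0//; lra.
  rewrite ler_wpM2r ?sqr_ge0//; move: hK; rewrite ltr_pdivlMr//; lra.
have -> : phi (u (z + h)) - phi (u z) -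
  (complex.Re (p1%:C * a * h + (p1%:C * b + (p2 / 2)%:C * a ^+ 2) * h ^+ 2) +
   (p1 * c + p2 / 2 * normc a ^+ 2) * n ^+ 2) =
  (phi (u (z + h)) - phi (u z) - (p1 * t + p2 * t ^+ 2)) +
  p1 * (t - (complex.Re (a * h + b * h ^+ 2) + c * n ^+ 2)) +
  p2 * (2 * complex.Re (a * h) * rho + rho ^+ 2).
  have -> : p1%:C * a * h + (p1%:C * b + (p2 / 2)%:C * a ^+ 2) * h ^+ 2 =
    p1%:C * (a * h + b * h ^+ 2) + (p2 / 2)%:C * (a * h) ^+ 2 by ring.
  have k : complex.Re (a * h) ^+ 2 = normc a ^+ 2 * n ^+ 2 / 2 + complex.Re ((a * h) ^+ 2) / 2.
    by rewrite Re_sqr normcM exprMn.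
  rewrite [complex.Re (_ + (p2 / 2)%:C * _)]ReD !ReZ.
  have -> : complex.Re ((a * h) ^+ 2) = 2 * complex.Re (a * h) ^+ 2 - normc a ^+ 2 * n ^+ 2.
    by rewrite k; field.
  by rewrite [in p2 * t ^+ 2]et /rho; field.
have := ler_normD (phi (u (z + h)) - phi (u z) - (p1 * t + p2 * t ^+ 2) +
  p1 * (t - (complex.Re (a * h + b * h ^+ 2) + c * n ^+ 2)))
  (p2 * (2 * complex.Re (a * h) * rho + rho ^+ 2)).
have := ler_normD (phi (u (z + h)) - phi (u z) - (p1 * t + p2 * t ^+ 2))
  (p1 * (t - (complex.Re (a * h + b * h ^+ 2) + c * n ^+ 2))).
lra.
Qed.

(** Adding the expansions at [t], [i t], [- t] and [- i t] cancels both the linear term and the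
    [h ^ 2] term, so that only [c t ^ 2] is left. *)
Lemma lap_max u z a c r : lap u z a c -> 0 < r ->
  (forall h, normc h < r -> u (z + h) <= u z) -> c <= 0.
Proof.
move=> [b hb] r0 hm; apply/ler_addgt0Pr => e e0; rewrite add0r.
have [s s0 hs] := hb e e0.
pose t := Num.min r s / 2; have t0 : 0 < t by rewrite divr_gt0// lt_min r0.
have [tr ts] : t < r /\ t < s.
  have m1 : Num.min r s <= r by rewrite ge_min lexx.
  have m2 : Num.min r s <= s by rewrite ge_min lexx orbT.
  by split; rewrite /t; lra.
clearbody t.
have key h : normc h = t ->
    - e * t ^+ 2 <= - (complex.Re (a * h + b * h ^+ 2) + c * t ^+ 2).
  move=> ht; have := hs h; have := hm h; rewrite ht => /(_ tr) h1 /(_ ts).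
  by rewrite ler_norml; lra.
have nt : normc t%:C = t by rewrite normc_real gtr0_norm.
have nit : normc ('i%C * t%:C) = t by rewrite normcM normc_i mul1r.
have k1 := key _ nt; have k2 := key _ nit.
have k3 : - e * t ^+ 2 <= _ := key (- t%:C) ltac:(by rewrite normcN).
have k4 : - e * t ^+ 2 <= _ := key (- ('i%C * t%:C)) ltac:(by rewrite normcN).
move: k1 k2 k3 k4; rewrite !ReD !mulrN !sqrrN !exprMn sqr_i !mulN1r.
rewrite !mulrN !raddfN /= => k1 k2 k3 k4.
have t2 : 0 < t ^+ 2 by rewrite exprn_gt0.
have : c * t ^+ 2 <= e * t ^+ 2 by lra.
by rewrite ler_pM2r.
Qed.

Lemma normcD_sqr a b : normc (a + b) ^+ 2 =
  normc a ^+ 2 + normc b ^+ 2 + 2 * complex.Re (a^* * b).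
Proof. by rewrite !normcE2; case: a b => ? ? [? ?] /=; ring. Qed.

Lemma normc_conj a : normc (a^*) = normc a.
Proof. by case: a => x y /=; rewrite sqrrN. Qed.

Lemma lap_sqr_dist (r2 : R) z : lap (fun w => r2 - normc w ^+ 2) z (- (2 * z^*)) (-1).
Proof.
exists 0 => e e0; exists 1 => // h _.
rewrite normcD_sqr mul0r addr0.
have -> : complex.Re (- (2 * z^*) * h) = - (2 * complex.Re (z^* * h)).
  by case: z h => ? ? [? ?] /=; ring.
rewrite [X in `|X|](_ : _ = 0) ?normr0; last by ring.
by rewrite mulr_ge0 ?sqr_ge0// ltW.
Qed.

Lemma lap_normc_sqr F z r : 0 < r -> disc_hol F z r ->
  lap (fun w => normc (F w) ^+ 2) z (2 * (F z)^* * cd F z) (normc (cd F z) ^+ 2).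
Proof.
move=> r0 hF; have [c hc] := cderiv_cd r0 hF.
pose a0 := F z; pose a1 := cd F z.
exists (2 * a0^* * (c / 2)) => e e0.
have n0 := normc_ge0 a0; have n1 := normc_ge0 a1; have nc := normc_ge0 c.
have e1 : 0 < e / (4 * (normc a0 + 1)) by rewrite divr_gt0//; lra.
have [s1 s10 h1] := taylor2 r0 hF hc e1.
have [s2 s20 h2] := taylor2 r0 hF hc ltr01.
pose K := normc c + 1; have K0 : 0 < K by rewrite /K; lra.
pose K' := K ^+ 2 + 2 * normc a1 * K + 1; have K'0 : 0 < K' by rewrite /K'; nra.
exists (Num.min (Num.min s1 s2) (Num.min 1 (e / 2 / K'))) => [|h].
  by rewrite !lt_min s10 s20 ltr01 !divr_gt0.
rewrite !lt_min => /andP[/andP[/h1 {}h1 /h2 {}h2] /andP[hl hK]].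
rewrite -/a0 -/a1 in h1 h2 *.
set n := normc h in h1 h2 hl hK *; have nn0 : 0 <= n := normc_ge0 h.
pose err := F (z + h) - a0 - a1 * h - c / 2 * h ^+ 2.
pose y := c / 2 * h ^+ 2 + err.
have yK : normc y <= K * n ^+ 2.
  apply: (le_trans (le_normcD _ _)).
  have -> : normc (c / 2 * h ^+ 2) = normc c / 2 * n ^+ 2.
    rewrite normcM normcX; congr (_ * _).
    by rewrite normc_div normc_nat.
  have : 0 <= normc c * n ^+ 2 by rewrite mulr_ge0 ?sqr_ge0.
  move: h2; rewrite -/err /K; lra.
have -> : F (z + h) = a0 + (a1 * h + y) by rewrite /y /err; ring.
rewrite [normc (a0 + _) ^+ 2]normcD_sqr [normc (a1 * h + y) ^+ 2]normcD_sqr.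
have -> : complex.Re (2 * a0^* * a1 * h + 2 * a0^* * (c / 2) * h ^+ 2) =
    2 * complex.Re (a0^* * (a1 * h + y)) - 2 * complex.Re (a0^* * err).
  have -> : 2 * a0^* * a1 * h + 2 * a0^* * (c / 2) * h ^+ 2 =
     2%:C * (a0^* * (a1 * h + y)) + (- 2)%:C * (a0^* * err).
    have two : 2%:C = 2 :> R[i] by exact: (rmorph_nat (real_complex R) 2).
    by rewrite rmorphN two /y; clearbody err; ring.
  by rewrite ReD !ReZ; ring.
rewrite normcM exprMn -/n.
rewrite [X in `|X|](_ : _ = normc y ^+ 2 + 2 * complex.Re ((a1 * h)^* * y)
   + 2 * complex.Re (a0^* * err)); last by ring.
have k1 : `|2 * complex.Re (a0^* * err)| <= e / 2 * n ^+ 2.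
  rewrite normrM [`|2|]ger0_norm//.
  have := le_Re_normc (a0^* * err); rewrite normcM normc_conj => k.
  have : normc a0 * normc err <= (normc a0 + 1) * (e / (4 * (normc a0 + 1)) * n ^+ 2).
    by apply: ler_pM => //; [exact: normc_ge0|lra].
  have -> : (normc a0 + 1) * (e / (4 * (normc a0 + 1)) * n ^+ 2) = e / 4 * n ^+ 2.
    by field; rewrite gt_eqF//; lra.
  lra.
have k2 : `|2 * complex.Re ((a1 * h)^* * y)| <= 2 * normc a1 * K * n * n ^+ 2.
  rewrite normrM [`|2|]ger0_norm// -!mulrA ler_wpM2l//.
  apply: (le_trans (le_Re_normc _)); rewrite normcM normc_conj normcM -/n -mulrA.
  rewrite ler_wpM2l// [K * _]mulrCA ler_wpM2l//.
have k3 : `|normc y ^+ 2| <= K ^+ 2 * n * n ^+ 2.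
  rewrite ger0_norm ?sqr_ge0//; apply: (@le_trans _ _ ((K * n ^+ 2) ^+ 2)).
    by rewrite lerXn2r ?nnegrE ?normc_ge0// mulr_ge0 ?sqr_ge0// ltW.
  rewrite exprMn -mulrA ler_wpM2l ?sqr_ge0// [(n ^+ 2) ^+ 2]expr2.
  by rewrite ler_wpM2r ?sqr_ge0//; nra.
have k4 : K' * n * n ^+ 2 <= e / 2 * n ^+ 2.
  rewrite ler_wpM2r ?sqr_ge0//; move: hK; rewrite ltr_pdivlMr//; lra.
have := ler_normD (normc y ^+ 2 + 2 * complex.Re ((a1 * h)^* * y)) (2 * complex.Re (a0^* * err)).
have := ler_normD (normc y ^+ 2) (2 * complex.Re ((a1 * h)^* * y)).
have : 0 <= n * n ^+ 2 by rewrite mulr_ge0 ?sqr_ge0.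
move: k4; rewrite /K'; lra.
Qed.

End Laplacian.

(** * Second-order expansions of exponential and logarithm *)

Section SecondOrder.
Context {R : realType}.
Implicit Types (phi dphi : R -> R) (x p : R).

Lemma is_derive_eps phi x (l : R) : is_derive x 1 phi l ->
  forall e, 0 < e -> exists2 s, 0 < s & forall t, `|t| < s ->
    `|phi (x + t) - phi x - l * t| <= e * `|t|.
Proof.
move=> [dphi lE] e e0.
have cv : h^-1 *: (phi (h *: (1 : R) + x) - phi x) @[h --> 0^'] --> l.
  by rewrite -lE; exact: dphi.
move/cvgrPdist_le: cv => /(_ e e0); rewrite near_withinE => /nbhs_ballP[s /= s0 hs].
exists s => // t ts; have [->|t0] := eqVneq t 0.
  by rewrite addr0 subrr mulr0 subr0 normr0 mulr0.
have := hs t; rewrite /ball /= sub0r normrN => /(_ ts t0).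
rewrite -(ler_pM2r (x := `|t|)) ?normr_gt0// -normrM => H.
rewrite distrC; have <- : (l - t^-1 *: (phi (t *: (1 : R) + x) - phi x)) * t =
  l * t - (phi (x + t) - phi x); last exact: H.
by rewrite /GRing.scale /= mulr1 [t + x]addrC; field.
Qed.

(** Taylor's formula with Peano remainder: [g] is [phi] minus its quadratic part, up to a constant,
    and its derivative is small against [t], so the local Lipschitz principle bounds its increment
    by [e * t ^ 2]. *)
Lemma expand2_of_derive phi dphi x (p2 r : R) : 0 < r ->
  (forall y, `|y - x| < r -> is_derive y 1 phi (dphi y)) ->
  is_derive x 1 dphi (2 * p2) -> expand2 phi x (dphi x) p2.
Proof.
move=> r0 h1 h2 e e0; have [s s0 hs] := is_derive_eps h2 e0.
exists (Num.min r s) => [|t]; first by rewrite lt_min r0.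
rewrite lt_min => /andP[tr ts].
pose g (y : R) := phi (x + y) - dphi x * y - p2 * y ^+ 2.
have -> : phi (x + t) - phi x - (dphi x * t + p2 * t ^+ 2) = - (g (0 * t) - g (1 * t)).
  by rewrite /g mul0r mul1r addr0; ring.
rewrite normrN.
apply: (@lipschitz_of_local _ (fun a b => `|g (a * t) - g (b * t)|)) => [a b c|a b|].
- have -> : g (a * t) - g (c * t) = (g (a * t) - g (b * t)) + (g (b * t) - g (c * t)) by ring.
  exact: ler_normD.
- exact: distrC.
move=> a /andP[a0 a1] d d0.
have at_ : `|a * t| <= `|t| by rewrite normrM ger0_norm// ler_piMl.
have n0 := normr_ge0 t.
have ra : `|x + a * t - x| < r by rewrite addrAC subrr add0r; lra.
have dt : 0 < d / (2 * (`|t| + 1)) by rewrite divr_gt0//; lra.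
have [q q0 hq] := is_derive_eps (h1 _ ra) dt.
exists (Num.min (q / (`|t| + 1)) (d / (2 * (`|p2| + 1) * (t ^+ 2 + 1)))).
  by rewrite lt_min !divr_gt0// ?mulr_gt0//; have := normr_ge0 p2; nra.
move=> b hb; set k := b - a; rewrite lt_min => /andP[].
have t1 : 0 < `|t| + 1 by lra.
rewrite ltr_pdivlMr// => k1.
have P0 : 0 < 2 * (`|p2| + 1) * (t ^+ 2 + 1).
  by rewrite !mulr_gt0//; have := normr_ge0 p2; nra.
rewrite ltr_pdivlMr// => k2.
have kn := normr_ge0 k.
have kt : `|k * t| < q by rewrite normrM; clear -k1 kn n0; nra.
have H1 := hq _ kt.
have H2 := hs (a * t) (le_lt_trans at_ ts).
have -> : g (b * t) - g (a * t) =
  (phi (x + a * t + k * t) - phi (x + a * t) - dphi (x + a * t) * (k * t)) +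
  (dphi (x + a * t) - dphi x - 2 * p2 * (a * t)) * (k * t) - p2 * (k * t) ^+ 2.
  have -> : x + a * t + k * t = x + b * t by rewrite /k; ring.
  by rewrite /g /k; ring.
apply: (le_trans (ler_normD _ _)); rewrite normrN.
apply: (le_trans (lerD (ler_normD _ _) (lexx _))).
have m1 : d / (2 * (`|t| + 1)) * `|k * t| <= d / 2 * `|k|.
  rewrite normrM.
  have -> : d / (2 * (`|t| + 1)) * (`|k| * `|t|) = d / 2 * `|k| * (`|t| / (`|t| + 1)).
    by field; rewrite gt_eqF.
  by rewrite ler_piMr ?mulr_ge0//; [lra|rewrite ler_pdivrMr//; lra].
have m2 : `|(dphi (x + a * t) - dphi x - 2 * p2 * (a * t)) * (k * t)| <= e * t ^+ 2 * `|k|.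
  rewrite normrM [`|k * t|]normrM.
  have -> : e * t ^+ 2 * `|k| = (e * `|t|) * (`|k| * `|t|).
    by rewrite -[t ^+ 2]real_normK ?num_real//; ring.
  rewrite ler_wpM2r ?mulr_ge0//; apply: (le_trans H2).
  by rewrite ler_wpM2l// ltW.
have m3 : `|p2 * (k * t) ^+ 2| <= d / 2 * `|k|.
  rewrite normrM (ger0_norm (sqr_ge0 _)) exprMn -[k ^+ 2]real_normK ?num_real//.
  have := normr_ge0 p2; have := sqr_ge0 t => u1 u2.
  have : `|p2| * t ^+ 2 * `|k| <= d / 2.
    have : `|p2| * t ^+ 2 <= (`|p2| + 1) * (t ^+ 2 + 1) by clear -u1 u2; nra.
    by move=> u3; have := ler_wpM2r kn u3; clear -k2; lra.
  by move=> u3; have := ler_wpM2r kn u3; clear; lra.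
by clear -H1 m1 m2 m3; lra.
Qed.

Lemma expand2_expR x : expand2 (@expR R) x (expR x) (expR x / 2).
Proof.
apply: (@expand2_of_derive _ (@expR R) _ _ 1) => //.
by rewrite mulrC divfK//; exact: is_derive_expR.
Qed.

Lemma expand2_ln x : 0 < x -> expand2 (@ln R) x (x^-1) (- (2 * x ^+ 2)^-1).
Proof.
move=> x0; apply: (@expand2_of_derive _ (fun y => y^-1) _ _ x) => //.
  move=> y; rewrite ltr_norml => /andP[h1 h2]; apply: is_derive1_ln; lra.
have -> : 2 * - (2 * x ^+ 2)^-1 = - x ^- 2 *: (1 : R).
  by rewrite /GRing.scale /= mulr1; field; rewrite gt_eqF.
exact: (@is_deriveV _ id x 1 1 (lt0r_neq0 x0) (is_derive_id x 1)).
Qed.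

End SecondOrder.

(** * Laplacians of the terms in the logarithm of the density *)

Section LogModulus.
Context {R : realType}.
Implicit Types (F : R[i] -> R[i]) (z : R[i]) (r : R).

Lemma lap_ln_normc_sqr F z r : 0 < r -> disc_hol F z r -> F z != 0 ->
  lap (fun w => ln (normc (F w) ^+ 2)) z
    (((normc (F z) ^+ 2)^-1)%:C * (2 * (F z)^* * cd F z)) 0.
Proof.
move=> r0 hF Fz; have Fp : 0 < normc (F z) ^+ 2 by rewrite exprn_gt0// normc_gt0.
have := lap_comp (lap_normc_sqr r0 hF) (expand2_ln Fp).
set c := (X in lap _ _ _ X); suff -> : c = 0 by [].
by rewrite /c !normcM normc_conj normc_nat; field; rewrite gt_eqF// normc_gt0.
Qed.

(** For [u = log |F|^2] this is [log (1 + |F|^(2k))]. Although [u] is harmonic, its Laplacian is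
    positive wherever the gradient is nonzero; this is the source of the negative curvature. *)
Lemma lap_ln1exp (u : R[i] -> R) z a (k : R) : lap u z a 0 ->
  exists a', lap (fun w => ln (1 + expR (k * u w))) z a'
    (k ^+ 2 * normc a ^+ 2 / 4 * (expR (k * u z) / (1 + expR (k * u z)) ^+ 2)).
Proof.
move=> hu; have h1 := lapZ k hu.
have h2 := lap_shift 1 (lap_comp h1 (expand2_expR _)).
have E := expR_gt0 (k * u z); set E0 := expR _ in E h2 *.
have v0 : 0 < 1 + E0 by lra.
have := lap_comp h2 (expand2_ln v0); set c := (X in lap _ _ _ X) => h3.
suff <- : c = k ^+ 2 * normc a ^+ 2 / 4 * (E0 / (1 + E0) ^+ 2).
  by eexists; exact: h3.
rewrite /c mulr0 mulr0 add0r !normcM !normc_real (gtr0_norm E) !exprMn.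
by rewrite -[`|k| ^+ 2]normrX (ger0_norm (sqr_ge0 k)); field; rewrite !gt_eqF//; lra.
Qed.

End LogModulus.

(** * Fifteenth roots and the curvature inequality *)

Section Root15.
Context {R : realType}.
Implicit Types (p q P Q : R).

(** With weights p^(-3/5) q^(-3/5) (1 + p^s) (1 + q^s) the density decays at infinity like p^(2s -
    6/5), and the Laplacian of its logarithm supplies p^(-1 - s). The two agree for s = 1/15, and
    every exponent is then a multiple of 1/15. As an exponential the root is positive for all real
    [p], and it matches the form of [lap_ln1exp]. *)
Definition root15 p : R := expR (15^-1 * ln p).

Lemma root15_gt0 p : 0 < root15 p.
Proof. exact: expR_gt0. Qed.

Lemma root15X p : 0 < p -> root15 p ^+ 15 = p.
Proof.
move=> p0; rewrite /root15 -expRM_natl mulrA divff ?mul1r; first by rewrite lnK.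
by rewrite pnatr_eq0.
Qed.

Lemma ln_root15 p : ln (root15 p) = 15^-1 * ln p.
Proof. by rewrite /root15 expRK. Qed.

Lemma root15_ge1 p : 1 <= p -> 1 <= root15 p.
Proof.
by move=> p1; rewrite -expR0 ler_expR mulr_ge0// ?invr_ge0 ?ler0n// ln_ge0.
Qed.

Lemma root15_le1 p : p <= 1 -> root15 p <= 1.
Proof.
move=> p1; rewrite -expR0 ler_expR mulr_ge0_le0// ?invr_ge0 ?ler0n//.
exact: ln_le0.
Qed.

Lemma root15_le p : 0 < p -> root15 p <= 1 + p.
Proof.
move=> p0; have [p1|p1] := leP p 1.
  by apply: (le_trans (root15_le1 p1)); rewrite lerDl ltW.
rewrite -{2}(root15X p0); apply: (@le_trans _ _ (root15 p ^+ 15)).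
  by apply: ler_eXnr => //; exact/root15_ge1/ltW.
by rewrite lerDr.
Qed.

Lemma root15_ge p (c : R) : 0 < p -> c <= 1 -> c <= p -> c <= root15 p.
Proof.
move=> p0 c1 cp; have [p1|p1] := leP p 1; last first.
  by apply: (le_trans c1); exact/root15_ge1/ltW.
apply: (le_trans cp); rewrite -{1}(root15X p0).
by apply: ler_iXnr => //; [exact/ltW/root15_gt0|exact: root15_le1].
Qed.

Lemma root15_homo p q : 0 < p -> p <= q -> root15 p <= root15 q.
Proof.
move=> p0 pq; rewrite ler_expR ler_wpM2l ?invr_ge0 ?ler0n//.
by rewrite ler_ln ?posrE// (lt_le_trans p0).
Qed.

(** The left side is the weight of the metric, the right side one term of the Laplacian of its
    logarithm. As [Q] is at least 1/4, both [1 + P] and [1 + Q] are at most [5 * Q]; four such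
    factors give [625 = 5 ^ 4], and the remaining fifth powers compare by [P <= Q]. *)
Lemma metric_le P Q : 0 < P -> P <= Q -> 4^-1 <= Q ->
  (1 + P) * (1 + Q) / (P ^+ 9 * Q ^+ 9) <= 625 * (P / (P ^+ 15 * (1 + P) ^+ 2)).
Proof.
move=> P0 PQ Q4; have Q0 : 0 < Q by apply: lt_le_trans Q4.
have P1 : 0 < 1 + P by lra.
have Q1 : 0 < 1 + Q by lra.
rewrite ler_pdivrMr ?mulr_gt0 ?exprn_gt0//.
have -> : 625 * (P / (P ^+ 15 * (1 + P) ^+ 2)) * (P ^+ 9 * Q ^+ 9) =
    (625 * Q ^+ 9) / (P ^+ 5 * (1 + P) ^+ 2) by field; rewrite !gt_eqF.
rewrite ler_pdivlMr ?mulr_gt0 ?exprn_gt0//.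
have k1 : P ^+ 5 <= Q ^+ 5 by rewrite lerXn2r ?nnegrE ?(ltW P0) ?(ltW Q0).
have k2 : (1 + P) ^+ 3 <= (5 * Q) ^+ 3 by rewrite lerXn2r ?nnegrE//; lra.
have k3 : 1 + Q <= 5 * Q by lra.
have -> : (1 + P) * (1 + Q) * (P ^+ 5 * (1 + P) ^+ 2) = P ^+ 5 * (1 + P) ^+ 3 * (1 + Q).
  by ring.
have -> : 625 * Q ^+ 9 = Q ^+ 5 * (5 * Q) ^+ 3 * (5 * Q) by ring.
have e5 : 0 <= P ^+ 5 by rewrite exprn_ge0// ltW.
have e3 : 0 <= (1 + P) ^+ 3 by rewrite exprn_ge0// ltW.
exact: (ler_pM (mulr_ge0 e5 e3) (ltW Q1) (ler_pM e5 e3 k1 k2) k3).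
Qed.

End Root15.

(** * Attainment of maxima, and the metric at multiple zeros *)

Section AhlforsLemma.
Context {R : realType}.
Implicit Types (F g q : R[i] -> R[i]) (z w : R[i]) (r e s : R).

(** Without a maximum the superlevel sets generate a proper filter, and compactness would yield a
    point whose value lies below itself. Upper semicontinuity is the right hypothesis because at the
    points over 0 and 1 the density is only estimated from above. *)
Lemma usc_max (phi : R[i] -> R) r : 0 <= r ->
  (forall w, normc w <= r -> forall e, 0 < e -> exists2 s : R, 0 < s &
     forall h, normc h < s -> phi (w + h) <= phi w + e) ->
  exists2 w, normc w <= r & forall w', normc w' <= r -> phi w' <= phi w.
Proof.
move=> r0 usc; apply: contrapT => nmax.
have nm w : normc w <= r -> exists2 w', normc w' <= r & phi w < phi w'.
  move=> wr; apply: contrapT => h; apply: nmax; exists w => // w' w'r.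
  by rewrite leNgt; apply/negP => lt; apply: h; exists w'.
pose K := [set w : R[i] | normc w <= r].
pose G := filter_from K (fun w => [set w' | normc w' <= r /\ phi w <= phi w']).
have FG : ProperFilter G.
  apply: filter_from_proper; last by move=> w Kw; exists w.
  apply: filter_from_filter; first by exists 0; rewrite /K /mkset normc0.
  move=> a b Ka Kb; have [ab|ba] := leP (phi a) (phi b).
    by exists b => // x [xr bx]; split; split=> //; exact: le_trans bx.
  by exists a => // x [xr ax]; split; split=> //; exact: le_trans (ltW ba) ax.
have := @compact_disc R 0 r => /compact_near_coveringP.
move=> /(_ R[i] G (fun i w => phi w < phi i) _)[].
  move=> w /=; rewrite subr0 => wr; have [w' w'r lt] := nm w wr.
  have e0 : 0 < (phi w' - phi w) / 2 by lra.
  have [s s0 hs] := usc w wr _ e0.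
  exists ([set x | normc (x - w) < s], [set w'' | normc w'' <= r /\ phi w' <= phi w'']) => /=.
    by split; [apply/nbhs_nrmP; exists s|exists w'].
  move=> [x i] /= [xs [_ hi]]; apply: lt_le_trans hi.
  by have := hs (x - w) xs; rewrite [w + _]addrC subrK; lra.
move=> w Kw h; have [wr _] : normc w <= r /\ phi w <= phi w by [].
by have := h w (conj wr (lexx _)) w; rewrite /= subr0 ltxx => /(_ wr).
Qed.

Lemma cderivX n z : cderiv (fun w => w ^+ n.+1) z (n.+1%:R * z ^+ n).
Proof.
elim: n => [|n IH].
  rewrite expr0 mulr1; apply: (cderiv_ext ltr01 _ (cderiv_id z)) => h _ /=.
  by rewrite expr1.
have := cderivM (cderiv_id z) IH.
have -> : 1 * z ^+ n.+1 + z * (n.+1%:R * z ^+ n) = n.+2%:R * z ^+ n.+1.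
  by rewrite exprS -(natr1 n.+1); ring.
by apply: (cderiv_ext ltr01) => h _; rewrite [in RHS]exprS.
Qed.

(* Zeros of order at least three do not obstruct the comparison: there the
   pulled back metric [|F'|^2 / |F|^(6/5)] tends to zero. *)
Lemma metric_at_zero F z r m q : 0 < r -> disc_hol F z r -> disc_hol q 0 r ->
  q 0 != 0 -> (forall h, normc h < r -> F (z + h) = h ^+ m * q h) ->
  F z = 0 -> cd F z = 0 -> cd (cd F) z = 0 ->
  forall e, 0 < e -> exists2 s : R, 0 < s & forall h, h != 0 -> normc h < s ->
    F (z + h) != 0 /\
    normc (cd F (z + h)) ^+ 2 / root15 (normc (F (z + h)) ^+ 2) ^+ 9 <= e.
Proof.
move=> r0 hF hq q0 Fq Fz F1z F2z e e0.
have n0 : 0 < normc (q 0) by rewrite normc_gt0.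
have r00 : normc (0 - 0 : R[i]) < r by rewrite subrr normc0.
have [|s1 s10 h1] := cderiv_cont (cdP (hq 0 r00)) (e := normc (q 0) / 2); first by lra.
have [s2 s20 h2] := ccont_bound (cderiv_cont (cdP (disc_hol_cd hq r00))).
have qlow h : normc h < s1 -> normc (q 0) / 2 <= normc (q h) <= 2 * normc (q 0).
  move=> /h1; rewrite add0r => H.
  have a := le_normc_sub (q 0) (q 0 - q h); have b := le_normc_sub (q h) (q h - q 0).
  rewrite !subKr normcB in a; rewrite subKr in b.
  have k := le_normc_sub (q h) (q 0); apply/andP; split; lra.
(* With [F], [F'] and [F''] all zero at [z], [F (z + h)] is small against [h ^ 2], which no order
   [m] up to 2 allows. *)
have m3 : (2 < m)%N.
  rewrite ltnNge; apply/negP => m2.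
  have [||s3 s30 h3] := taylor2 r0 hF (c := 0) _ (e := normc (q 0) / 4).
  - by rewrite -F2z; apply/cdP/(disc_hol_cd hF); rewrite subrr normc0.
  - by lra.
  pose t := Num.min (Num.min s1 s3) (Num.min r 1) / 2.
  have [t0 t1 t3 tr tl] : [/\ 0 < t, t < s1, t < s3, t < r & t < 1].
    have m0 : 0 < Num.min (Num.min s1 s3) (Num.min r 1).
      by rewrite !lt_min s10 s30 r0 ltr01.
    have [] : [/\ Num.min (Num.min s1 s3) (Num.min r 1) <= s1,
      Num.min (Num.min s1 s3) (Num.min r 1) <= s3,
      Num.min (Num.min s1 s3) (Num.min r 1) <= r &
      Num.min (Num.min s1 s3) (Num.min r 1) <= 1].
      by split; rewrite !ge_min lexx ?orbT.
    by rewrite /t; split; lra.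
  clearbody t; have nt : normc t%:C = t by rewrite normc_real gtr0_norm.
  have := h3 t%:C; rewrite nt F1z Fz !mul0r !subr0 Fq ?nt// normcM normcX nt => /(_ t3) H.
  have /andP[k _] : normc (q 0) / 2 <= normc (q t%:C) <= 2 * normc (q 0).
    by apply: qlow; rewrite nt.
  have tm : t ^+ 2 <= t ^+ m by rewrite ler_wiXn2l// ltW.
  have t2 : 0 < t ^+ 2 by rewrite exprn_gt0.
  have : t ^+ 2 * (normc (q 0) / 2) <= t ^+ m * normc (q t%:C).
    by rewrite ler_pM//; lra.
  nra.
case: m m3 Fq => [//|[//|[//|k]]] _ Fq.
pose K := k.+3%:R * (2 * normc (q 0)) + (normc (cd q 0) + 1).
have K0 : 0 < K.
  by rewrite ltr_wpDl ?mulr_ge0 ?ler0n ?ltW// ltr_wpDl ?normc_ge0.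
pose c := normc (q 0) / 2; have c0 : 0 < c by rewrite /c; lra.
pose K' := K ^+ 10 / c ^+ 6; have K'0 : 0 < K' by rewrite divr_gt0 ?exprn_gt0.
exists (Num.min (Num.min s1 s2) (Num.min r (Num.min 1 (e ^+ 5 / K')))).
  by rewrite !lt_min s10 s20 r0 ltr01 divr_gt0 ?exprn_gt0.
move=> h h0; rewrite !lt_min => /andP[/andP[hs1 hs2] /and3P[hr hl]].
rewrite ltr_pdivlMr// => hK.
have /andP[q1 q2] := qlow h hs1.
have np : 0 < normc h by rewrite normc_gt0.
have qh : q h != 0 by rewrite -normc_gt0; lra.
have Fh : F (z + h) != 0 by rewrite Fq// mulf_neq0// expf_neq0.
split=> //.
have hr0 : normc (h - 0) < r by rewrite subr0.
have DF : cd F (z + h) = k.+3%:R * h ^+ k.+2 * q h + h ^+ k.+3 * cd q h.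
  have H : cderiv (fun w => w ^+ k.+3 * q w) (- z + 1 * (z + h))
      (k.+3%:R * h ^+ k.+2 * q h + h ^+ k.+3 * cd q h).
    by rewrite mul1r addKr; exact: cderivM (cderivX k.+2 h) (cdP (hq h hr0)).
  apply: cd_eq; have := cderiv_affine_comp H; rewrite mul1r.
  apply: (@cderiv_ext _ _ _ _ _ (r - normc h)); first by lra.
  move=> x hx; have -> : - z + 1 * (z + h + x) = h + x by ring.
  by rewrite -addrA Fq// (le_lt_trans (le_normcD _ _))//; lra.
have DFle : normc (cd F (z + h)) <= K * normc h ^+ k.+2.
  rewrite DF; apply: (le_trans (le_normcD _ _)); rewrite /K [X in _ <= X]mulrDl; apply: lerD.
    rewrite 2!normcM normcX normc_nat.
    rewrite mulrAC ler_wpM2r ?exprn_ge0 ?normc_ge0// ler_wpM2l ?ler0n//.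
  rewrite normcM normcX exprS mulrC.
  have := h2 h hs2; rewrite add0r => H; apply: ler_pM; rewrite ?normc_ge0//.
    by rewrite mulr_ge0 ?exprn_ge0 ?normc_ge0.
  by rewrite ler_piMl ?exprn_ge0 ?normc_ge0// ltW.
have Fge : c * normc h ^+ k.+3 <= normc (F (z + h)).
  by rewrite Fq// normcM normcX mulrC ler_wpM2l ?exprn_ge0 ?normc_ge0.
set x := normc h in np hK hl DFle Fge *.
set d := normc (cd F (z + h)) in DFle *; have d0 : 0 <= d := normc_ge0 _.
set f := normc (F (z + h)) in Fge *.
have cx : 0 < c * x ^+ k.+3 by rewrite mulr_gt0 ?exprn_gt0.
have f0 : 0 < f by apply: lt_le_trans Fge.
have f20 : 0 < f ^+ 2 by rewrite exprn_gt0.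
(* The fifth power clears the root: [root15 (f ^ 2) ^ 45] is [f ^ 6]. *)
rewrite -(@ler_pXn2r _ 5) ?nnegrE ?(ltW e0)//; last first.
  by rewrite divr_ge0 ?sqr_ge0// exprn_ge0// ltW ?root15_gt0.
rewrite exprMn exprVn -!exprM.
have -> : root15 (f ^+ 2) ^+ (9 * 5) = f ^+ 6.
  by rewrite (exprM _ 15 3) root15X// -exprM.
rewrite ler_pdivrMr ?exprn_gt0//.
have a1 : d ^+ (2 * 5) <= (K * x ^+ k.+2) ^+ 10.
  by rewrite lerXn2r ?nnegrE// mulr_ge0 ?exprn_ge0 ?(ltW K0) ?(ltW np).
have a2 : (c * x ^+ k.+3) ^+ 6 <= f ^+ 6 by rewrite lerXn2r ?nnegrE ?(ltW cx) ?(ltW f0).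
apply: (le_trans a1); apply: (le_trans _ (ler_wpM2l _ a2)); last first.
  by rewrite exprn_ge0// ltW.
rewrite [(K * _) ^+ 10]exprMn [(c * _) ^+ 6]exprMn -!exprM.
(* For order [k + 3] the numerator has degree [10 (k + 2)] and the denominator [6 (k + 3)]; the
   surplus [4 k + 2] is positive, so the quotient tends to 0. *)
have E : x ^+ (k.+2 * 10) = x ^+ (k * 4 + 2) * x ^+ (k.+3 * 6).
  by rewrite -exprD; congr (_ ^+ _); clear; lia.
rewrite E; move: (x ^+ (k.+3 * 6)) (exprn_ge0 (k.+3 * 6) (ltW np)) => y y0.
rewrite [X in X <= _]mulrA [X in _ <= X]mulrA ler_wpM2r//.
have -> : K ^+ 10 = K' * c ^+ 6 by rewrite /K' divfK// gt_eqF// exprn_gt0.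
rewrite mulrAC ler_wpM2r ?exprn_ge0 ?(ltW c0)//.
have x1 : x ^+ (k * 4 + 2) <= x.
  by rewrite -[X in _ <= X]expr1 ler_wiXn2l ?(ltW np) ?(ltW hl)// addn2.
apply: (le_trans (ler_wpM2l (ltW K'0) x1)); lra.
Qed.

End AhlforsLemma.

(** * The maximum of the density on a disc *)

Section EntireFunctions.
Context {R : realType}.
Implicit Types (F g : R[i] -> R[i]) (z w : R[i]) (r e s D p q t : R).

Definition entire F : Prop := forall z, exists l, cderiv F z l.

Lemma entire_disc F z r : entire F -> disc_hol F z r.
Proof. by move=> hF w _. Qed.

Lemma entire_cd F : entire F -> entire (cd F).
Proof. by move=> hF z; apply: (cderiv_cd ltr01); exact: entire_disc. Qed.

Lemma entire_subr F (c : R[i]) : entire F -> entire (fun w => F w - c).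
Proof.
by move=> hF z; eexists; apply: cderivB (cdP (hF z)) (cderiv_cst c z).
Qed.

Lemma cd_subr F (c : R[i]) : entire F -> cd (fun w => F w - c) = cd F.
Proof.
move=> hF; apply/funext => z; apply: cd_eq; rewrite -[cd F z]subr0.
exact: cderivB (cdP (hF z)) (cderiv_cst c z).
Qed.

(* With [D], [p], [q], [t] equal to [|g'|^2], [|g|^2], [|g - 1|^2] and
   [r^2 - |w|^2], this is the square of the density of the pulled back metric
   relative to the Poincare metric of the disc of radius [r]. The exponent 3/5
   at 0 and 1 is more than 1/2, which makes infinity a cone point too, and less
   than 2/3, so that the pullback vanishes where [g] takes the value 0 or 1 to
   order 3; the factors [1 + root15 _] make the curvature negative. *)
Definition sqdensity D p q t : R :=
  D / (root15 p ^+ 9 * root15 q ^+ 9) * ((1 + root15 p) * (1 + root15 q)) * t ^+ 2.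

Lemma sqdensityC D p q t : sqdensity D p q t = sqdensity D q p t.
Proof. by rewrite /sqdensity mulrC [root15 p ^+ 9 * _]mulrC [(1 + root15 p) * _]mulrC mulrC. Qed.

Lemma sqdensity_gt0 D p q t : 0 < D -> t != 0 -> 0 < sqdensity D p q t.
Proof.
move=> D0 t0; have P0 := root15_gt0 p; have Q0 := root15_gt0 q.
have t2 : 0 < t ^+ 2 by rewrite lt_def sqrf_eq0 t0 sqr_ge0.
have P1 : 0 < 1 + root15 p by lra.
have Q1 : 0 < 1 + root15 q by lra.
rewrite /sqdensity mulr_gt0// mulr_gt0//; last by rewrite mulr_gt0.
by rewrite divr_gt0// mulr_gt0// exprn_gt0.
Qed.

Lemma sqdensity0 p q t : sqdensity 0 p q t = 0.
Proof. by rewrite /sqdensity !mul0r. Qed.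

Lemma ln_sqdensity D p q t : 0 < D -> 0 < p -> 0 < q -> 0 < t -> ln (sqdensity D p q t) =
  ln D + (- (9 / 15) * ln p + - (9 / 15) * ln q)
  + (ln (1 + root15 p) + ln (1 + root15 q)) + 2 * ln t.
Proof.
move=> D0 p0 q0 t0; have P0 := root15_gt0 p; have Q0 := root15_gt0 q.
have P1 : 0 < 1 + root15 p by lra.
have Q1 : 0 < 1 + root15 q by lra.
have lnX n (x : R) : 0 < x -> ln (x ^+ n) = n%:R * ln x.
  by move=> x0; rewrite lnXn// mulr_natl.
rewrite /sqdensity lnM ?posrE ?mulr_gt0 ?invr_gt0 ?mulr_gt0 ?exprn_gt0//.
rewrite lnM ?posrE ?mulr_gt0 ?invr_gt0 ?mulr_gt0 ?exprn_gt0//.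
rewrite lnM ?posrE ?invr_gt0 ?mulr_gt0 ?exprn_gt0//.
rewrite lnV ?posrE ?mulr_gt0 ?exprn_gt0//.
rewrite lnM ?posrE ?exprn_gt0// lnM ?posrE//.
by rewrite !lnX// !ln_root15; field.
Qed.

(** At a maximum the logarithm of the density has nonpositive Laplacian. In quarter Laplacians,
    [log |g'|^2], [log |g|^2] and [log |g - 1|^2] contribute nothing, the factor [t ^ 2] contributes
    [- 2 r^2 / t^2], and the terms [log (1 + root15 _)] are positive with a factor
    [1 / 225 = (1 / 15)^2]. The curvature inequality with its 625 turns this into a bound on the
    density. *)
Lemma sqdensity_max_le g z r s : entire g -> 0 < s -> normc z < r ->
  g z != 0 -> g z - 1 != 0 -> cd g z != 0 ->
  let S w := sqdensity (normc (cd g w) ^+ 2) (normc (g w) ^+ 2) (normc (g w - 1) ^+ 2)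
    (r ^+ 2 - normc w ^+ 2) in
  (forall h, normc h < s -> S (z + h) <= S z) -> S z <= 2 * 225 * 625 * r ^+ 2.
Proof.
move=> hg s0 zr g0 g1 dg S hmax.
have hg1 := entire_subr 1 hg.
pose g' w := g w - 1.
have dg' : cd g' = cd g by exact: cd_subr.
have L1 := lap_ln_normc_sqr ltr01 (entire_disc (entire_cd hg)) dg.
have L2 := lap_ln_normc_sqr ltr01 (entire_disc hg) g0.
have L3 := lap_ln_normc_sqr ltr01 (entire_disc hg1) g1.
have [b2 K2] := lap_ln1exp 15^-1 L2; have [b3 K3] := lap_ln1exp 15^-1 L3.
have n0 := normc_ge0 z; have r0 : 0 < r by lra.
have T0 : 0 < r ^+ 2 - normc z ^+ 2 by rewrite subr_gt0 ltrXn2r// ltW.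
have L4 := lapZ 2 (lap_comp (lap_sqr_dist (r ^+ 2) z) (expand2_ln T0)).
(* The summands follow the order in [ln_sqdensity], so that the sum is literally the logarithm of
   the density. *)
have L := lapD (lapD (lapD L1 (lapD (lapZ (- (9 / 15)) L2) (lapZ (- (9 / 15)) L3)))
  (lapD K2 K3)) L4.

have [d1 d10 c1] := cderiv_cont (cdP (entire_cd hg z)) (e := normc (cd g z) / 2)
  ltac:(by rewrite divr_gt0 ?normc_gt0).
have [d2 d20 c2] := cderiv_cont (cdP (hg z)) (e := normc (g z) / 2)
  ltac:(by rewrite divr_gt0 ?normc_gt0).
have [d3 d30 c3] := cderiv_cont (cdP (hg1 z)) (e := normc (g z - 1) / 2)
  ltac:(by rewrite divr_gt0 ?normc_gt0).
have nz (a b : R[i]) : a != 0 -> normc (b - a) <= normc a / 2 -> b != 0.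
  move=> a0 h; rewrite -normc_gt0; have := le_normc_sub a (a - b).
  by rewrite subKr normcB; move: a0; rewrite -normc_gt0; lra.
have ns (a : R[i]) : a != 0 -> 0 < normc a ^+ 2 by move=> a0; rewrite exprn_gt0 ?normc_gt0.
(* Within [d] of [z] none of [g'], [g], [g - 1] vanishes and the point stays in the disc, so the
   logarithm of the density splits at all these points. *)
pose d := Num.min (Num.min s (r - normc z)) (Num.min d1 (Num.min d2 d3)).
have d0 : 0 < d by rewrite !lt_min s0 d10 d20 d30 subr_gt0 zr.
have := lap_max L d0; move: (normc_ge0 z) => {L K2 K3 L4 L1 L2 L3}.
set D := normc (cd g z) ^+ 2; set p := normc (g z) ^+ 2.
set q := normc (g z - 1) ^+ 2; set t := r ^+ 2 - normc z ^+ 2 in T0 *.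
rewrite -/(root15 p) -/(root15 q) => _ H.
have D0 : 0 < D := ns _ dg.
have p0 : 0 < p := ns _ g0.
have q0 : 0 < q := ns _ g1.
have P0 := root15_gt0 p; have Q0 := root15_gt0 q.
have A1 : normc ((normc (g z) ^- 2)%:C * (2 * (g z)^* * cd g z)) ^+ 2 = 4 * (D / p).
  rewrite !normcM normc_conj normc_nat normc_real (ger0_norm (ltW _)) ?invr_gt0//.
  by rewrite !exprMn -/D /p; field; rewrite gt_eqF// normc_gt0.
have A2 : normc ((normc (g z - 1) ^- 2)%:C *
    (2 * (g z - 1)^* * cd (fun w => g w - 1) z)) ^+ 2 = 4 * (D / q).
  rewrite dg' !normcM normc_conj normc_nat normc_real (ger0_norm (ltW _)) ?invr_gt0//.
  by rewrite !exprMn -/D /q; field; rewrite gt_eqF// normc_gt0.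
have A3 : normc (- (2 * z^*)) ^+ 2 = 4 * (r ^+ 2 - t).
  by rewrite normcN normcM normc_conj normc_nat exprMn /t; ring.
rewrite A1 A2 A3 in H.
have {}H : 0 + (- (9 / 15) * 0 + - (9 / 15) * 0) +
      (15^-1 ^+ 2 * (4 * (D / p)) / 4 * (root15 p / (1 + root15 p) ^+ 2) +
       15^-1 ^+ 2 * (4 * (D / q)) / 4 * (root15 q / (1 + root15 q) ^+ 2)) +
      2 * (t^-1 * -1 + - (2 * t ^+ 2)^-1 / 2 * (4 * (r ^+ 2 - t))) <= 0.
  apply: H => h; rewrite !lt_min => /andP[/andP[hs hr] /and3P[h1 h2 h3]].
  have := hmax h hs; rewrite /S -/D -/p -/q -/t => {}hmax.
  have D1 := ns _ (nz _ _ dg (c1 h h1)).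
  have p1 := ns _ (nz _ _ g0 (c2 h h2)).
  have q1 := ns _ (nz _ _ g1 (c3 h h3)).
  have t1 : 0 < r ^+ 2 - normc (z + h) ^+ 2.
    rewrite subr_gt0 ltrXn2r ?nnegrE ?normc_ge0 ?(ltW r0)// (le_lt_trans (le_normcD _ _))//; lra.
  rewrite -/(root15 _) -/(root15 (normc (g (z + h) - 1) ^+ 2)) -!ln_sqdensity//.
  by rewrite ler_ln ?posrE ?sqdensity_gt0 ?gt_eqF.
have P1 : 0 < 1 + root15 p := addr_gt0 ltr01 P0.
have Q1 : 0 < 1 + root15 q := addr_gt0 ltr01 Q0.
have t2 : 0 < t ^+ 2 by rewrite exprn_gt0.
have {}H : D * (root15 p / (p * (1 + root15 p) ^+ 2) +
     root15 q / (q * (1 + root15 q) ^+ 2)) * t ^+ 2 <= 2 * 225 * r ^+ 2.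
  have e : 0 + (- (9 / 15) * 0 + - (9 / 15) * 0) +
      (15^-1 ^+ 2 * (4 * (D / p)) / 4 * (root15 p / (1 + root15 p) ^+ 2) +
       15^-1 ^+ 2 * (4 * (D / q)) / 4 * (root15 q / (1 + root15 q) ^+ 2)) +
      2 * (t^-1 * -1 + - (2 * t ^+ 2)^-1 / 2 * (4 * (r ^+ 2 - t))) =
    (D * (root15 p / (p * (1 + root15 p) ^+ 2) +
     root15 q / (q * (1 + root15 q) ^+ 2)) * t ^+ 2 - 2 * 225 * r ^+ 2) / (225 * t ^+ 2).
    by field; rewrite !gt_eqF.
  by move: H; rewrite e pmulr_lle0 ?invr_gt0 ?mulr_gt0// subr_le0.
have big : (1 + root15 p) * (1 + root15 q) / (root15 p ^+ 9 * root15 q ^+ 9) <=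
    625 * (root15 p / (p * (1 + root15 p) ^+ 2) + root15 q / (q * (1 + root15 q) ^+ 2)).
  (* Since [g] and [g - 1] differ by 1, the larger of them has modulus at least 1/2; it plays the
     part of [Q] in [metric_le]. *)
  have fourth (a b : R[i]) : normc (a - b) = 1 -> normc a <= normc b -> 4^-1 <= normc b ^+ 2.
    move=> ab ab'; have := le_normcD a (- b); rewrite normcN ab => h.
    have : (2^-1) ^+ 2 <= normc b ^+ 2 by rewrite lerXn2r ?nnegrE ?normc_ge0//; lra.
    by rewrite expr2; lra.
  have F0 : 0 <= 625 * (root15 p / (p * (1 + root15 p) ^+ 2)).
    exact: mulr_ge0 (ler0n _ 625) (divr_ge0 (ltW P0) (mulr_ge0 (ltW p0) (sqr_ge0 _))).
  have F1 : 0 <= 625 * (root15 q / (q * (1 + root15 q) ^+ 2)).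
    exact: mulr_ge0 (ler0n _ 625) (divr_ge0 (ltW Q0) (mulr_ge0 (ltW q0) (sqr_ge0 _))).
  have quarter : (4^-1 : R) <= 1 by rewrite invf_le1 ?ler1n ?ltr0n.
  have [pq|qp] := leP (normc (g z)) (normc (g z - 1)).
    have pq2 : p <= q by rewrite lerXn2r ?nnegrE ?normc_ge0.
    have q4 : 4^-1 <= q.
      by apply: (fourth _ _ _ pq); rewrite subKr normc1.
    have := metric_le P0 (root15_homo p0 pq2) (root15_ge q0 quarter q4).
    by rewrite root15X// => H1; apply: (le_trans H1); rewrite mulrDr lerDl.
  have pq2 : q <= p by rewrite lerXn2r ?nnegrE ?normc_ge0 ?(ltW qp).
  have q4 : 4^-1 <= p.
    apply: (fourth _ _ _ (ltW qp)).
    by rewrite addrAC subrr add0r normcN normc1.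
  have := metric_le Q0 (root15_homo q0 pq2) (root15_ge p0 quarter q4).
  rewrite root15X// [(1 + root15 q) * _]mulrC [root15 q ^+ 9 * _]mulrC => H1.
  by apply: (le_trans H1); rewrite mulrDr lerDr.
have -> : S z = D * ((1 + root15 p) * (1 + root15 q) / (root15 p ^+ 9 * root15 q ^+ 9)) * t ^+ 2.
  by rewrite /S -/D -/p -/q -/t /sqdensity; ring.
have := ler_wpM2l (ltW D0) big => b1; have := ler_wpM2r (ltW t2) b1.
move: H => /(ler_wpM2l (ler0n R 625)) H b2'; apply: (le_trans b2').
by move: H; congr (_ <= _); ring.
Qed.

End EntireFunctions.

(** * Comparison on growing discs *)

Section Ahlfors.
Context {R : realType}.
Implicit Types (F g : R[i] -> R[i]) (z w : R[i]) (r e s : R).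

Lemma sqdensity_le_near (d p q t T : R) : 0 <= d -> 0 < p <= 1 -> 4^-1 <= q <= 4 -> t ^+ 2 <= T ->
  sqdensity d p q t <= d / root15 p ^+ 9 * (4 * 20 * 4 ^+ 9 * T).
Proof.
move=> d0 /andP[p0 p1] /andP[q4 q5] tT; have q0 : 0 < q by lra.
have P0 := root15_gt0 p; have Q0 := root15_gt0 q.
have P2 := root15_le p0; have Q2 := root15_le q0.
have Q4 : 4^-1 <= root15 q by apply: root15_ge => //; lra.
have P1 : 0 <= 1 + root15 p by lra.
have Q1 : 0 <= 1 + root15 q by lra.
have -> : sqdensity d p q t =
    d / root15 p ^+ 9 * ((1 + root15 p) * (1 + root15 q) / root15 q ^+ 9 * t ^+ 2).
  by rewrite /sqdensity; field; rewrite !gt_eqF.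
have Q9 : 0 <= (root15 q ^+ 9)^-1 by rewrite invr_ge0 exprn_ge0// ltW.
apply: ler_wpM2l; first by rewrite divr_ge0// exprn_ge0// ltW.
apply: ler_pM => //; [by rewrite !mulr_ge0|exact: sqr_ge0|].
apply: ler_pM => //; first exact: mulr_ge0.
  by apply: ler_pM => //; lra.
rewrite -exprVn lerXn2r ?nnegrE ?invr_ge0 ?(ltW Q0) ?ler0n//.
by rewrite -[X in _ <= X]invrK lef_pV2 ?posrE ?invr_gt0.
Qed.

(** [F1] and [F2] are [g] and [g - 1] in either order: where one vanishes the other has modulus
    1. *)
Lemma sqdensity_near_zero F1 F2 z r : entire F1 -> entire F2 ->
  F1 z = 0 -> cd F1 z = 0 -> cd (cd F1) z = 0 -> normc (F2 z) = 1 ->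
  cd F1 0 != 0 -> normc z <= r ->
  forall e, 0 < e -> exists2 s : R, 0 < s & forall h, normc h < s ->
    sqdensity (normc (cd F1 (z + h)) ^+ 2) (normc (F1 (z + h)) ^+ 2)
      (normc (F2 (z + h)) ^+ 2) (r ^+ 2 - normc (z + h) ^+ 2) <= e.
Proof.
move=> h1 h2 z0 z1 z2 F2z nz zr e e0.
have nz0 := normc_ge0 z; have r0 : 0 <= r by lra.
(* An eighth of this radius still reaches beyond 0, so flatness at [z] would contradict the nonzero
   derivative at 0. *)
pose rho := 8 * (normc z + 1); have rho0 : 0 < rho by rewrite /rho; lra.
have [flat|[m [q [hq q0 Fq]]]] := zero_dichotomy rho0 (entire_disc h1 (z := z) (r := rho)).
  exfalso; move/eqP: nz; apply; apply: cd_eq.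
  apply: (cderiv_ext ltr01 _ (cderiv_cst 0 0)) => h hh /=; rewrite flat//.
  rewrite add0r /rho (le_lt_trans (le_normcD _ _))// normcN.
  have -> : 8 * (normc z + 1) / 8 = normc z + 1 by field.
  lra.
pose B : R := 4 * 20 * 4 ^+ 9 * (r + 1) ^+ 4.
have B0 : 0 < B by rewrite !mulr_gt0 ?exprn_gt0 ?ltr0n//; lra.
have [|s1 s10 k1] := metric_at_zero rho0 (entire_disc h1) hq q0 Fq z0 z1 z2 (e := e / B).
  by rewrite divr_gt0.
have half : 0 < 2^-1 :> R by rewrite invr_gt0.
have [s2 s20 k2] := cderiv_cont (cdP (h2 z)) half.
have [s3 s30 k3] := cderiv_cont (cdP (h1 z)) ltr01.
exists (Num.min (Num.min s1 s2) (Num.min s3 1)) => [|h].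
  by rewrite !lt_min s10 s20 s30 ltr01.
rewrite !lt_min => /andP[/andP[hs1 hs2] /andP[hs3 hs4]].
have [->|hn0] := eqVneq h 0.
  by rewrite addr0 z1 normc0 expr0n sqdensity0 ltW.
have [Fh ineq] := k1 h hn0 hs1.
set d := normc (cd F1 _) ^+ 2 in ineq *; set p := normc (F1 _) ^+ 2 in ineq *.
set q2 := normc (F2 _) ^+ 2.
have {}k2 := k2 h hs2; have {}k3 := k3 h hs3; rewrite z0 subr0 in k3.
have n1 := normc_ge0 (F1 (z + h)); have n2 := normc_ge0 (F2 (z + h)).
have p0 : 0 < p by rewrite exprn_gt0// normc_gt0.
have p1 : p <= 1 by rewrite expr_le1.
have [low high] : 2^-1 <= normc (F2 (z + h)) /\ normc (F2 (z + h)) <= 2.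
  have a := le_normc_sub (F2 z) (F2 z - F2 (z + h)).
  rewrite subKr normcB F2z in a.
  have b := le_normc_sub (F2 (z + h)) (F2 z); rewrite F2z in b.
  by split; lra.
have q4 : 4^-1 <= q2.
  have : (2^-1) ^+ 2 <= q2 by rewrite lerXn2r ?nnegrE//; lra.
  by rewrite expr2; lra.
have q5 : q2 <= 4.
  have : q2 <= 2 ^+ 2 by rewrite lerXn2r ?nnegrE//; lra.
  by rewrite expr2; lra.
have t4 : (r ^+ 2 - normc (z + h) ^+ 2) ^+ 2 <= (r + 1) ^+ 4.
  have zh : normc (z + h) <= r + 1.
    by apply: (le_trans (le_normcD _ _)); apply: lerD zr (ltW hs4).
  have := normc_ge0 (z + h); move: (normc _) r0 zh; clear => x r0 zh x0.
  have -> : (r + 1) ^+ 4 = ((r + 1) ^+ 2) ^+ 2 by rewrite -exprM.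
  have b1 : x ^+ 2 <= (r + 1) ^+ 2 by rewrite lerXn2r ?nnegrE//; lra.
  have b2 : r ^+ 2 <= (r + 1) ^+ 2 by rewrite lerXn2r ?nnegrE//; lra.
  have b3 := sqr_ge0 x; have b4 := sqr_ge0 r.
  move: (x ^+ 2) (r ^+ 2) ((r + 1) ^+ 2) b1 b2 b3 b4; clear => x r w *; nra.
have p01 : 0 < p <= 1 by rewrite p0.
have q45 : 4^-1 <= q2 <= 4 by rewrite q4.
apply: (le_trans (sqdensity_le_near (sqr_ge0 _) p01 q45 t4)); rewrite -/B -ler_pdivlMr//.
Qed.

(** Neighbourhoods of [z] in terms of [normc], so that [ccont] yields convergence along this filter
    directly and the algebra of limits proves continuity of the density. *)
Definition discs z : set_system R[i] :=
  filter_from [set r : R | 0 < r] (fun r => [set w | normc (w - z) < r]).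

#[global] Instance discs_filter z : Filter (discs z).
Proof.
apply: filter_from_filter; first by exists 1; exact: ltr01.
move=> a b a0 b0; exists (Num.min a b) => /=; first by rewrite lt_min a0.
by move=> w /=; rewrite lt_min => /andP.
Qed.

Lemma cvg_normc F z : ccont F z -> normc (F x) @[x --> discs z] --> normc (F z).
Proof.
move=> hF; apply/cvgrPdist_le => e e0; have [s s0 hs] := hF e e0.
exists s => // w hw /=.
have := hs (w - z) hw; rewrite [z + _]addrC subrK => H.
rewrite ler_norml; have a := le_normc_sub (F w) (F z).
by have := le_normc_sub (F z) (F w); rewrite [normc (F z - _)]normcB; lra.
Qed.

Lemma continuous_root15 (p : R) : 0 < p -> {for p, continuous root15}.
Proof.
move=> p0; apply: (@continuous_comp _ _ _ (@ln R) (fun x => expR (15^-1 * x))).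
  exact: continuous_ln.
have H : {for ln p, continuous (fun x : R => 15^-1 * x)} by exact: mulrl_continuous.
exact: (continuous_comp H (@continuous_expR R _)).
Qed.

Lemma cvg_root15 (phi : R[i] -> R) z : 0 < phi z ->
  phi x @[x --> discs z] --> phi z -> root15 (phi x) @[x --> discs z] --> root15 (phi z).
Proof. by move=> p0 hp; apply: cvg_comp hp _; exact: continuous_root15. Qed.

Lemma cvg_sqdensity (D p q t : R[i] -> R) z : 0 < p z -> 0 < q z ->
  D x @[x --> discs z] --> D z -> p x @[x --> discs z] --> p z -> q x @[x --> discs z] --> q z ->
  t x @[x --> discs z] --> t z ->
  sqdensity (D x) (p x) (q x) (t x) @[x --> discs z] --> sqdensity (D z) (p z) (q z) (t z).
Proof.
move=> p0 q0 hD hp hq ht.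
have P := cvg_root15 p0 hp; have Q := cvg_root15 q0 hq.
have P0 := root15_gt0 (p z); have Q0 := root15_gt0 (q z).
have X (n : nat) (f : R[i] -> R) : f x @[x --> discs z] --> f z -> f x ^+ n @[x --> discs z] --> f z ^+ n.
  by move=> hf; elim: n => [|n IH]; [exact: cvg_cst|rewrite exprS; under eq_fun do rewrite exprS; exact: cvgM].
have one (f : R[i] -> R) : f x @[x --> discs z] --> f z -> 1 + f x @[x --> discs z] --> 1 + f z.
  by move=> hf; apply: cvgD => //; exact: cvg_cst.
apply: cvgM; last exact: X.
apply: cvgM; last by apply: cvgM; exact: one.
apply: cvgM => //; apply: cvgV; first by rewrite mulf_neq0// expf_neq0// gt_eqF.
by apply: cvgM; exact: (X 9%N (fun x => root15 _)).
Qed.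

(** At the centre the density is a fixed [A > 0] times [r ^ 4], whereas its maximum over the disc is
    at most a constant times [r ^ 2]. *)
Theorem ahlfors g : entire g ->
  (forall z, g z = 0 \/ g z = 1 -> cd g z = 0 /\ cd (cd g) z = 0) -> cd g 0 = 0.
Proof.
move=> hg ram; apply: contrapT => /eqP nz.
have hg1 := entire_subr 1 hg; have dg1 := cd_subr 1 hg.
have E0 z : cd g z != 0 -> g z != 0 /\ g z - 1 != 0.
  move=> cz; split; apply/eqP.
    by move=> gz; have [c0 _] := ram z (or_introl gz); move: cz; rewrite c0 eqxx.
  by move/eqP; rewrite subr_eq0 => /eqP gz; have [c0 _] := ram z (or_intror gz); move: cz; rewrite c0 eqxx.
pose S r w := sqdensity (normc (cd g w) ^+ 2) (normc (g w) ^+ 2) (normc (g w - 1) ^+ 2)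
    (r ^+ 2 - normc w ^+ 2).
have S0 r w : 0 <= S r w.
  have [d0|d0] := eqVneq (cd g w) 0; first by rewrite /S d0 normc0 expr0n sqdensity0.
  rewrite /S; have [->|t0] := eqVneq (r ^+ 2 - normc w ^+ 2) 0.
    by rewrite /sqdensity expr0n mulr0.
  by rewrite ltW// sqdensity_gt0// exprn_gt0 ?normc_gt0.
have bd r : 0 < r -> S r 0 <= 2 * 225 * 625 * r ^+ 2.
  move=> r0; have [|w wr wmax] := @usc_max R (S r) r (ltW r0).
    move=> w wr e e0.
    have [gw|gw] := eqVneq (g w) 0.
      have [c1 c2] := ram w (or_introl gw).
      have n1 : normc (g w - 1) = 1 by rewrite gw sub0r normcN normc1.
      have [s s0 hs] := sqdensity_near_zero hg hg1 gw c1 c2 n1 nz wr e0.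
      by exists s => // h /hs H; apply: (le_trans H); rewrite lerDr.
    have [gw1|gw1] := eqVneq (g w - 1) 0.
      have gw' : g w = 1 by apply/eqP; rewrite -subr_eq0 gw1.
      have [c1 c2] := ram w (or_intror gw').
      have n1 : normc (g w) = 1 by rewrite gw' normc1.
      rewrite -dg1 in c1 c2; have nz1 := nz; rewrite -dg1 in nz1.
      have [s s0 hs] := sqdensity_near_zero hg1 hg gw1 c1 c2 n1 nz1 wr e0.
      exists s => // h /hs H; rewrite /S sqdensityC -{1}dg1; apply: (le_trans H).
      by rewrite lerDr; exact: (S0 r w).
    have pos (a : R[i]) : a != 0 -> 0 < normc a ^+ 2 by move=> ?; rewrite exprn_gt0// normc_gt0.
    have sq F : ccont F w -> normc (F x) ^+ 2 @[x --> discs w] --> normc (F w) ^+ 2.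
      by move=> /cvg_normc hF; exact: cvgM.
    have : S r x @[x --> discs w] --> S r w.
      apply: (@cvg_sqdensity (fun x => normc (cd g x) ^+ 2) (fun x => normc (g x) ^+ 2)
        (fun x => normc (g x - 1) ^+ 2) (fun x => r ^+ 2 - normc x ^+ 2)); try exact: pos.
      - by apply: sq; apply: cderiv_cont (cdP (entire_cd hg w)).
      - by apply: sq; apply: cderiv_cont (cdP (hg w)).
      - by apply: (sq (fun x => g x - 1)); apply: cderiv_cont (cdP (hg1 w)).
      - apply: cvgB; first exact: cvg_cst.
        by apply: (sq id); apply: cderiv_cont (cderiv_id w).
    move/cvgrPdist_le => /(_ e e0) [s s0 hs].
    exists s => // h hh; have := hs (w + h); rewrite /mkset addrAC subrr add0r => /(_ hh).
    by rewrite ler_norml; lra.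
  have n0r : normc (0 : R[i]) <= r by rewrite normc0 ltW.
  apply: (le_trans (wmax 0 n0r)).
  (* The maximum is at least this positive value, so it is attained neither on the boundary nor at a
     zero of [g'], which by [ram] rules out the points over 0 and 1. *)
  have S0p : 0 < S r 0.
    by apply: sqdensity_gt0; [rewrite exprn_gt0 ?normc_gt0|rewrite normc0 expr0n subr0 gt_eqF// exprn_gt0].
  have Sw : 0 < S r w := lt_le_trans S0p (wmax 0 n0r).
  have dw : cd g w != 0.
    by apply/eqP => d0; move: Sw; rewrite /S d0 normc0 expr0n sqdensity0 ltxx.
  have wr' : normc w < r.
    rewrite lt_neqAle wr andbT; apply/eqP => e.
    by move: Sw; rewrite /S e subrr /sqdensity expr0n mulr0 ltxx.
  have [gw gw1] := E0 w dw.
  apply: (@sqdensity_max_le R g w r (r - normc w)) => //; first by rewrite subr_gt0.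
  move=> h hh; apply: wmax; rewrite (le_trans (le_normcD _ _))//; lra.
pose A := sqdensity (normc (cd g 0) ^+ 2) (normc (g 0) ^+ 2) (normc (g 0 - 1) ^+ 2) 1.
have A0 : 0 < A by rewrite sqdensity_gt0 ?oner_eq0// exprn_gt0// normc_gt0.
have SA r : S r 0 = A * r ^+ 4.
  by rewrite /S normc0 expr0n subr0 /A /sqdensity expr1n mulr1 -exprM.
pose K : R := 2 * 225 * 625; have K0 : 0 < K by rewrite !mulr_gt0 ?ltr0n.
pose r := K / A + 1.
have r1 : 1 <= r by rewrite lerDr divr_ge0 ?ltW.
have r0 : 0 < r by lra.
have := bd r r0; rewrite SA -/K.
have -> : A * r ^+ 4 = A * r ^+ 2 * r ^+ 2 by rewrite -mulrA -exprD.
rewrite ler_pM2r ?exprn_gt0// => H.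
have : A * r <= K by apply: le_trans H; rewrite ler_wpM2l ?(ltW A0)// expr2; nra.
rewrite /r mulrDr mulrCA divff ?gt_eqF// !mulr1; lra.
Qed.

End Ahlfors.

(** * Zalcman rescaling *)

Section Zalcman.
Context {R : realType}.
Implicit Types (F G : R[i] -> R[i]) (z w a b : R[i]) (r s M : R).

(** The space is a union of real lines through 0. *)
Lemma connected_normed (V : normedModType R[i]) : connected [set: V].
Proof.
have -> : [set: V] = \bigcup_(v in [set: V]) [set t%:C *: v | t in [set: R]].
  by apply/seteqP; split=> // v _; exists v => //; exists 1 => //; rewrite scale1r.
apply: bigcup_connected; first by exists 0 => v _; exists 0 => //; rewrite scale0r.
move=> v _; apply: connected_continuous_connected.
  by apply/connected_intervalP.
apply: continuous_subspaceT => t; apply/cvgrPdist_lt => /= e e0.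
have er : e = (complex.Re e)%:C by rewrite RRe_real// gtr0_real.
rewrite er ltcR in e0.
have v1 : 0 < nrm v + 1 by have := nrm_ge0 v; lra.
apply/nbhs_ballP; exists (complex.Re e / (nrm v + 1)) => /=; first by rewrite divr_gt0.
move=> x /=; rewrite /ball /= ltr_pdivlMr// => xt.
rewrite -scalerBl -rmorphB normr_nrm nrmZ normc_real er ltcR.
by have := nrm_ge0 v; have := normr_ge0 (t - x); nra.
Qed.

Lemma cd_affine_comp F (c k : R[i]) w : (exists l, cderiv F (c + k * w) l) ->
  cd (fun x => F (c + k * x)) w = k * cd F (c + k * w).
Proof. by move=> /cdP h; apply: cd_eq; exact: cderiv_affine_comp. Qed.

Lemma cd2_affine_comp F (c k : R[i]) w r : 0 < r ->
  (forall x, normc (x - w) < r -> exists l, cderiv F (c + k * x) l) ->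
  (exists l, cderiv (cd F) (c + k * w) l) ->
  cd (cd (fun x => F (c + k * x))) w = k ^+ 2 * cd (cd F) (c + k * w).
Proof.
move=> r0 hF /cdP h; apply: cd_eq; rewrite expr2 -mulrA.
apply: (@cderiv_ext _ (fun x => k * cd F (c + k * x)) _ _ _ r) => //.
  by move=> x xr; rewrite cd_affine_comp//; apply: hF; rewrite addrAC subrr add0r.
by apply: cderivZ; exact: cderiv_affine_comp.
Qed.

Context {U : set_system nat} {UU : UltraFilter U}.

(** Smallness is known not at [z] but at points drifting towards it; a common Lipschitz constant
    carries it over to [z]. *)
Lemma ulim_zero (v : nat -> R[i] -> R[i]) z c s K : 0 < s ->
  U [set j | forall w, normc (w - z) < s -> normc (v j w - v j z) <= K * normc (w - z)] ->
  (forall e d, 0 < e -> 0 < d ->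
     U [set j | exists2 w, normc (w - z) < d & normc (v j w) <= e]) ->
  ulim (U := U) (v^~ z) c -> c = 0.
Proof.
move=> s0 lip small lim; apply/eqP; rewrite -normc_eq0; apply/eqP/le_anti.
rewrite normc_ge0 andbT; apply/ler_addgt0Pr => e e0; rewrite add0r.
have e2 : 0 < e / 2 by lra.
have K1 : 0 < `|K| + 1 by have := normr_ge0 K; lra.
have d0 : 0 < Num.min s (e / 2 / (`|K| + 1)) by rewrite lt_min s0 divr_gt0.
apply: (ulim_le lim); apply: filterS2 lip (small _ _ e2 d0) => j hj [w].
rewrite lt_min => /andP[ws]; rewrite ltr_pdivlMr// => wK we /=.
have := hj w ws; have -> : v j z = v j w - (v j w - v j z) by rewrite subKr.
move=> H; apply: (le_trans (le_normcD _ _)); rewrite normcN.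
rewrite subKr in H.
have n0 := normc_ge0 (w - z).
have : K * normc (w - z) <= `|K| * normc (w - z) by rewrite ler_wpM2r// ler_norm.
lra.
Qed.

(** If zeros near [z] were missing on a set of the ultrafilter, Hurwitz would make [g] vanish around
    [z]. The dichotomy at [z] on a disc large enough to reach 0 then leaves two cases: [g] vanishes
    around 0, against the nonzero derivative there, or it has finite order at [z], against its
    vanishing. *)
Lemma hurwitz_near (u : nat -> R[i] -> R[i]) g z s M : entire g -> cd g 0 != 0 ->
  0 < s ->
  U [set j | disc_hol (u j) z s /\ forall w, normc (w - z) < s -> normc (u j w) <= M] ->
  (forall w, ulim (U := U) (u^~ w) (g w)) -> g z = 0 ->
  forall d, 0 < d -> U [set j | exists2 w, normc (w - z) < d & u j w = 0].
Proof.
move=> hg g1 s0 hu lim gz d d0.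
have [//|no] := in_ultra_setVsetC [set j | exists2 w, normc (w - z) < d & u j w = 0] UU.
exfalso; pose t := Num.min s d; have t0 : 0 < t by rewrite lt_min s0.
have [ts td] : t <= s /\ t <= d by split; rewrite /t ge_min lexx ?orbT.
have flat w : normc (w - z) < t / 8 -> g w = 0.
  apply: (@hurwitz _ U UU u g z t M) => //.
    apply: filterS hu => j [h1 h2]; split; first by apply: (disc_holS h1); rewrite subrr normc0; lra.
    by move=> x hx; apply: h2; lra.
  apply: filterS no => j hj x hx; apply/eqP => ux; apply: hj; exists x => //; lra.
have nz0 := normc_ge0 z.
pose rho := 8 * (normc z + 1); have rho0 : 0 < rho by rewrite /rho; lra.
have [fl|[m [q [hq q0 gq]]]] := zero_dichotomy rho0 (entire_disc hg (z := z) (r := rho)).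
  move/eqP: g1; apply; apply: cd_eq.
  apply: (cderiv_ext ltr01 _ (cderiv_cst 0 0)) => h hh /=; rewrite fl//.
  rewrite add0r /rho (le_lt_trans (le_normcD _ _))// normcN.
  have -> : 8 * (normc z + 1) / 8 = normc z + 1 by field.
  lra.
have r00 : normc (0 - 0 : R[i]) < rho by rewrite subrr normc0.
have n0 : 0 < normc (q 0) by rewrite normc_gt0.
have [|e e0 he] := cderiv_cont (cdP (hq 0 r00)) (e := normc (q 0) / 2); first by lra.
pose x := Num.min e (Num.min (t / 8) rho) / 2.
have m0 : 0 < Num.min e (Num.min (t / 8) rho) by rewrite !lt_min e0 rho0 divr_gt0.
have [m1 m2 m3] : [/\ Num.min e (Num.min (t / 8) rho) <= e,
  Num.min e (Num.min (t / 8) rho) <= t / 8 & Num.min e (Num.min (t / 8) rho) <= rho].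
  by split; rewrite !ge_min lexx ?orbT.
have x0 : 0 < x by rewrite divr_gt0.
have nx : normc x%:C = x by rewrite normc_real gtr0_norm.
have := gq x%:C; rewrite nx flat; last by rewrite addrAC subrr add0r nx /x; lra.
move=> /(_ _) H; have {}H : 0 = x%:C ^+ m * q x%:C by apply: H; rewrite /x; lra.
have xm : (x%:C : R[i]) ^+ m != 0 by rewrite expf_neq0// -normc_gt0 nx.
have qx : q x%:C = 0.
  by apply/eqP; move/eqP: H; rewrite eq_sym mulf_eq0 (negbTE xm).
have := he x%:C; rewrite add0r nx qx sub0r normcN => /(_ _) H2.
have : normc (q 0) <= normc (q 0) / 2 by apply: H2; rewrite /x; lra.
lra.
Qed.

End Zalcman.

(** * The bound in one variable *)

Section Rescaling.
Context {R : realType}.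
Implicit Types (F G g : R[i] -> R[i]) (z w t a b : R[i]) (r s M N : R).

Lemma usc_spherical F r : 0 < r -> disc_hol F 0 r ->
  forall w, normc w <= r / 2 -> forall e, 0 < e -> exists2 s : R, 0 < s &
    forall h, normc h < s ->
    (r / 2 - normc (w + h)) * (normc (cd F (w + h)) / (1 + normc (F (w + h)) ^+ 2)) <=
    (r / 2 - normc w) * (normc (cd F w) / (1 + normc (F w) ^+ 2)) + e.
Proof.
move=> r0 hF w wr e e0.
have wr' : normc (w - 0) < r by rewrite subr0; lra.
have c1 := cvg_normc (cderiv_cont (cdP (hF w wr'))).
have c2 := cvg_normc (cderiv_cont (cdP (disc_hol_cd hF wr'))).
have c3 := cvg_normc (cderiv_cont (cderiv_id w)).
have a1 : r / 2 - normc x @[x --> discs w] --> r / 2 - normc w.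
  by apply: cvgB; [exact: cvg_cst|exact: c3].
have a2 : 1 + normc (F x) * normc (F x) @[x --> discs w] --> 1 + normc (F w) * normc (F w).
  by apply: cvgD; [exact: cvg_cst|exact: cvgM].
have a3 : 1 + normc (F w) * normc (F w) != 0.
  by rewrite gt_eqF// ltr_pwDl// mulr_ge0 ?normc_ge0.
have : (r / 2 - normc x) * (normc (cd F x) / (1 + normc (F x) ^+ 2)) @[x --> discs w] -->
   (r / 2 - normc w) * (normc (cd F w) / (1 + normc (F w) ^+ 2)).
  by apply: cvgM; [exact: a1|apply: cvgM; [exact: c2|exact: cvgV a3 a2]].
move/cvgrPdist_le => /(_ e e0)[s s0 hs]; exists s => // h hh.
have := hs (w + h); rewrite /mkset addrAC subrr add0r => /(_ hh).
by rewrite ler_norml; lra.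
Qed.

(* Zalcman's rescaling; [N] is the maximum of [(r / 2 - |t|) F#(t)]. *)
Lemma zalcman_rescale F r (k : R) : 0 < r -> 0 <= k -> disc_hol F 0 r ->
  k * (1 + normc (F 0) ^+ 2) < normc (cd F 0) ->
  exists (c rho : R[i]) N, [/\ r / 2 * k < N, 0 < normc rho <= r / 2 / N,
    forall x, normc x < N -> normc (c + rho * x) < r,
    normc (rho * cd F c) = 1 + normc (F c) ^+ 2 &
    forall x, normc x < N / 2 ->
      normc (rho * cd F (c + rho * x)) <= 2 * (1 + normc (F (c + rho * x)) ^+ 2)].
Proof.
move=> r0 k0 hF big; pose S x := normc (cd F x) / (1 + normc (F x) ^+ 2).
have den x : 0 < 1 + normc (F x) ^+ 2 by have := sqr_ge0 (normc (F x)); lra.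
have S0 x : 0 <= S x by rewrite divr_ge0 ?normc_ge0// ltW.
have r2 : 0 <= r / 2 by lra.
have [c cr cmax] := usc_max r2 (usc_spherical r0 hF).
have {}cmax x : normc x <= r / 2 ->
  (r / 2 - normc x) * S x <= (r / 2 - normc c) * S c := cmax x.
set N := (r / 2 - normc c) * S c in cmax.
have N1 : r / 2 * k < N.
  have := cmax 0; rewrite normc0 subr0 => /(_ r2) H; apply: lt_le_trans H.
  by rewrite ltr_pM2l; [rewrite ltr_pdivlMr|lra].
have N0 : 0 < N by apply: le_lt_trans N1; rewrite mulr_ge0.
have Sc : 0 < S c.
  rewrite lt_def S0 andbT; apply/eqP => e; move: N0; rewrite /N e mulr0 ltxx//.
have cr' : 0 < r / 2 - normc c by move: N0; rewrite /N pmulr_lgt0.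
(* Scaling by the reciprocal of the spherical derivative at [c] makes that of the rescaled function
   equal to 1 at the origin. *)
exists c, (S c)^-1%:C, N.
have nrho : normc ((S c)^-1%:C) = (S c)^-1 by rewrite normc_real ger0_norm// invr_ge0.
have eN : N / S c = r / 2 - normc c by rewrite /N mulfK// gt_eqF.
have nx x : normc ((S c)^-1%:C * x) = normc x / S c by rewrite normcM nrho mulrC.
split=> //.
- rewrite nrho invr_gt0 Sc/= ler_pdivlMr// mulrC eN; have := normc_ge0 c; lra.
- move=> x xN; apply: (le_lt_trans (le_normcD _ _)); rewrite nx.
  have : normc x / S c < N / S c by rewrite ltr_pM2r// invr_gt0.
  by rewrite eN; lra.
- have cdc : normc (cd F c) != 0.
    by apply/eqP => e; move: Sc; rewrite /S e mul0r ltxx.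
  by rewrite normcM nrho /S invf_div divfK.
(* For |x| below [N / 2] the point [y] is at most half-way from [c] to the circle of radius [r / 2];
   the weight at least halves at worst, hence the factor 2. *)
- move=> x xN; set y := c + _.
  have yc : normc y <= normc c + (r / 2 - normc c) / 2.
    apply: (le_trans (le_normcD _ _)); rewrite nx lerD2l.
    have : normc x / S c < N / 2 / S c by rewrite ltr_pM2r// invr_gt0.
    by rewrite mulrAC eN; lra.
  have := cmax y; have yr : normc y <= r / 2 by lra.
  move=> /(_ yr) H.
  have H2 : S y <= 2 * S c.
    have : (r / 2 - normc c) / 2 * S y <= N.
      apply: le_trans H; rewrite ler_wpM2r//; lra.
    rewrite /N => H3.
    have : (r / 2 - normc c) * S y <= (r / 2 - normc c) * (2 * S c) by lra.
    by rewrite ler_pM2l.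
  have e : normc (cd F y) = S y * (1 + normc (F y) ^+ 2) by rewrite /S divfK// gt_eqF.
  rewrite normcM nrho e mulrA ler_wpM2r ?(ltW (den y))//.
  by rewrite ler_pdivrMl// mulrC.
Qed.

(** The order of quantifiers is the point: [C] is common to all [F]. Were there none, functions with
    spherical derivative above [j + 1] at 0 could be rescaled to a sequence covered by Marty's
    criterion on the whole plane. *)
Theorem ramified_bound a b M r : a != b -> 0 < r -> exists C : R,
  forall F, disc_hol F 0 r ->
  (forall t, normc t < r -> F t = a \/ F t = b ->
     normc (cd F t) <= M /\ normc (cd (cd F) t) <= M) ->
  normc (cd F 0) <= C * (1 + normc (F 0) ^+ 2).
Proof.
move=> ab r0; apply: contrapT => nC.
have [F hF] : {F & forall j : nat, [/\ disc_hol (F j) 0 r,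
    forall t, normc t < r -> F j t = a \/ F j t = b ->
      normc (cd (F j) t) <= M /\ normc (cd (cd (F j)) t) <= M &
    j.+1%:R * (1 + normc (F j 0) ^+ 2) < normc (cd (F j) 0)]}.
  apply: (@boolp.choice _ _ (fun (j : nat) F => [/\ disc_hol F 0 r,
    forall t, normc t < r -> F t = a \/ F t = b ->
      normc (cd F t) <= M /\ normc (cd (cd F) t) <= M &
    j.+1%:R * (1 + normc (F 0) ^+ 2) < normc (cd F 0)])) => j.
  apply: contrapT => h; apply: nC; exists j.+1%:R => F h1 h2.
  by rewrite leNgt; apply/negP => h3; apply: h; exists F.
have [cj hcj] : {c & forall j : nat, exists N, [/\ r / 2 * j.+1%:R < N, 0 < normc (c j).2 <= r / 2 / N,
    forall x, normc x < N -> normc ((c j).1 + (c j).2 * x) < r,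
    normc ((c j).2 * cd (F j) (c j).1) = 1 + normc (F j (c j).1) ^+ 2 &
    forall x, normc x < N / 2 -> normc ((c j).2 * cd (F j) ((c j).1 + (c j).2 * x)) <=
      2 * (1 + normc (F j ((c j).1 + (c j).2 * x)) ^+ 2)]}.
  apply: (@boolp.choice nat (R[i] * R[i]) (fun j c => exists N, [/\ r / 2 * j.+1%:R < N,
    0 < normc c.2 <= r / 2 / N,
    forall x, normc x < N -> normc (c.1 + c.2 * x) < r,
    normc (c.2 * cd (F j) c.1) = 1 + normc (F j c.1) ^+ 2 &
    forall x, normc x < N / 2 -> normc (c.2 * cd (F j) (c.1 + c.2 * x)) <=
      2 * (1 + normc (F j (c.1 + c.2 * x)) ^+ 2)])) => j.
  have [h1 h2 h3] := hF j.
  have [c [rho [N h]]] := zalcman_rescale r0 (ler0n R j.+1) h1 h3.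
  by exists (c, rho), N.
pose rho j := (cj j).2.
pose G j x := F j ((cj j).1 + rho j * x).
have [U [UU Uoo]] := ultraFilterLemma eventually_filter.
have large B : U [set j | B < j.+1%:R * (r / 4)].
  have r4 : 0 < r / 4 by lra.
  apply: Uoo; exists (Num.truncn (B / (r / 4))) => // j.
  rewrite /mkset -ltr_pdivrMr// => h; apply: (lt_le_trans (truncnS_gt _)).
  by rewrite ler_nat.
have rho1 j : normc (rho j) <= j.+1%:R^-1.
  have [N [h1 /andP[_ h3] _ _ _]] := hcj j; apply: (le_trans h3).
  have r2 : 0 < r / 2 by lra.
  have N0 : 0 < N by apply: le_lt_trans h1; rewrite mulr_ge0// ltW.
  rewrite ler_pdivrMr// ler_pdivlMl// mulrC ltW//.
(* Since [N] exceeds [r / 2 * (j + 1)], this disc lies within radius [N / 2], where the rescaled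
   spherical derivative is at most 2; every fixed disc is eventually covered. *)
have Gfacts j z : normc z < j.+1%:R * (r / 4) ->
    [/\ normc ((cj j).1 + rho j * z) < r, exists l, cderiv (G j) z l,
     normc (cd (G j) z) <= 2 * (1 + normc (G j z) ^+ 2),
     cd (G j) z = rho j * cd (F j) ((cj j).1 + rho j * z) &
     cd (cd (G j)) z = rho j ^+ 2 * cd (cd (F j)) ((cj j).1 + rho j * z)].
  move=> zj; have [N [h1 _ h4 h5 h6]] := hcj j; have [f1 f2 f3] := hF j.
  have jr : r / 2 * j.+1%:R = 2 * (j.+1%:R * (r / 4)) by field.
  have zN : normc z < N / 2 by lra.
  have nz := normc_ge0 z.
  have F1 x : normc x < N -> normc ((cj j).1 + rho j * x - 0) < r.
    by rewrite subr0; exact: h4.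
  have zN' : normc z < N by lra.
  have D1 : cd (G j) z = rho j * cd (F j) ((cj j).1 + rho j * z).
    by apply: cd_affine_comp; apply: f1; exact: F1.
  split=> //.
  - exact: h4.
  - by eexists; apply: cderiv_affine_comp (cdP (f1 _ (F1 _ zN'))).
  - by rewrite D1; exact: h6.
  - apply: (@cd2_affine_comp _ (F j) (cj j).1 (rho j) z (N / 2)); first by lra.
      move=> x hx; apply/f1/F1; have -> : x = (x - z) + z by ring.
      by apply: (le_lt_trans (le_normcD _ _)); lra.
    by apply: (disc_hol_cd f1); exact: F1.
have near z s : U [set j | forall w, normc (w - z) < s -> normc w < j.+1%:R * (r / 4)].
  apply: filterS (large (normc z + s)) => j /= hj w hw.
  have -> : w = (w - z) + z by ring.
  by apply: (le_lt_trans (le_normcD _ _)); lra.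
have G0 : U [set j | normc (cd (G j) 0) = 1 + normc (G j 0) ^+ 2].
  apply: filterS (near 0 1) => j /(_ 0) h.
  have [|_ _ _ e _] := Gfacts j 0; first by apply: h; rewrite subrr normc0.
  have [N [_ _ _ h5 _]] := hcj j.
  by rewrite /mkset e /G mulr0 addr0.
have sb z : [set: R[i]] z -> exists s C, 0 < s /\
    U [set j | forall w : R[i], nrm (w - z) < s -> spherical_bound (G j) C w].
  move=> _; exists 1, 2; split=> //; apply: filterS (near z 1) => j hj w hw.
  have [_ Dw bw _ _] := Gfacts j w (hj w hw).
  exists (fun h => cd (G j) w * h); split; first exact: clin_mul.
    exact: (cderiv_Dat (cdP Dw)).
  move=> h; rewrite normcM; apply: (le_trans (ler_wpM2r (normc_ge0 h) bw)).
  by rewrite mulrAC.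
have [] := @marty R R[i] U UU G (@compact_disc R) setT openT (@connected_normed R R[i]) sb.
  move=> [g hg]; have {}hg z := hg z I.
  have entg : entire g by move=> z; have [h _ _] := hg z; exact: hol_at_cderiv.
  have lim z : ulim (U := U) (G^~ z) (g z) by have [] := hg z.
  have loc z : exists s K, 0 < s /\ U [set j | disc_hol (G j) z s /\
      forall w, normc (w - z) < s -> normc (G j w) <= K].
    have [_ _ [s [K [s0 h _]]]] := hg z; exists s, K; split=> //.
    apply: filterS h => j hj; split=> w hw; have [h1 h2] := hj w hw => //.
    exact: hol_at_cderiv.
  have lim1 z : ulim (U := U) (fun j => cd (G j) z) (cd g z).
    have [s [K [s0 h]]] := loc z.
    by have [] := cderiv_ulim s0 h (fun w _ => lim w).
  have loc1 z : exists s K, 0 < s /\ U [set j | disc_hol (cd (G j)) z s /\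
      forall w, normc (w - z) < s -> normc (cd (G j) w) <= K].
    have [s [K [s0 h]]] := loc z; exists (s / 2), (8 * K / (s / 2)); split; first by lra.
    apply: filterS h => j [h1 h2]; split.
      by apply: disc_hol_cd; apply: (disc_holS h1); rewrite subrr normc0; lra.
    move=> w hw; apply: cauchy_le; first by lra.
      by apply: (disc_holS h1); lra.
    by move=> x hx; apply: h2; apply: (sub_disc hw _ hx); lra.
  have lim2 z : ulim (U := U) (fun j => cd (cd (G j)) z) (cd (cd g) z).
    have [s [K [s0 h]]] := loc1 z.
    by have [] := cderiv_ulim s0 h (fun w _ => lim1 w).
  have nz : cd g 0 != 0.
    apply/eqP => g0; have l0 := lim1 0; rewrite g0 in l0.
    have half : 0 < 2^-1 :> R by rewrite invr_gt0.
    have [j [h1 h2]] := filter_ex (filterI G0 (l0 _ half)).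
    move: h2; rewrite /mkset subr0 h1; have := sqr_ge0 (normc (G j 0)); lra.
  have lip (v : nat -> R[i] -> R[i]) z : (exists s K, 0 < s /\
      U [set j | disc_hol (v j) z s /\ forall w, normc (w - z) < s -> normc (v j w) <= K]) ->
      exists s K, 0 < s /\ U [set j | forall w, normc (w - z) < s ->
      normc (cd (v j) w - cd (v j) z) <= K * normc (w - z)].
    move=> [s [K [s0 h]]]; exists (s / 8), (1024 * K / s ^+ 2); split; first by lra.
    apply: filterS h => j [h1 h2] w hw; apply: (cd_lip s0 h1 h2) => //.
    by rewrite subrr normc0; lra.
  (* Points where [G j] takes the value [c] approach [z]. At them the chain rule bounds the first
     and second derivative by |rho j| and |rho j|^2 times the bound for [F j]. *)
  have key z c : c = a \/ c = b -> g z = c -> cd g z = 0 /\ cd (cd g) z = 0.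
    move=> cab gz.
    have hits d : 0 < d -> U [set j | exists2 w, normc (w - z) < d & G j w = c].
      move=> d0; have [s [K [s0 h]]] := loc z.
      have nz' : cd (fun w => g w - c) 0 != 0 by rewrite cd_subr.
      have gz' : g z - c = 0 by rewrite gz subrr.
      have lim' w : ulim (U := U) (fun j => G j w - c) (g w - c).
        exact: ulimB (lim w) (ulim_cst c).
      have := @hurwitz_near R U UU (fun j w => G j w - c) (fun w => g w - c) z s
        (K + normc c) (entire_subr c entg) nz' s0 _ lim' gz' d d0.
      move=> H; have {}H : U [set j | exists2 w, normc (w - z) < d & G j w - c = 0].
        apply: H; apply: filterS h => j [h1 h2]; split.
          by move=> w hw; eexists; apply: cderivB (cdP (h1 w hw)) (cderiv_cst c w).
        move=> w hw; apply: (le_trans (le_normcD _ _)); rewrite normcN lerD2r.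
        exact: h2.
      by apply: filterS H => j [w w1 w2]; exists w => //; apply/eqP; rewrite -subr_eq0 w2.
    pose M1 := `|M| + 1; have M10 : 0 < M1 by rewrite /M1; have := normr_ge0 M; lra.
    have fine e : 0 < e -> U [set j | j.+1%:R^-1 <= 1 :> R /\ j.+1%:R^-1 * M1 <= e].
      move=> e0; apply: filterS (large (M1 / e * (r / 4))) => j.
      rewrite /mkset ltr_pM2r; last by lra.
      move=> h; split; first by rewrite invf_le1 ?ler1n ?ltr0n.
      by rewrite mulrC ler_pdivrMr ?ltr0n// mulrC -ler_pdivrMr// ltW.
    have small e d : 0 < e -> 0 < d -> U [set j | exists2 w, normc (w - z) < d &
        normc (cd (G j) w) <= e /\ normc (cd (cd (G j)) w) <= e].
      move=> e0 d0; apply: filterS2 (filterI (hits d d0) (near z d)) (fine e e0).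
      move=> j [[w wd Gw] hj] [f1 f2]; exists w => //.
      have [wr _ _ e1 e2] := Gfacts j w (hj w wd); have [_ hM _] := hF j.
      have Fc : F j ((cj j).1 + rho j * w) = c := Gw.
      have [|M2 M3] := hM _ wr; first by rewrite Fc.
      have MM : M <= M1 by rewrite /M1; have := ler_norm M; lra.
      have r1 := rho1 j; have r0' := normc_ge0 (rho j).
      split.
        rewrite e1 normcM; apply: le_trans f2; apply: ler_pM; rewrite ?normc_ge0//.
        by lra.
      rewrite e2 normcM normcX; apply: le_trans f2; apply: ler_pM; rewrite ?normc_ge0 ?sqr_ge0//.
        by rewrite expr2; apply: (le_trans _ r1); rewrite ler_piMl// (le_trans r1).
      by lra.
    split.
      have [s [K [s0 h]]] := lip _ _ (loc z).
      apply: (@ulim_zero R U UU (fun j => cd (G j)) z _ s K s0 h _ (lim1 z)) => e d e0 d0.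
      by apply: filterS (small e d e0 d0) => j [w w1 [w2 w3]]; exists w.
    have [s [K [s0 h]]] := lip _ _ (loc1 z).
    apply: (@ulim_zero R U UU (fun j => cd (cd (G j))) z _ s K s0 h _ (lim2 z)) => e d e0 d0.
    by apply: filterS (small e d e0 d0) => j [w w1 [w2 w3]]; exists w.
  (* An affine change of the target moves [a] and [b] to 0 and 1. *)
  pose k := (b - a)^-1; have ba : b - a != 0 by rewrite subr_eq0 eq_sym.
  have k0 : k != 0 by rewrite invr_eq0.
  pose g1 w := k * (g w - a).
  have D1 z : cderiv g1 z (k * cd g z).
    apply: cderivZ; rewrite -[cd g z]subr0.
    exact: cderivB (cdP (entg z)) (cderiv_cst a z).
  have c1 : cd g1 = (fun z => k * cd g z) by apply/funext => z; exact: cd_eq.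
  have ent1 : entire g1 by move=> z; exists (k * cd g z).
  have c2 z : cd (cd g1) z = k * cd (cd g) z.
    by rewrite c1; apply: cd_eq; apply: cderivZ; exact: cdP (entire_cd entg z).
  have := ahlfors ent1; rewrite c1 => H.
  have : k * cd g 0 = 0.
    apply: H => z hz.
    have hgz : g z = a \/ g z = b.
      case: hz; rewrite /g1 => /eqP.
        by rewrite mulf_eq0 (negbTE k0) /= subr_eq0 => /eqP; left.
      rewrite /k mulrC -[1](divff ba) (inj_eq (mulIf k0)) => /eqP h; right.
      by apply/eqP; rewrite -(inj_eq (addIr (- a))) h.
    have [x1 x2] : cd g z = 0 /\ cd (cd g) z = 0 by case: hgz => hz'; apply: (key z _ _ hz'); [left|right].
    by rewrite -c1 c2 x1 x2 mulr0.
  by move/eqP; rewrite mulf_eq0 (negbTE k0) (negbTE nz).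
(* Divergence to infinity is excluded: |1 / G j| would be below [s / 16] on the disc of radius [s],
   so its derivative at 0 would be at most 1/2 by Cauchy's estimate, whereas the normalisation makes
   it [(1 + |G j 0|^2) / |G j 0|^2 > 1] in modulus. *)
move=> inf; have [s s0 hs] := inf 0 I.
have e0 : 0 < s / 16 by lra.
have [j [[h0 hB] hn]] := filter_ex (filterI (filterI G0 (hs (s / 16)^-1)) (near 0 s)).
have Gn w : normc (w - 0) < s -> G j w != 0.
  move=> hw; rewrite -normc_gt0; apply: lt_trans (hB w hw).
  by rewrite invr_gt0.
have Gd w : normc (w - 0) < s -> exists l, cderiv (G j) w l.
  by move=> hw; have [] := Gfacts j w (hn w hw).
have s00 : normc (0 - 0 : R[i]) < s by rewrite subrr normc0.
have := @cauchy_le R (fun w => (G j w)^-1) 0 s (s / 16) s0.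
move=> H; have {}H : normc (cd (fun w => (G j w)^-1) 0) <= 8 * (s / 16) / s.
  apply: H => w hw.
    by have [l hl] := Gd w hw; eexists; apply: cderivV hl; exact: Gn.
  rewrite normcV -[X in _ <= X]invrK lef_pV2 ?posrE ?invr_gt0//; first exact/ltW/hB.
  by rewrite normc_gt0 Gn.
have G00 := Gn 0 s00.
move: H; rewrite (cd_eq (cderivV G00 (cdP (Gd 0 s00)))).
rewrite normc_div normcN normcX (h0 : normc (cd (G j) 0) = _).
have np : 0 < normc (G j 0) by rewrite normc_gt0.
rewrite ler_pdivrMr ?exprn_gt0//.
have -> : 8 * (s / 16) / s = 2^-1 by field; rewrite gt_eqF.
have := sqr_ge0 (normc (G j 0)); lra.
Qed.

End Rescaling.

(** * Several variables *)

Section Interface.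
Context {R : realType} {V : normedModType R[i]}.
Implicit Types (f : V -> R[i]) (z h v : V).

Lemma pos_complexE (e : R[i]) : 0 < e -> e = (complex.Re e)%:C /\ 0 < complex.Re e.
Proof.
move=> e0; have er : e = (complex.Re e)%:C by rewrite RRe_real// gtr0_real.
by split=> //; move: e0; rewrite er ltcR.
Qed.

Lemma differentiable_Dat f z : differentiable f z -> clin ('d f z) /\ Dat f z ('d f z).
Proof.
move=> df; split.
  split=> [x y|t x|]; [exact: linearD|exact: linearZ|].
  have := @diff_continuous _ _ _ _ _ df 0.
  rewrite /continuous_at linear0 => /cvgrPdist_lt /(_ 1 ltr01) /nbhs_nrmP[d d0 hd].
  exists (2 / d) => h; have [h0|h0] := eqVneq (nrm h) 0.
    by rewrite (nrm_eq0 h0) linear0 normc0 nrm0 mulr0.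
  have hp : 0 < nrm h by rewrite lt_def h0 nrm_ge0.
  have tp : 0 < d / 2 / nrm h by rewrite !divr_gt0.
  have nt : normc ((d / 2 / nrm h)%:C) = d / 2 / nrm h by rewrite normc_real gtr0_norm.
  have := hd ((d / 2 / nrm h)%:C *: h); rewrite subr0 nrmZ nt divfK// => /(_ _).
  rewrite sub0r normrN linearZ normrc_normc => H.
  have {}H : normc ((d / 2 / nrm h)%:C * 'd f z h) < 1.
    by rewrite -ltcR; apply: H; lra.
  move: H; rewrite normcM nt mulrAC ltr_pdivrMr// mul1r => H.
  by rewrite mulrAC ler_pdivlMr//; lra.
move=> e e0; have /eqaddoP := diff_locally df.
have ec : 0 < e%:C by rewrite ltcR.
move=> /(_ _ ec) /nbhs_nrmP[d d0 hd]; exists d => // h hh.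
have := hd h; rewrite subr0 => /(_ hh) /=.
rewrite normrc_normc normr_nrm -rmorphM lecR.
rewrite [X in normc X](_ : _ = f (z + h) - f z - 'd f z h)//.
by rewrite -[LHS]/(f (h + z) - (f z + 'd f z h)) [h + z]addrC opprD addrA.
Qed.

Lemma Dat_differentiable f z (L : V -> R[i]) : clin L -> Dat f z L -> differentiable f z.
Proof.
move=> [lD lZ [K hK]] hL.
have lin : linear L by move=> a x y; rewrite lD lZ.
pose L' : {linear V -> R[i]} := HB.pack L (GRing.isLinear.Build _ _ _ _ L lin).
have cL : continuous L'.
  move=> x; apply/cvgrPdist_le => e /pos_complexE[-> e0].
  have K1 : 0 < `|K| + 1 by have := normr_ge0 K; lra.
  apply/nbhs_nrmP; exists (complex.Re e / (`|K| + 1)); first by rewrite divr_gt0.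
  move=> w; rewrite ltr_pdivlMr// => hw; rewrite -linearB normrc_normc lecR.
  apply: (le_trans (hK _)); rewrite nrmB.
  have n0 := nrm_ge0 (w - x).
  have : K * nrm (w - x) <= `|K| * nrm (w - x) by rewrite ler_wpM2r// ler_norm.
  lra.
have ex : f \o shift z = cst (f z) + L' +o_ 0 id.
  apply/eqaddoP => e /pos_complexE[-> e0]; have [d d0 hd] := hL _ e0.
  apply/nbhs_nrmP; exists d => // h; rewrite subr0 => /hd H.
  rewrite normrc_normc normr_nrm -rmorphM lecR.
  rewrite [X in normc X](_ : _ = f (z + h) - f z - L h)//.
  by rewrite -[LHS]/(f (h + z) - (f z + L h)) [h + z]addrC opprD addrA.
by apply/diff_locallyP; rewrite (diff_unique cL ex).
Qed.

Lemma cderiv_derive f z v (l : R[i]) : cderiv (fun t => f (z + t *: v)) 0 l ->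
  'D_v f z = l.
Proof.
move=> hl; apply: cvg_lim; first exact: norm_hausdorff.
apply/cvgrPdist_le => e /pos_complexE[-> e0]; have [d d0 hd] := hl _ e0.
rewrite near_withinE; apply/(@nbhs_nrmP R R[i]); exists d => // t; rewrite subr0 => ht t0.
rewrite normrc_normc lecR -(ler_pM2r (x := normc t)) ?normc_gt0// -normcM.
have := hd t ht; rewrite add0r scale0r addr0 -normcN => H; apply: le_trans H.
rewrite le_eqVlt; apply/orP; left; apply/eqP; congr normc.
rewrite /= /shift /= mulrBl [t *: v + z]addrC.
have -> : t^-1 *: (f (z + t *: v) - f z) * t = f (z + t *: v) - f z.
  by rewrite -[t^-1 *: _]/(t^-1 * _) mulrC mulrA divff// mul1r.
ring.
Qed.

End Interface.

(** * Coordinates and the maximum norm *)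

Section RowVectors.
Context {R : realType} {n : nat}.
Implicit Types (f : 'rV[R[i]]_n -> R[i]) (z v w : 'rV[R[i]]_n) (k : 'I_n).

Lemma le_nrm_coord v k : normc (v 0 k) <= nrm v.
Proof.
have H : `|v 0 k| <= mx_norm v.
  by rewrite mx_normE -[leLHS]nngE num_le; exact: (le_bigmax _ _ (ord0, k)).
by move: H; rewrite -[mx_norm v]/(`|v|) normrc_normc normr_nrm lecR.
Qed.

Lemma nrm_le_coord v (c : R) : 0 <= c -> (forall k, normc (v 0 k) <= c) -> nrm v <= c.
Proof.
move=> c0 h; have [->|v0] := eqVneq (nrm v) 0; first by [].
have [|[i k] /= e] := @mx_norm_neq0 _ _ _ v.
  by apply: contra_neq v0 => e; rewrite /nrm [`|v|]e.
by rewrite /nrm [`|v|]e ord1; exact: h.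
Qed.

End RowVectors.

(** * From coordinate discs to a local spherical bound *)

Section SeveralVariables.
Context {R : realType} {n : nat}.
Implicit Types (f : 'rV[R[i]]_n -> R[i]) (z v w : 'rV[R[i]]_n) (k : 'I_n).

Local Notation e_ k := (delta_mx 0 k : 'rV[R[i]]_n).

Lemma nrm_delta_le1 k : nrm (e_ k) <= 1.
Proof.
apply: nrm_le_coord => // j; rewrite mxE eqxx /=.
by case: eqP => _; rewrite ?normc1 ?normc0.
Qed.

Lemma row_sum_delta v : v = \sum_(k < n) v 0 k *: e_ k.
Proof. exact: row_sum_delta. Qed.

Lemma compact_nrm_ball z (r : R) : compact [set w | nrm (w - z) <= r].
Proof.
have [r0|r0] := leP 0 r; last first.
  have -> : [set w | nrm (w - z) <= r] = set0; last exact: compact0.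
  by apply/seteqP; split=> // w /= h; have := nrm_ge0 (w - z); lra.
suff -> : [set w | nrm (w - z) <= r] =
    [set w | forall k, [set x | normc (x - z 0 k) <= r] (w 0 k)].
  by apply: (@rV_compact _ n (fun k => [set x | normc (x - z 0 k) <= r])) => k; exact: compact_disc.
apply/seteqP; split=> w /= h.
  move=> k; apply: le_trans h; have := le_nrm_coord (w - z) k; by rewrite !mxE.
by apply: nrm_le_coord => // k; have := h k; rewrite !mxE.
Qed.

Lemma Dfv_delta f z k : Dfv f z (e_ k) = partial k f z.
Proof.
rewrite /Dfv (bigD1 k)//= big1 ?addr0 => [|j jk]; rewrite !mxE eqxx.
  by rewrite eqxx mulr1.
by rewrite (negbTE jk) mulr0.
Qed.

Lemma eucl_norm_delta k : eucl_norm (e_ k) = 1 :> R.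
Proof.
rewrite /eucl_norm (bigD1 k)//= big1 ?addr0 => [|j jk]; rewrite !mxE eqxx.
  by rewrite eqxx normc1 expr1n sqrtr1.
by rewrite (negbTE jk) normc0 expr0n.
Qed.

(** The unit vector [e_ k] competes in the supremum. The set is bounded above, as it must be for
    [sup] to dominate its elements, because coordinates of a Euclidean unit vector have modulus at
    most 1. *)
Lemma partial_le_spherical f z k (M : R) : spherical_deriv f z <= M ->
  normc (partial k f z) <= M * (1 + normc (f z) ^+ 2).
Proof.
move=> hM; have den : 0 < 1 + normc (f z) ^+ 2 by have := sqr_ge0 (normc (f z)); lra.
rewrite -ler_pdivrMr//; apply: le_trans hM; apply: ub_le_sup; last first.
  by exists (e_ k); [exact: eucl_norm_delta|rewrite Dfv_delta].
exists ((\sum_(j < n) normc (partial j f z)) / (1 + normc (f z) ^+ 2)) => _ [v /= v1 <-].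
rewrite ler_wpM2r ?invr_ge0 ?(ltW den)//; apply: (le_trans (le_normc_sum _ _ _)).
apply: ler_sum => j _; rewrite normcM ler_piMr ?normc_ge0//.
rewrite -v1 /eucl_norm -[X in X <= _]ger0_norm ?normc_ge0// -sqrtr_sqr.
rewrite ler_sqrt ?sumr_ge0// => [|? _]; last exact: sqr_ge0.
by rewrite (bigD1 j)//= lerDl sumr_ge0// => ? _; exact: sqr_ge0.
Qed.

Lemma partial_line f z k (t : R[i]) : differentiable f (z + t *: e_ k) ->
  cderiv (fun s => f (z + s *: e_ k)) t (partial k f (z + t *: e_ k)).
Proof.
move=> /differentiable_Dat[lin D]; have h := cderiv_line lin D.
suff -> : partial k f (z + t *: e_ k) = 'd f (z + t *: e_ k) (e_ k) by [].
apply: cderiv_derive; apply: cderiv_line lin _.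
by rewrite scale0r addr0.
Qed.

(** The derivative of the restriction to the line is the restriction of [partial k f], so holomorphy
    in one variable already provides the second derivative; differentiability of [partial k f] on
    C^n does not enter. *)
Lemma partial2_line f z k (t : R[i]) (r : R) : 0 < r ->
  (forall s, normc (s - t) < r -> differentiable f (z + s *: e_ k)) ->
  cd (cd (fun s => f (z + s *: e_ k))) t = partial k (partial k f) (z + t *: e_ k).
Proof.
move=> r0 df; set F := fun s => f (z + s *: e_ k).
have cF s : normc (s - t) < r -> cd F s = partial k f (z + s *: e_ k).
  by move=> hs; apply: cd_eq; apply: partial_line; exact: df.
have dF : disc_hol F t r.
  by move=> s hs; exists (partial k f (z + s *: e_ k)); apply: partial_line; exact: df.
symmetry; apply: cderiv_derive.
have h2 : cderiv (cd F) (t + 1 * 0) (cd (cd F) t).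
  by rewrite mul1r addr0; exact: cdP (cderiv_cd r0 dF).
have := cderiv_affine_comp h2; rewrite mul1r; apply: (@cderiv_ext _ _ _ _ _ r) => // s hs.
rewrite add0r mul1r cF; first by rewrite scalerDl addrA.
by rewrite addrAC subrr add0r.
Qed.

(** For [w] within [r] of [z], the discs of radius [r] about [w] in the coordinate directions lie in
    one closed ball of radius [2 * r] inside [D]. The constants of that ball feed the one-variable
    bound on every such disc. *)
Lemma local_spherical_bound (D : set 'rV[R[i]]_n) (F : set ('rV[R[i]]_n -> R[i])) :
  open D -> (forall f, F f -> holomorphic_on D f) ->
  (forall K : set 'rV[R[i]]_n, compact K -> K `<=` D ->
    exists (a b : R[i]) (M : R), [/\ a != b, 0 < M &
      forall f, F f -> forall z, K z -> [set a; b] (f z) ->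
        spherical_deriv f z <= M /\
        forall k : 'I_n, spherical_deriv (partial k f) z <= M]) ->
  forall z, D z -> exists2 r : R, 0 < r & exists C, forall f, F f ->
    forall w, nrm (w - z) < r -> spherical_bound f C w.
Proof.
move=> oD hol HF z Dz.
have := oD; rewrite openE => /(_ z Dz) /nbhs_nrmP[r0 r00 hr].
pose r := r0 / 3; have rp : 0 < r by rewrite divr_gt0.
have KD : [set w | nrm (w - z) <= 2 * r] `<=` D.
  by move=> w /= hw; apply: hr; rewrite /r in hw; lra.
have [a [b [M [ab M0 hM]]]] := HF _ (@compact_nrm_ball z (2 * r)) KD.
(* Bounds [1 + |f|^2] wherever [f] is [a] or [b], so [M1] bounds the first partial derivatives
   there. *)
pose A := 1 + (normc a + normc b) ^+ 2.
have na := normc_ge0 a; have nb := normc_ge0 b.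
have A1 : 1 <= A by rewrite lerDl sqr_ge0.
pose M1 := M * A; have M10 : 0 <= M1 by rewrite mulr_ge0//; lra.
(* The second summand bounds the pure second derivatives, the spherical bound being applied to a
   partial derivative of modulus at most [M1]; the sum serves for both orders at once. *)
pose M2 := M1 + M * (1 + M1 ^+ 2).
have M12 : M1 <= M2 by rewrite lerDl mulr_ge0 ?addr_ge0 ?sqr_ge0 ?(ltW M0).
have [C hC] := @ramified_bound R a b M2 r ab rp.
exists r => //; exists (n%:R * C) => f Ff w hw.
have in2 k t : normc t < r -> nrm (w + t *: e_ k - z) < 2 * r.
  move=> ht; have -> : w + t *: e_ k - z = (w - z) + t *: e_ k by rewrite addrAC.
  apply: (le_lt_trans (nrmD _ _)); rewrite nrmZ.
  have : normc t * nrm (e_ k) <= normc t by rewrite ler_piMr ?normc_ge0// nrm_delta_le1.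
  lra.
have df k t : normc t < r -> differentiable f (w + t *: e_ k).
  by move=> /(in2 k)/ltW/KD; exact: hol.
have bound k : normc (partial k f w) <= C * (1 + normc (f w) ^+ 2).
  pose G t := f (w + t *: e_ k).
  have c1 t : normc t < r -> cd G t = partial k f (w + t *: e_ k).
    by move=> ht; apply: cd_eq; apply: partial_line; exact: df.
  have c2 t : normc t < r -> cd (cd G) t = partial k (partial k f) (w + t *: e_ k).
    move=> ht; apply: (@partial2_line _ _ _ _ (r - normc t)); first lra.
    move=> s hs; apply: df; have -> : s = (s - t) + t by ring.
    by apply: (le_lt_trans (le_normcD _ _)); lra.
  have := hC G; rewrite (c1 0) ?normc0// /G scale0r addr0; apply.
    move=> t; rewrite subr0 => ht; exists (partial k f (w + t *: e_ k)).
    by apply: partial_line; exact: df.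
  move=> t ht hab; have [|h1 h2] := hM f Ff (w + t *: e_ k) (ltW (in2 k t ht)).
    by case: hab => ->; [left|right].
  have fA : 1 + normc (f (w + t *: e_ k)) ^+ 2 <= A.
    rewrite lerD2l lerXn2r ?nnegrE ?normc_ge0 ?addr_ge0//.
    by case: hab => ->; lra.
  have p1 : normc (partial k f (w + t *: e_ k)) <= M1.
    apply: (le_trans (partial_le_spherical k h1)).
    by rewrite ler_wpM2l ?(ltW M0).
  rewrite c1// c2//; split; first exact: le_trans M12.
  apply: (le_trans (partial_le_spherical k (h2 k))).
  apply: (@le_trans _ _ (M * (1 + M1 ^+ 2))); last by rewrite lerDr.
  rewrite ler_wpM2l ?(ltW M0)// lerD2l lerXn2r ?nnegrE ?normc_ge0//.
have Dw : differentiable f w by apply: (hol f Ff); apply: KD; rewrite /mkset; lra.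
have [lin DD] := differentiable_Dat Dw.
(* The differential is a sum of [n] coordinate terms, each bounded by [C]; hence the constant
   [n%:R * C]. *)
exists ('d f w); split=> // h.
have -> : 'd f w h = \sum_(k < n) h 0 k * partial k f w.
  rewrite {1}(row_sum_delta h) linear_sum; apply: eq_bigr => k _.
  rewrite linearZ; congr (_ * _); symmetry; apply: cderiv_derive.
  by apply: cderiv_line lin _; rewrite scale0r addr0.
apply: (le_trans (le_normc_sum _ _ _)).
apply: (@le_trans _ _ (\sum_(k < n) nrm h * (C * (1 + normc (f w) ^+ 2)))).
  apply: ler_sum => k _; rewrite normcM.
  by apply: ler_pM; rewrite ?normc_ge0// le_nrm_coord.
by rewrite sumr_const card_ord -[X in X <= _]mulr_natl le_eqVlt; apply/orP; left; apply/eqP; ring.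
Qed.

End SeveralVariables.

(** * Choice of a subsequence and exhaustion by compact sets *)

Section Subsequence.
Context {R : realType}.

(** Every set of [U] meets every tail, so an index beyond the previous one can be found for each
    successive requirement. *)
Lemma select_subsequence (U : set_system nat) (P : nat -> nat -> Prop) :
  ProperFilter U -> \oo `<=` U -> (forall k, U (P k)) ->
  exists2 s : nat -> nat, {homo s : i j / (i < j)%N} & forall k, P k (s k).
Proof.
move=> FU Uoo hP.
have [f hf] : {f & forall km : nat * nat, (km.2 < f km)%N /\ P km.1 (f km)}.
  apply: (@boolp.choice _ _ (fun (km : nat * nat) j => (km.2 < j)%N /\ P km.1 j)) => -[k m].
  have Um : U [set j | (m < j)%N] by apply: Uoo; exists m.+1.
  by have [j [h1 h2]] := filter_ex (filterI Um (hP k)); exists j.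
pose s := fix s k := if k is k'.+1 then f (k'.+1, s k') else f (0, 0)%N.
exists s; first by apply: (homo_ltn ltn_trans) => k; have [] := hf (k.+1, s k).
by case=> [|k]; [have [] := hf (0, 0)%N|have [] := hf (k.+1, s k)].
Qed.

(** The usual exhaustion: norm at most [k], and distance at least [1 / (k + 1)] from the complement
    of [D]. The last clause gives each point a fixed neighbourhood lying in all late [K k]. *)
Lemma exhaustion n (D : set 'rV[R[i]]_n) : open D ->
  exists K : nat -> set 'rV[R[i]]_n, [/\ forall k, compact (K k), forall k, K k `<=` D &
    forall z, D z -> exists2 r : R, 0 < r & exists k0, forall k, (k0 <= k)%N ->
      forall w, nrm (w - z) < r -> K k w].
Proof.
move=> oD.
exists (fun k => [set w | nrm (w - 0) <= k%:R] `&`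
  [set w | forall x, nrm (x - w) < k.+1%:R^-1 -> D x]); split=> [k|k w [_]|z Dz].
- apply: (@subclosed_compact _ _ [set w | nrm (w - 0) <= k%:R]).
  + apply: closedI.
      by apply: compact_closed; [exact: norm_hausdorff|exact: compact_nrm_ball].
    rewrite -[X in closed X]setCK; apply: open_closedC; rewrite openE => w /= hw.
    have [x hx] : exists x, ~ (nrm (x - w) < k.+1%:R^-1 -> D x).
      by apply: contrapT => h; apply: hw => x; apply: contrapT => h'; apply: h; exists x.
    have [xw nDx] : nrm (x - w) < k.+1%:R^-1 /\ ~ D x by apply/not_implyP.
    apply/nbhs_nrmP; exists (k.+1%:R^-1 - nrm (x - w)); first by rewrite subr_gt0.
    move=> y hy /= h; apply/nDx/h; have -> : x - y = (x - w) + (w - y) by rewrite addrA subrK.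
    by apply: (le_lt_trans (nrmD _ _)); rewrite [nrm (w - y)]nrmB addrC -ltrBrDr.
  + exact: compact_nrm_ball.
  + by move=> w [].
- by apply; rewrite subrr nrm0 invr_gt0.
have := oD; rewrite openE => /(_ z Dz) /nbhs_nrmP[d d0 hd].
exists (d / 2); first by lra.
exists (Num.truncn (nrm z + d + 2 / d)).+1 => k hk w hw.
have kb : nrm z + d + 2 / d < k%:R.
  by apply: (lt_le_trans (truncnS_gt _)); rewrite ler_nat.
have i0 : 0 < 2 / d by rewrite divr_gt0.
have nz := nrm_ge0 z.
split=> /=.
  have -> : w - 0 = (w - z) + z by rewrite subr0 subrK.
  by apply: (le_trans (nrmD _ _)); lra.
move=> x hx; apply: hd; have -> : x - z = (x - w) + (w - z) by rewrite addrA subrK.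
have kd : k.+1%:R^-1 <= d / 2.
  by rewrite -[d / 2]invf_div lef_pV2 ?posrE ?ltr0n ?divr_gt0// -natr1; lra.
apply: (le_lt_trans (nrmD _ _)); have := lt_le_trans hx kd; lra.
Qed.

Lemma uniform_cvgP (T : choiceType) (A : set T) (v : nat -> T -> R[i]) (g : T -> R[i]) :
  (forall e, 0 < e -> \forall k \near \oo, forall w, A w -> normc (v k w - g w) <= e) ->
  {uniform A, v @ \oo --> g}.
Proof.
move=> h P /uniform_nbhs[E [entE EP]].
move: entE; rewrite -entourage_ballE => -[e /= /pos_complexE[-> e0] eE].
have e2 : 0 < complex.Re e / 2 by lra.
rewrite /fmap /=; apply: filterS (h _ e2) => k hk; apply: EP => w Aw; apply: eE => /=.
rewrite -ball_normE /= normrc_normc ltcR normcB.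
by apply: (le_lt_trans (hk w Aw)); lra.
Qed.

End Subsequence.

(** * Normality of the family *)

Unset Implicit Arguments.

Theorem theorem2p6 (R : realType) (n : nat) (n_gt0 : (0 < n)%N)
    (D : set 'rV[R[i]]_n) (domD : domain D)
    (F : set ('rV[R[i]]_n -> R[i]))
    (holF : forall f, F f -> holomorphic_on D f)
    (HF : forall K : set 'rV[R[i]]_n, compact K -> K `<=` D ->
      exists (a b : R[i]) (M : R), [/\ a != b, 0 < M &
        forall f, F f -> forall z, K z -> [set a; b] (f z) ->
          spherical_deriv f z <= M /\
          forall k : 'I_n, spherical_deriv (partial k f) z <= M]) :
  normal_family D F.
Proof.
case: domD => oD cD _ u Fu.
have [U [UU Uoo]] := ultraFilterLemma eventually_filter.
have sb z : D z -> exists r C, 0 < r /\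
    U [set j | forall w, nrm (w - z) < r -> spherical_bound (u j) C w].
  move=> Dz; have [r r0 [C hC]] := local_spherical_bound oD holF HF Dz.
  by exists r, C; split=> //; apply: nearW => j; exact: hC.
have [K [cK KD Kint]] := exhaustion oD.
have [[g hg]|inf] := marty (@compact_nrm_ball R n) oD cD sb.
  (* Tying the error to the index of the compact set lets a single increasing choice of indices act
     as a diagonal sequence. *)
  have unif k : U [set j | forall w, K k w -> normc (u j w - g w) <= k.+1%:R^-1].
    have := cK k => /compact_near_coveringP cov.
    apply: (cov nat U (fun j w => normc (u j w - g w) <= k.+1%:R^-1)) => x /KD Dx.
    have [_ _ [s [M [s0 _ hs]]]] := hg x Dx.
    have k0 : 0 < k.+1%:R^-1 :> R by rewrite invr_gt0.
    exists ([set w | nrm (w - x) < s],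
      [set j | forall w, nrm (w - x) < s -> normc (u j w - g w) <= k.+1%:R^-1]) => /=.
      by split; [apply/nbhs_nrmP; exists s|exact: hs].
    by move=> [w j] /= [ws hj]; exact: hj.
  have [s sinc hs] := select_subsequence _ Uoo unif.
  exists s => //; left; exists g.
    by move=> z Dz; have [[L lL DL] _ _] := hg z Dz; exact: Dat_differentiable lL DL.
  move=> z Dz; have [r r0 [k0 hk0]] := Kint z Dz.
  exists [set w | nrm (w - z) < r]; first by apply/nbhs_nrmP; exists r.
  apply: uniform_cvgP => e e0; exists (maxn k0 (Num.truncn e^-1)) => // k /=.
  rewrite geq_max => /andP[k0k ke] w [wr _].
  apply: (le_trans (hs k w (hk0 k k0k w wr))).
  rewrite -[e]invrK lef_pV2 ?posrE ?invr_gt0// ltW// (lt_le_trans (truncnS_gt _))//.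
  by rewrite ler_nat.
(* The same diagonal device, with growing lower bounds in place of shrinking errors. *)
have unif k : U [set j | forall w, K k w -> k%:R < normc (u j w)].
  have := cK k => /compact_near_coveringP cov.
  apply: (cov nat U (fun j w => k%:R < normc (u j w))) => x /KD Dx.
  have [s s0 hs] := inf x Dx.
  exists ([set w | nrm (w - x) < s],
    [set j | forall w, nrm (w - x) < s -> k%:R < normc (u j w)]) => /=.
    by split; [apply/nbhs_nrmP; exists s|exact: hs].
  by move=> [w j] /= [ws hj]; exact: hj.
have [s sinc hs] := select_subsequence _ Uoo unif.
exists s => //; right=> z Dz; have [r r0 [k0 hk0]] := Kint z Dz.
exists [set w | nrm (w - z) < r]; first by apply/nbhs_nrmP; exists r.
move=> B; exists (maxn k0 (Num.truncn B).+1) => // k /=.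
rewrite geq_max => /andP[k0k kB] w [wr _].
apply: lt_trans (hs k w (hk0 k k0k w wr)).
by apply: (lt_le_trans (truncnS_gt _)); rewrite ler_nat.
Qed.
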